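(* Let $\mathcal{M}_L=\{T\in\mathcal{S}'_2 : T\times f\in\mathcal{S}_2\text{ for all }f\in\mathcal{S}_2\}$, where $\times$ is the twisted product, let $W:\mathcal{S}'_2\to\mathcal{S}'_2$ be the Wigner transformation and let $Z:\mathcal{S}'_2\to\mathcal{L}(\mathcal{S}_1,\mathcal{S}'_1)$ be the kernel map $(ZT)(\phi):=T\cdot\phi$. Then $ZW(\mathcal{M}_L)=\mathcal{L}(\mathcal{S}_1)$. Moreover, $\mathcal{M}_L$ is an algebra under the twisted product, and $ZW:\mathcal{M}_L\to\mathcal{L}(\mathcal{S}_1)$ is an algebra isomorphism (where $\mathcal{L}(\mathcal{S}_1)$ carries composition of operators).
   Context: Notation. $\mathcal{S}_1=\mathcal{S}(\mathbb{R})$, $\mathcal{S}_2=\mathcal{S}(\mathbb{R}^2)$ are the Schwartz spaces (complex-valued functions) and $\mathcal{S}'_1,\mathcal{S}'_2$ their duals with the strong dual topology. $\mathcal{L}(E,F)$ is the space of continuous linear maps $E\to F$ and $\mathcal{L}(E)=\mathcal{L}(E,E)$; $\mathcal{L}(\mathcal{S}_1)$ is regarded as a subspace of $\mathcal{L}(\mathcal{S}_1,\mathcal{S}'_1)$ via the inclusion $\mathcal{S}_1\subset\mathcal{S}'_1$. For $\phi,\psi\in\mathcal{S}_1$, $(\phi\otimes\psi)(q,p):=\phi(q)\psi(p)$. Pairings are bilinear and use normalized Lebesgue measures: functions are embedded in distributions by $\langle\phi,\psi\rangle=(2\pi)^{-1/2}\int_{\mathbb{R}}\phi\psi\,dx$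 on $\mathbb{R}$ and $\langle f,g\rangle=(2\pi)^{-1}\int_{\mathbb{R}^2}fg\,dq\,dp$ on $\mathbb{R}^2$. Twisted product: for $f,g\in\mathcal{S}_2$, $$(f\times g)(u)=\frac{1}{4\pi^2}\int_{\mathbb{R}^2}\int_{\mathbb{R}^2}f(v)g(w)\,e^{i(u'Jv+v'Jw+w'Ju)}\,dv\,dw,\qquad J=\begin{pmatrix}0&1\\-1&0\end{pmatrix},$$ where $u'Jv$ denotes transpose$(u)Jv$; $\times$ is an associative continuous product on $\mathcal{S}_2$. For $T\in\mathcal{S}'_2$, $f\in\mathcal{S}_2$, define $T\times f\in\mathcal{S}'_2$ by $\langle T\times f,h\rangle:=\langle T,f\times h\rangle$ for $h\in\mathcal{S}_2$. For $T\in\mathcal{S}'_2$ and $S\in\mathcal{M}_L$, the map $h\mapsto S\times h$ is continuous on $\mathcal{S}_2$, and $T\times S\in\mathcal{S}'_2$ is defined by $\langle T\times S,h\rangle:=\langle T,S\times h\rangle$. Wigner transformation: for $f\in\mathcal{S}_2$, $$(Wf)(x,y)=\frac{1}{\sqrt{2\pi}}\int_{\mathbb{R}}f\Bigl(\frac{x+y}{\sqrt2},z\Bigr)e^{i(x-y)z/\sqrt2}\,dz,$$ an isomorphism of $\mathcal{S}_2$ onto itself; it is extended to $\mathcal{S}'_2$ by transposition: $\langle WT,h\rangle:=\langle T,\overline{W}^{-1}h\rangle$, where $(\overline{W}^{-1}h)(x,y)=\frac{1}{\sqrt{2\pi}}\int_{\mathbb{R}}h\bigl(\frac{x+z}{\sqrt2},\frac{x-z}{\sqrt2}\bigr)e^{iyz}\,dz$.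 Kernel action: for $T\in\mathcal{S}'_2$, $\phi\in\mathcal{S}_1$, $T\cdot\phi\in\mathcal{S}'_1$ is defined by $\langle T\cdot\phi,\psi\rangle:=\frac{1}{\sqrt2}\langle T,\psi\otimes\phi\rangle$ for $\psi\in\mathcal{S}_1$ (so for $f\in\mathcal{S}_2$, $(f\cdot\phi)(x)=\frac{1}{\sqrt{4\pi}}\int_{\mathbb{R}}f(x,y)\phi(y)\,dy$). By the kernel theorem, $Z$ is an isomorphism of $\mathcal{S}'_2$ onto $\mathcal{L}(\mathcal{S}_1,\mathcal{S}'_1)$. *)

(* Defs.v *)
From HB Require Import structures.
From mathcomp Require Import all_boot all_order all_algebra.
From mathcomp Require Import all_classical all_reals all_analysis.
From mathcomp Require Import complex.

Set Implicit Arguments.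
Unset Strict Implicit.
Unset Printing Implicit Defensive.

Import Order.TTheory GRing.Theory Num.Theory.
Import numFieldNormedType.Exports.

Local Open Scope classical_set_scope.
Local Open Scope ring_scope.
Local Open Scope complex_scope.

Local Notation Re := complex.Re.
Local Notation Im := complex.Im.

(* The library puts no topology on R[i]; it is given the one of (R[i])^o. *)
HB.instance Definition _ (R : realType) :=
  NormedModule.copy R[i] (R[i])^o.

Section ComplexCalculus.
Variable R : realType.

Definition expi (t : R) : R[i] := cos t +i* sin t.

Definition cintegral d (T : measurableType d) (mu : {measure set T -> \bar R})
    (f : T -> R[i]) : R[i] :=
  (\int[mu]_x Re (f x)) +i* (\int[mu]_x Im (f x)).

Definition int1 (f : R -> R[i]) : R[i] := cintegral (@lebesgue_measure R) f.

Definition int2 (f : R * R -> R[i]) : R[i] :=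
  cintegral (@lebesgue_measure R \x @lebesgue_measure R)%E f.

Variable E : normedModType R.

Definition cderivable (f : E -> R[i]) (x v : E) : Prop :=
  derivable (fun y => Re (f y)) x v /\ derivable (fun y => Im (f y)) x v.

Definition cderive (f : E -> R[i]) (v x : E) : R[i] :=
  ('D_v (fun y => Re (f y)) x) +i* ('D_v (fun y => Im (f y)) x).

End ComplexCalculus.

Record frame (R : realType) := Frame {
  carrier :> normedModType R;
  axes : finType;
  axis : axes -> carrier;
  coord : axes -> carrier -> R }.

Definition line (R : realType) : frame R :=
  @Frame R (R : normedModType R) unit (fun=> 1) (fun=> id).

Definition plane (R : realType) : frame R :=
  @Frame R (R * R)%type bool
    (fun i => if i then (0, 1) else (1, 0)) (fun i x => if i then x.2 else x.1).

Section Schwartz.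
Variables (R : realType) (X : frame R).
Local Notation C := R[i].
Implicit Types (a b : seq (axes X)) (f g : X -> C).

(* Multi-indices are words in the coordinate indices: the word i1 ... ik stands
   for the partial derivative along the axes i1, ..., ik, resp. for the monomial
   x_i1 * ... * x_ik. *)
Definition pderiv b f : X -> C :=
  foldr (fun i g => cderive g (axis i)) f b.

Definition monomial a (x : X) : R := \prod_(i <- a) coord i x.

Definition weighted a b f : X -> C := fun x => (monomial a x)%:C * pderiv b f x.

Definition smooth f : Prop :=
  forall b, continuous (pderiv b f) /\
    forall (i : axes X) x, cderivable (pderiv b f) x (axis i).

Definition is_schwartz f : Prop :=
  smooth f /\ forall a b, exists M : C, forall x, `|weighted a b f x| <= M.

Definition schwartz_pred : {pred X -> C} := fun f => `[< is_schwartz f >].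

Lemma derive_lin3 (p q : R) (r s t : X -> R) (x v : X) :
  derivable r x v -> derivable s x v -> derivable t x v ->
  derivable (fun y => p * r y + q * s y + t y) x v /\
  'D_v (fun y => p * r y + q * s y + t y) x =
    p * 'D_v r x + q * 'D_v s x + 'D_v t x.
Proof.
move=> dr ds dt.
have {}dr : is_derive x v r ('D_v r x) by exact/derivableP.
have {}ds : is_derive x v s ('D_v s x) by exact/derivableP.
have {}dt : is_derive x v t ('D_v t x) by exact/derivableP.
have H := is_deriveD (is_deriveD (is_deriveZ p dr) (is_deriveZ q ds)) dt.
split; first exact: (@ex_derive _ _ _ _ _ _ _ H).
exact: (@derive_val _ _ _ _ _ _ _ H).
Qed.

Lemma ReZD (k u v : C) : Re (k * u + v) = Re k * Re u + - Im k * Im u + Re v.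
Proof. by case: k u v => [? ?] [? ?] [? ?]; rewrite mulNr. Qed.

Lemma ImZD (k u v : C) : Im (k * u + v) = Re k * Im u + Im k * Re u + Im v.
Proof. by case: k u v => [? ?] [? ?] [? ?]. Qed.

Lemma cderiveZD (k : C) f g (x v : X) :
  cderivable f x v -> cderivable g x v ->
  cderivable (k *: f + g) x v /\
  cderive (k *: f + g) v x = k * cderive f v x + cderive g v x.
Proof.
move=> [fR fI] [gR gI]; rewrite /cderivable /cderive.
have -> : (fun y => Re ((k *: f + g) y)) =
    (fun y => Re k * Re (f y) + - Im k * Im (f y) + Re (g y)).
  by apply/funext => y; exact: ReZD.
have -> : (fun y => Im ((k *: f + g) y)) =
    (fun y => Re k * Im (f y) + Im k * Re (f y) + Im (g y)).
  by apply/funext => y; exact: ImZD.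
have [d1 ->] := derive_lin3 (Re k) (- Im k) fR fI gR.
have [d2 ->] := derive_lin3 (Re k) (Im k) fI fR gI.
split; first by split.
by apply/eqP; rewrite eq_complex ReZD ImZD /= !eqxx.
Qed.

Lemma pderivZD (k : C) f g b : smooth f -> smooth g ->
  pderiv b (k *: f + g) = k *: pderiv b f + pderiv b g.
Proof.
move=> sf sg; elim: b => //= i b ->; apply/funext => x.
by have [_ ->] := cderiveZD k ((sf b).2 i x) ((sg b).2 i x).
Qed.

Lemma smoothZD (k : C) f g : smooth f -> smooth g -> smooth (k *: f + g).
Proof.
move=> sf sg b; rewrite pderivZD //; split.
  move=> x; apply: (@continuousD _ C^o).
    by apply: (@continuousZr _ C^o); exact: (sf b).1.
  exact: (sg b).1.
by move=> i x; have [] := cderiveZD k ((sf b).2 i x) ((sg b).2 i x).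
Qed.

Lemma pderiv0 b : pderiv b (0 : X -> C) = 0.
Proof.
elim: b => //= i b ->; apply/funext => x.
by rewrite /cderive !derive_cst.
Qed.

Lemma schwartz_submod_closed : submod_closed schwartz_pred.
Proof.
split.
  apply/asboolP; split=> [b|a b].
    rewrite pderiv0; split; first by move=> x; exact: cvg_cst.
    by move=> i x; split; exact: derivable_cst.
  by exists 0 => x; rewrite /weighted pderiv0 mulr0 normr0.
move=> k f g /asboolP[sf bf] /asboolP[sg bg]; apply/asboolP.
split=> [|a b]; first exact: smoothZD.
have [M hM] := bf a b; have [N hN] := bg a b.
exists (`|k| * M + N) => x; rewrite /weighted pderivZD //.
have -> : (monomial a x)%:C * (k *: pderiv b f + pderiv b g) x =
    k * weighted a b f x + weighted a b g x.
  by rewrite /weighted mulrCA -mulrDr.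
by rewrite (le_trans (ler_normD _ _)) // lerD // normrM ler_wpM2l.
Qed.

HB.instance Definition _ :=
  GRing.isSubmodClosed.Build C (X -> C) schwartz_pred schwartz_submod_closed.

Record schwartz := Schwartz {
  schwartz_fun :> X -> C;
  schwartz_funP : schwartz_fun \in schwartz_pred }.

HB.instance Definition _ := [isSub for schwartz_fun].
HB.instance Definition _ := [Choice of schwartz by <:].
HB.instance Definition _ := [SubChoice_isSubLmodule of schwartz by <:].

(* The topology generated by the seminorms sup |x^a D^b f|. *)
HB.instance Definition _ := Topological.copy schwartz
  (initial_topology (fun f : schwartz =>
    (fun ab => weighted ab.1 ab.2 f)
      : {ptws (seq (axes X) * seq (axes X)) -> {uniform X -> C}})).

(* Junk value 0 outside the Schwartz space; the functions it is applied to below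
   (twisted products, Wigner transforms and tensor products of Schwartz
   functions) are all Schwartz functions. *)
Definition to_schwartz (f : X -> C) : schwartz := insubd (0 : schwartz) f.

End Schwartz.

Definition contlin (K : numFieldType) (E F : preTopologicalLmodType K) :
  set (E -> F) := [set A | linear A /\ continuous A].
Arguments contlin {K} E F.

Section Algebras.
Variable K : pzRingType.

Definition is_algebra (V : lmodType K) (A : set V) (mul : V -> V -> V) : Prop :=
  [/\ A 0 /\ (forall k x y, A x -> A y -> A (k *: x + y)),
      forall x y, A x -> A y -> A (mul x y),
      forall k x y z, A x -> A y -> A z ->
        mul (k *: x + y) z = k *: mul x z + mul y z,
      forall k x y z, A x -> A y -> A z ->
        mul x (k *: y + z) = k *: mul x y + mul x z &
      forall x y z, A x -> A y -> A z -> mul x (mul y z) = mul (mul x y) z].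

Definition is_algebra_iso (V W : lmodType K) (A : set V) (mulA : V -> V -> V)
    (B : set W) (mulB : W -> W -> W) (F : V -> W) : Prop :=
  [/\ set_bij A B F,
      forall k x y, A x -> A y -> F (k *: x + y) = k *: F x + F y &
      forall x y, A x -> A y -> F (mulA x y) = mulB (F x) (F y)].

End Algebras.

Section PhaseSpace.
Variable R : realType.
Local Notation C := R[i].
Local Notation S1 := (schwartz (line R)).
Local Notation S2 := (schwartz (plane R)).

(* The embeddings of functions in distributions. A tempered distribution is a
   map T : schwartz X -> R[i] satisfying contlin; the operations below are
   written for arbitrary maps. *)
Definition emb1 (f : S1) : S1 -> C :=
  fun g => (Num.sqrt (2 * pi))^-1%:C * int1 (fun x => f x * g x).

Definition emb2 (f : S2) : S2 -> C :=
  fun g => (2 * pi)^-1%:C * int2 (fun u => f u * g u).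

(* u'Jv with J = ((0, 1), (-1, 0)) *)
Definition symp (u v : R * R) : R := u.1 * v.2 - u.2 * v.1.

Definition twist (f g : S2) : S2 := to_schwartz (X := plane R) (fun u =>
  (4 * pi ^+ 2)^-1%:C * int2 (fun v => int2 (fun w =>
    f v * g w * expi (symp u v + symp v w + symp w u)))).

(* T x f for a distribution T and a function f *)
Definition dtwistl (T : S2 -> C) (f : S2) : S2 -> C := fun h => T (twist f h).

Definition ML : set (S2 -> C) :=
  [set T | contlin S2 C T /\ forall f, range emb2 (dtwistl T f)].

(* The Schwartz function g with emb2 g = T, for T in the range of emb2. *)
Definition density (T : S2 -> C) : S2 := xget 0 [set g | emb2 g = T].

(* T x S for a distribution T and S in ML *)
Definition dtwist (T S : S2 -> C) : S2 -> C :=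
  fun h => T (density (dtwistl S h)).

(* The complex conjugate of the inverse of the Wigner transformation
   f |-> (2 pi)^(-1/2) * int f ((x + y) / sqrt 2, z) e^(i (x - y) z / sqrt 2) dz,
   which is also its transpose. *)
Definition Wbarinv (h : S2) : S2 := to_schwartz (X := plane R) (fun u =>
  (Num.sqrt (2 * pi))^-1%:C * int1 (fun z =>
    h ((u.1 + z) / Num.sqrt 2, (u.1 - z) / Num.sqrt 2) * expi (u.2 * z))).

Definition wigner (T : S2 -> C) : S2 -> C := fun h => T (Wbarinv h).

Definition tensor (f g : S1) : S2 :=
  to_schwartz (X := plane R) (fun u => f u.1 * g u.2).

(* phi |-> T . phi, where <T . phi, psi> = 2^(-1/2) <T, psi (x) phi> *)
Definition kernel_map (T : S2 -> C) : S1 -> (S1 -> C) :=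
  fun phi psi => (Num.sqrt 2)^-1%:C * T (tensor psi phi).

End PhaseSpace.
Arguments ML R : clear implicits.

(* Main.v *)
(** Everything is transported through V, the conjugate inverse Wigner transform:
the twisted product of V l and V k is V (k . l), where k . l is the composition
of integral kernels, and V m paired with V k is a multiple of the double
integral of k(x, y) m(y, x).  To a continuous operator A on S(R) corresponds
the distribution T_A (below, [symbol A]) sending V h to a multiple of the
trace, the integral over x of ((1 (x) A) h)(x, x).  Since 1 (x) A sends k . l
to k . ((1 (x) A) l), the product of T_A with V l is V ((1 (x) A) l); hence T_A
lies in M_L, T_A x T_B = T_{AB}, and ZW T_A = A.

Conversely let T be in M_L.  A tensor psi (x) phi is a multiple of the product
(psi (x) b) . (gamma (x) phi), so T (V (psi (x) phi)) is the integral of psi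
against a Schwartz function A phi.  The operator A is weakly continuous, hence
continuous by uniform boundedness.  T and T_A agree on tensors, hence on all
V (k . l), and the kernels k . l span a dense subspace. *)

From HB Require Import structures.
From mathcomp Require Import all_boot all_order all_algebra.
From mathcomp Require Import all_classical all_reals all_analysis measurable_realfun.
From mathcomp Require Import complex ring lra.
Require Import Defs.

Set Implicit Arguments.
Unset Strict Implicit.
Unset Printing Implicit Defensive.

Import Order.TTheory GRing.Theory Num.Theory.
Import numFieldNormedType.Exports.

Local Open Scope classical_set_scope.
Local Open Scope ring_scope.
Local Open Scope complex_scope.

Local Notation Re := complex.Re.
Local Notation Im := complex.Im.

(** * Directional derivatives of complex functions *)

(** All integrals are scalar, and derivatives are obtained from remainder bounds of order h^2. Two
    obstacles shape the converse. The operator A attached to T is known only through the integrals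
    of A phi against psi; each of them is continuous in phi for fixed psi, whereas the seminorms of
    A phi are suprema over all points. Completeness of S and a gliding hump bridge this gap. The
    second obstacle is density: the identity has no Schwartz kernel, so a kernel is not visibly a
    product k . l. It is approximated by cutting off with dilated Gaussians once in position and
    once in frequency, since such a double cut-off does have a Schwartz kernel. The constants are
    forced by the normalisations: k . l carries 1/sqrt(4 pi), the constant of the kernel action on
    functions, and the trace in T_A carries sqrt 2 / sqrt(2 pi), so that the factor 1/sqrt 2 of the
    kernel action cancels and exactly the factor 1/sqrt(2 pi) of the embedding of S(R) is left. *)

Section ComplexModulus.
Variable R : realType.
Local Notation C := R[i].
Implicit Types z w : C.

(** The norm on [R[i]] takes its values in [R[i]]; the estimates below need a modulus in the ordered
    field [R]. *)
Definition cabs z : R := ComplexField.Normc.normc z.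

Lemma normCE z : `|z| = (cabs z)%:C.
Proof. by []. Qed.

Lemma cabs_ge0 z : 0 <= cabs z.
Proof. by case: z => a b; exact: sqrtr_ge0. Qed.

Lemma cabsM z w : cabs (z * w) = cabs z * cabs w.
Proof. exact: ComplexField.Normc.normcM. Qed.

Lemma cabs0 : cabs 0 = 0.
Proof. exact: ComplexField.Normc.normc0. Qed.

Lemma cabs1 : cabs 1 = 1.
Proof. exact: ComplexField.Normc.normc1. Qed.

Lemma cabs_eq0 z : cabs z = 0 -> z = 0.
Proof. exact: ComplexField.Normc.eq0_normc. Qed.

Lemma cabsD z w : cabs (z + w) <= cabs z + cabs w.
Proof. exact: le_normcD. Qed.

Lemma cabsN z : cabs (- z) = cabs z.
Proof. exact: normcN. Qed.

Lemma cabsB z w : cabs (z - w) <= cabs z + cabs w.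
Proof. by rewrite -(cabsN w) cabsD. Qed.

Lemma cabsBC z w : cabs (z - w) = cabs (w - z).
Proof. by rewrite -cabsN opprB. Qed.

Lemma cabsR (a : R) : cabs a%:C = `|a|.
Proof. by rewrite /cabs /= expr0n /= addr0 sqrtr_sqr. Qed.

Lemma cabsi : cabs 'i = 1.
Proof. by rewrite /cabs /= expr0n /= add0r expr1n sqrtr1. Qed.

Lemma abs_Re z : `|Re z| <= cabs z.
Proof.
by case: z => a b; rewrite -sqrtr_sqr ler_wsqrtr // lerDl sqr_ge0.
Qed.

Lemma abs_Im z : `|Im z| <= cabs z.
Proof.
by case: z => a b; rewrite -sqrtr_sqr ler_wsqrtr // lerDr sqr_ge0.
Qed.

Lemma cabs_ReIm z : cabs z <= `|Re z| + `|Im z|.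
Proof.
have {1}-> : z = (Re z)%:C + 'i * (Im z)%:C.
  by case: z => a b; apply/eqP; rewrite eq_complex /=; apply/andP; split;
    apply/eqP; ring.
by apply: le_trans (cabsD _ _) _; rewrite cabsM cabsi mul1r !cabsR.
Qed.

Lemma cReD z w : Re (z + w) = Re z + Re w. Proof. by case: z; case: w. Qed.
Lemma cImD z w : Im (z + w) = Im z + Im w. Proof. by case: z; case: w. Qed.
Lemma cReN z : Re (- z) = - Re z. Proof. by case: z. Qed.
Lemma cImN z : Im (- z) = - Im z. Proof. by case: z. Qed.
Lemma ReRM (a : R) z : Re (a%:C * z) = a * Re z.
Proof. by case: z => x y /=; rewrite mul0r subr0. Qed.
Lemma ImRM (a : R) z : Im (a%:C * z) = a * Im z.
Proof. by case: z => x y /=; rewrite mul0r addr0. Qed.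

Lemma cReM z w : Re (z * w) = Re z * Re w - Im z * Im w.
Proof. by case: z; case: w. Qed.
Lemma cImM z w : Im (z * w) = Re z * Im w + Im z * Re w.
Proof. by case: z; case: w. Qed.

Lemma complex_ext z w : Re z = Re w -> Im z = Im w -> z = w.
Proof. by move=> h1 h2; apply/eqP; rewrite eq_complex h1 h2 !eqxx. Qed.

Lemma lerC_abs z (M : C) : (`|z| <= M) -> cabs z <= Re M.
Proof. by rewrite normCE; case: M => a b /= /andP[]. Qed.

End ComplexModulus.

Section Derivatives.
Variable R : realType.
Local Notation C := R[i].

(** A bound [K * h ^+ 2] on the remainder passes through integrals, continuous operators and uniform
    limits, so this one criterion serves to differentiate under an integral, under an operator and
    in a limit. *)
Lemma is_derive_quadratic (E : normedModType R) (g : E -> R) (x v : E)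
    (d K : R) :
  (forall h, `|h| <= 1 -> `|g (x + h *: v) - g x - h * d| <= K * h ^+ 2) ->
  is_derive x v g d.
Proof.
move=> H.
have Hc : (fun h : R => h^-1 *: ((g \o shift x) (h *: v) - g x)) @ 0^' --> d.
  apply/cvgrPdist_lt => e e0.
  have K0 : 0 <= `|K| + 1 by rewrite addr_ge0.
  have K1 : 0 < `|K| + 1 by rewrite ltr_wpDl.
  near=> h.
  have h0 : h != 0 by near: h; exact: nbhs_dnbhs_neq.
  have h1 : `|h| <= 1 by near: h; apply: dnbhs0_le.
  have he : `|h| < e / (`|K| + 1).
    by near: h; apply: dnbhs0_lt; exact: divr_gt0.
  rewrite /= distrC [h *: v + x]addrC.
  have -> : h^-1 *: (g (x + h *: v) - g x) - d =
      h^-1 * (g (x + h *: v) - g x - h * d).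
    rewrite /GRing.scale /= [RHS]mulrBr mulrA mulVf // mul1r //.
  rewrite normrM normfV ltr_pdivrMl ?normr_gt0 //.
  apply: le_lt_trans (H _ h1) _.
  apply: le_lt_trans (_ : (`|K| + 1) * h ^+ 2 < _).
    by rewrite ler_wpM2r ?sqr_ge0 // (le_trans (ler_norm _)) // lerDl.
  rewrite -real_normK ?num_real // expr2 mulrCA ltr_pM2l ?normr_gt0 //.
  by rewrite -ltr_pdivlMl // mulrC.
split; last exact: cvg_lim Hc.
by apply/cvg_ex; exists d.
Unshelve. all: by end_near.
Qed.

Lemma is_derive_line (E : normedModType R) (g : E -> R) (x v : E) (t d : R) :
  is_derive (x + t *: v) v g d -> is_derive t (1 : R) (fun s => g (x + s *: v)) d.
Proof.
move=> [h1 h2].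
have E0 : (fun h : R => h^-1 *: (((fun s => g (x + s *: v)) \o shift t) (h *: (1:R))
     - g (x + t *: v))) =
   (fun h => h^-1 *: ((g \o shift (x + t *: v)) (h *: v) - g (x + t *: v))).
  apply/funext => h /=; congr (_ *: (g _ - _)).
  by rewrite [h *: 1]mulr1 scalerDl addrCA addrC.
split; first by rewrite /derivable E0.
by rewrite /derive E0.
Qed.

(** Both signs of h are covered, so the intermediate point is located only by [|c| <= |h|], which is
    what a Lipschitz bound on g' can exploit. *)
Lemma real_MVT (g g' : R -> R) : (forall t, is_derive t (1:R) g (g' t)) ->
  forall h, exists2 c, `|c| <= `|h| & g h - g 0 = h * g' c.
Proof.
move=> gd.
have gc : continuous g.
  by move=> t; apply: differentiable_continuous; apply/derivable1_diffP; case: (gd t).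
move=> h; have [h0|h0] := leP 0 h.
  have [c] := MVT_segment h0 (fun x _ => gd x) (continuous_subspaceT gc).
  rewrite in_itv /= => /andP[c0 ch] ->; exists c; last by rewrite subr0 mulrC.
  by rewrite !ger0_norm.
have [c] := MVT_segment (ltW h0) (fun x _ => gd x) (continuous_subspaceT gc).
rewrite in_itv /= => /andP[c0 ch] E; exists c.
  by rewrite (ler0_norm ch) (ler0_norm (ltW h0)) lerN2.
by apply/eqP; rewrite -opprB E sub0r; apply/eqP; ring.
Qed.

Variable E : normedModType R.
Implicit Types (f g : E -> C) (x v : E).

(** [cderive] has a value even where no derivative exists; here the value is tied to existence, so
    that the rules for sums and products compose. *)
Definition isd f x v (d : C) : Prop :=
  is_derive x v (fun y => Re (f y)) (Re d) /\
  is_derive x v (fun y => Im (f y)) (Im d).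

Lemma isd_cderive f x v d : isd f x v d -> cderive f v x = d.
Proof.
by move=> [[_ h1] [_ h2]]; rewrite /cderive h1 h2; case: d {h1 h2}.
Qed.

Lemma isd_cderivable f x v d : isd f x v d -> cderivable f x v.
Proof. by move=> [[h1 _] [h2 _]]. Qed.

Lemma cderivable_isd f x v : cderivable f x v -> isd f x v (cderive f v x).
Proof. by move=> [h1 h2]; split; exact/derivableP. Qed.

Lemma isd_quadratic f x v (d : C) (K : R) :
  (forall h : R, `|h| <= 1 ->
     cabs (f (x + h *: v) - f x - h%:C * d) <= K * h ^+ 2) -> isd f x v d.
Proof.
move=> H; split; apply: (is_derive_quadratic (K := K)) => h /H; apply: le_trans.
  by apply: le_trans (abs_Re _); rewrite !(cReD, cReN) ReRM.
by apply: le_trans (abs_Im _); rewrite !(cImD, cImN) ImRM.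
Qed.

Lemma isd_ext f g x v d : f =1 g -> isd f x v d -> isd g x v d.
Proof. by move=> /funext ->. Qed.

Lemma isd_lin (k : C) f g x v d e :
  isd f x v d -> isd g x v e -> isd (fun y => k * f y + g y) x v (k * d + e).
Proof.
move=> fd ge.
have fd' := isd_cderivable fd; have ge' := isd_cderivable ge.
(* [cderiveZD] is stated for frames; only the carrier of this one matters, its axis and its
   coordinate are dummies. *)
pose X := @Frame R E unit (fun=> 0) (fun=> fun=> 0).
have [h1 h2] := @cderiveZD R X k f g x v fd' ge'.
by rewrite -(isd_cderive fd) -(isd_cderive ge) -h2; exact: cderivable_isd h1.
Qed.

Lemma isd_cst (k : C) x v : isd (fun=> k) x v 0.
Proof. by split; exact: is_derive_cst. Qed.

Lemma isdZ (k : C) f x v d : isd f x v d -> isd (fun y => k * f y) x v (k * d).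
Proof.
move=> fd; rewrite -[k * d]addr0.
apply: isd_ext (isd_lin k fd (isd_cst 0 x v)) => y; exact: addr0.
Qed.

Lemma isdD f g x v d e : isd f x v d -> isd g x v e ->
  isd (fun y => f y + g y) x v (d + e).
Proof.
move=> fd ge; rewrite -[d]mul1r.
by apply: isd_ext (isd_lin 1 fd ge) => y; rewrite mul1r.
Qed.

Lemma isdM f g x v d e : isd f x v d -> isd g x v e ->
  isd (fun y => f y * g y) x v (d * g x + f x * e).
Proof.
move=> [f1 f2] [g1 g2]; split.
  have H := is_deriveB (is_deriveM f1 g1) (is_deriveM f2 g2).
  have -> : (fun y => Re (f y * g y)) =
    (fun y => Re (f y)) * (fun y => Re (g y)) - (fun y => Im (f y)) * (fun y => Im (g y)).
    by apply/funext => y; rewrite cReM.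
  apply: is_derive_eq H _; rewrite cReD !cReM /GRing.scale /=; ring.
have H := is_deriveD (is_deriveM f1 g2) (is_deriveM f2 g1).
have -> : (fun y => Im (f y * g y)) =
    (fun y => Re (f y)) * (fun y => Im (g y)) + (fun y => Im (f y)) * (fun y => Re (g y)).
  by apply/funext => y; rewrite cImM.
apply: is_derive_eq H _; rewrite cImD !cImM /GRing.scale /=; ring.
Qed.

(** Real and imaginary parts have different intermediate points, so they are bounded separately;
    this is the origin of the factor 2. *)
Lemma isd_mvt f x v (d : R -> C) (M : R) :
  (forall t, isd f (x + t *: v) v (d t)) -> (forall t, cabs (d t) <= M) ->
  forall h, cabs (f (x + h *: v) - f x) <= 2 * M * `|h|.
Proof.
move=> fd dM h.
have [c1 _ H1] := real_MVT (fun t => is_derive_line (fd t).1) h.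
have [c2 _ H2] := real_MVT (fun t => is_derive_line (fd t).2) h.
rewrite !scale0r !addr0 in H1 H2.
apply: le_trans (cabs_ReIm _) _.
rewrite cReD cReN cImD cImN H1 H2 !normrM mulrC -[X in _ + X]mulrC -mulrDl.
rewrite ler_wpM2r // mulr_natl mulr2n lerD //.
  exact: le_trans (abs_Re _) _.
exact: le_trans (abs_Im _) _.
Qed.

(** At an intermediate point c the derivative differs from [d 0] by at most M |c| <= M |h|; the
    factor 2 again counts the real and the imaginary part. *)
Lemma isd_taylor f x v (d : R -> C) (M : R) :
  (forall t, isd f (x + t *: v) v (d t)) ->
  (forall t, cabs (d t - d 0) <= M * `|t|) ->
  forall h, cabs (f (x + h *: v) - f x - h%:C * d 0) <= 2 * M * h ^+ 2.
Proof.
move=> fd dM h.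
have M0 : 0 <= M.
  by have := le_trans (cabs_ge0 _) (dM 1); rewrite normr1 mulr1.
have [c1 ch1 H1] := real_MVT (fun t => is_derive_line (fd t).1) h.
have [c2 ch2 H2] := real_MVT (fun t => is_derive_line (fd t).2) h.
rewrite !scale0r !addr0 in H1 H2.
apply: le_trans (cabs_ReIm _) _.
rewrite !(cReD, cReN, cImD, cImN) ReRM ImRM H1 H2 -!mulrBr !normrM.
have -> : 2 * M * h ^+ 2 = `|h| * (M * `|h|) + `|h| * (M * `|h|).
  by rewrite -(real_normK (num_real h)); ring.
apply: lerD; apply: ler_wpM2l => //.
  have := abs_Re (d c1 - d 0); rewrite cReD cReN => /le_trans; apply.
  by rewrite (le_trans (dM _)) // ler_wpM2l.
have := abs_Im (d c2 - d 0); rewrite cImD cImN => /le_trans; apply.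
by rewrite (le_trans (dM _)) // ler_wpM2l.
Qed.

End Derivatives.

Section ComplexLimits.
Variables (R : realType) (T : Type).
Local Notation C := R[i].

Lemma cvg_cabsP (F : set_system T) (FF : Filter F) (f : T -> C) (l : C) :
  f @ F --> l <-> forall e : R, 0 < e -> \forall x \near F, cabs (l - f x) < e.
Proof.
split=> [/cvgrPdist_lt H e e0|H].
  have /H : 0 < e%:C by rewrite ltcR.
  by apply: filterS => x; rewrite normCE ltcR.
apply/cvgrPdist_lt => e; case: e => a b /andP[/= /eqP -> a0].
by apply: filterS (H a a0) => x; rewrite normCE -[(a +i* 0)]/(a%:C) ltcR.
Qed.

End ComplexLimits.

(** * Schwartz spaces and dominated maps *)

Section Frames.
Variable R : realType.
Local Notation C := R[i].

(** The record [frame] relates its axes neither to its coordinates nor to its norm. The first clause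
    yields the derivatives of coordinates; the second yields continuity of a function from bounds on
    its partial derivatives. *)
Definition regular_frame (X : frame R) : Prop :=
  (forall (i j : axes X) x h,
     coord i (x + h *: axis j) = coord i x + h * (i == j)%:R) /\
  (forall (f : X -> C) (d : axes X -> X -> C) (K : R),
     (forall i x, isd f x (axis i) (d i x)) -> (forall i x, cabs (d i x) <= K) ->
     exists2 L, 0 <= L & forall x y, cabs (f x - f y) <= L * `|x - y|).

Lemma lipschitz_continuous (X : normedModType R) (f : X -> C) (L : R) :
  (forall x y, cabs (f x - f y) <= L * `|x - y|) -> continuous f.
Proof.
move=> fL x; apply/cvg_cabsP => e e0.
have L1 : 0 < `|L| + 1 by rewrite ltr_wpDl.
near=> y.
have : `|x - y| < e / (`|L| + 1) by near: y; apply: cvgr_dist_lt => //; exact: divr_gt0.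
rewrite ltr_pdivlMr // => H; apply: le_lt_trans (fL _ _) (le_lt_trans _ H).
by rewrite mulrC ler_wpM2l // (le_trans (ler_norm _)) // lerDl.
Unshelve. all: by end_near.
Qed.

Lemma line_regular : regular_frame (line R).
Proof.
split=> [[] [] x h /=|f d K fd dK]; first by rewrite /GRing.scale /= mulr1.
have K0 : 0 <= K by exact: le_trans (cabs_ge0 _) (dK tt 0).
exists (2 * K); first by rewrite mulr_ge0.
move=> x y; have := isd_mvt (fun t => fd tt (y + t *: (1 : R))) (fun t => dK tt _) (x - y).
by rewrite [_ *: _]mulr1 subrKC.
Qed.

Lemma plane_regular : regular_frame (plane R).
Proof.
split=> [i j [x1 x2] h /=|f d K fd dK].
  by case: i; case: j; rewrite /= ?scaler0 ?mulr0 ?addr0 // /GRing.scale /= ?mulr1 ?mulr0 ?addr0.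
have K0 : 0 <= K by exact: le_trans (cabs_ge0 _) (dK true 0).
(* The path from y to x runs through the corner (x1, y2), and each of its two legs costs [2 * K]. *)
exists (2 * K + 2 * K); first by rewrite addr_ge0 // mulr_ge0.
move=> [x1 x2] [y1 y2].
have H1 := isd_mvt (fun t => fd false (((y1, y2) : R * R) + t *: ((1, 0) : R * R)))
  (fun t => dK false _) (x1 - y1).
have H2 := isd_mvt (fun t => fd true (((x1, y2) : R * R) + t *: ((0, 1) : R * R)))
  (fun t => dK true _) (x2 - y2).
have E1 : ((y1, y2) : R * R) + (x1 - y1) *: ((1, 0) : R * R) = (x1, y2).
  by congr pair; rewrite /= /GRing.scale /= ?mulr1 ?mulr0 ?addr0 ?subrKC.
have E2 : ((x1, y2) : R * R) + (x2 - y2) *: ((0, 1) : R * R) = (x1, x2).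
  by congr pair; rewrite /= /GRing.scale /= ?mulr1 ?mulr0 ?addr0 ?subrKC.
rewrite E1 in H1; rewrite E2 in H2.
have -> : f (x1, x2) - f (y1, y2) = (f (x1, x2) - f (x1, y2)) + (f (x1, y2) - f (y1, y2)).
  by rewrite addrA subrK.
have -> : `|((x1, x2) : R * R) - (y1, y2)| = Num.max `|x1 - y1| `|x2 - y2| by [].
apply: le_trans (cabsD _ _) _; rewrite mulrDl lerD //.
  by apply: le_trans H2 _; rewrite ler_wpM2l ?mulr_ge0 // le_max lexx orbT.
by apply: le_trans H1 _; rewrite ler_wpM2l ?mulr_ge0 // le_max lexx.
Qed.

End Frames.

(* A family of functions that is bounded and, up to finite sums, stable under
   partial derivatives and under multiplication by coordinates consists of
   Schwartz functions, with the seminorms bounded in the same way as the family.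
   All memberships in S and all continuity estimates below are obtained this way.
   The parameter p of the family is, for instance, the argument of an operator. *)
Section ClassCriterion.
Variables (R : realType) (X : frame R).
Local Notation C := R[i].
Hypothesis regX : regular_frame X.
Variables (I P : Type) (Dm : (P -> R) -> Prop) (F : I -> P -> X -> C).
Hypothesis Dm0 : Dm (fun=> 0).
Hypothesis DmD : forall m n, Dm m -> Dm n -> Dm (fun p => m p + n p).
Hypothesis Fbound : forall i, exists2 m, Dm m & forall p x, cabs (F i p x) <= m p.
Hypothesis Fderiv : forall i j, exists s : seq I, forall p x,
  isd (F i p) x (axis j) (\sum_(k <- s) F k p x).
Hypothesis Fcoord : forall i j, exists s : seq I, forall p x,
  (coord j x)%:C * F i p x = \sum_(k <- s) F k p x.

(** On finite sums, derivatives and multiplications by coordinates become operations on lists of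
    indices, so that words can be treated by induction. *)
Let G (s : seq I) p x := \sum_(k <- s) F k p x.

Let Gbound s : exists2 m, Dm m & forall p x, cabs (G s p x) <= m p.
Proof.
elim: s => [|i s [m Dm_m mE]].
  by exists (fun=> 0) => // p x; rewrite /G big_nil cabs0.
have [n Dn nE] := Fbound i; exists (fun p => n p + m p); first exact: DmD.
move=> p x; rewrite /G big_cons; apply: le_trans (cabsD _ _) _.
exact: lerD (nE _ _) (mE _ _).
Qed.

Let Gderiv s j : exists s', forall p x, isd (G s p) x (axis j) (G s' p x).
Proof.
elim: s => [|i s [s' IH]].
  exists [::] => p x; rewrite /G big_nil; apply: isd_ext (isd_cst 0 x _) => y.
  by rewrite big_nil.
have [t tE] := Fderiv i j; exists (t ++ s') => p x.
rewrite /G big_cat; apply: isd_ext (isdD (tE p x) (IH p x)) => y.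
by rewrite big_cons.
Qed.

Let Gcoord s j : exists s', forall p x, (coord j x)%:C * G s p x = G s' p x.
Proof.
elim: s => [|i s [s' IH]].
  by exists [::] => p x; rewrite /G big_nil mulr0.
have [t tE] := Fcoord i j; exists (t ++ s') => p x.
by rewrite /G big_cat big_cons mulrDr tE -/(G s p x) IH.
Qed.

Let Gpderiv s b : exists s', forall p, pderiv b (G s p) = G s' p.
Proof.
elim: b => [|j b [s' IH]]; first by exists s.
have [t tE] := Gderiv s' j; exists t => p; apply/funext => x /=.
by rewrite IH; exact: isd_cderive.
Qed.

Let Gmonomial s a : exists s', forall p x, (monomial a x)%:C * G s p x = G s' p x.
Proof.
elim: a => [|j a [s' IH]].
  by exists s => p x; rewrite /monomial big_nil mul1r.
have [t tE] := Gcoord s' j; exists t => p x.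
by rewrite /monomial big_cons rmorphM /= -mulrA -/(monomial a x) IH tE.
Qed.

Let Gweighted i a b : exists s', forall p, weighted a b (F i p) = G s' p.
Proof.
have [s sE] := Gpderiv [:: i] b; have [t tE] := Gmonomial s a.
exists t => p; apply/funext => x; rewrite /weighted.
have -> : F i p = G [:: i] p by apply/funext => y; rewrite /G big_seq1.
by rewrite sE tE.
Qed.

(** Continuity of a derivative follows because it is a finite sum of members: its own partial
    derivatives are such sums too, hence bounded, and a regular frame then makes it Lipschitz. *)
Lemma class_schwartz i p : is_schwartz (F i p).
Proof.
have FG : F i p = G [:: i] p by apply/funext => y; rewrite /G big_seq1.
split=> [b|a b]; last first.
  have [s ->] := Gweighted i a b; have [m _ mE] := Gbound s.
  by exists (m p)%:C => x; rewrite normCE lecR.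
rewrite FG; have [s ->] := Gpderiv [:: i] b; split; last first.
  by move=> j x; have [t tE] := Gderiv s j; exact: isd_cderivable (tE p x).
have [t tE] := choice (Gderiv s).
have [m mE] : exists m : R, forall j x, cabs (G (t j) p x) <= m.
  have /choice[m mE] : forall j, exists m : R, forall x, cabs (G (t j) p x) <= m.
    by move=> j; have [m _ mE] := Gbound (t j); exists (m p).
  exists (\sum_j `|m j|) => j x; apply: le_trans (mE j x) _.
  by rewrite (bigD1 j) //= (le_trans (ler_norm _)) // lerDl sumr_ge0.
have [L _ LE] := regX.2 _ (fun j => G (t j) p) m (fun j => tE j p) mE.
exact: lipschitz_continuous LE.
Qed.

Lemma class_bound i a b : exists2 m, Dm m &
  forall p x, cabs (weighted a b (F i p) x) <= m p.
Proof.
have [s sE] := Gweighted i a b; have [m Dm_m mE] := Gbound s.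
by exists m => // p x; rewrite sE.
Qed.

End ClassCriterion.

Section Seminorms.
Variables (R : realType) (X : frame R).
Local Notation C := R[i].
Local Notation S := (schwartz X).
Implicit Types (f g : S) (a b : seq (axes X)).

Lemma schwartzP f : is_schwartz f.
Proof. exact: (asboolW (schwartz_funP f)). Qed.

Definition mk_schwartz (f : X -> C) (fS : is_schwartz f) : S :=
  Schwartz (asboolT fS : f \in schwartz_pred (X := X)).

Lemma schwartz_ext f g : (forall x, f x = g x) -> f = g.
Proof. by move=> /funext fg; exact/val_inj. Qed.

Lemma to_schwartzE (f : X -> C) : is_schwartz f -> forall x, to_schwartz f x = f x.
Proof. by move=> fS x; rewrite /to_schwartz insubdK //; exact: asboolT. Qed.

Lemma schwartz_linE (k : C) f g x : (k *: f + g) x = k * f x + g x.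
Proof. by []. Qed.

Lemma schwartzDE f g x : (f + g) x = f x + g x.
Proof. by []. Qed.

Lemma schwartzBE f g x : (f - g) x = f x - g x.
Proof. by []. Qed.

Lemma schwartzZE (k : C) f x : (k *: f) x = k * f x.
Proof. by []. Qed.

Lemma pderiv_linE (k : C) f g b x :
  pderiv b (k *: f + g) x = k * pderiv b f x + pderiv b g x.
Proof.
by have := pderivZD k b (schwartzP f).1 (schwartzP g).1 => /(congr1 (@^~ x)).
Qed.

Lemma weighted_linE (k : C) f g a b x :
  weighted a b (k *: f + g) x = k * weighted a b f x + weighted a b g x.
Proof. by rewrite /weighted pderiv_linE mulrDr mulrCA. Qed.

Lemma weightedBE f g a b x :
  weighted a b (f - g) x = weighted a b f x - weighted a b g x.
Proof.
by rewrite -[f - g]addrC -scaleN1r weighted_linE mulN1r addrC.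
Qed.

Definition semi (ab : seq (axes X) * seq (axes X)) f : R :=
  sup (range (fun x => cabs (weighted ab.1 ab.2 f x))).

Lemma semi_ub ab f x : cabs (weighted ab.1 ab.2 f x) <= semi ab f.
Proof.
apply: ub_le_sup; last by exists x.
have [M HM] := (schwartzP f).2 ab.1 ab.2.
by exists (Re M) => _ [y _ <-]; exact: lerC_abs.
Qed.

Lemma semi_le ab f M : (forall x, cabs (weighted ab.1 ab.2 f x) <= M) ->
  semi ab f <= M.
Proof.
move=> H; apply: ge_sup; first by exists (cabs (weighted ab.1 ab.2 f 0)); exists 0.
by move=> _ [x _ <-].
Qed.

Lemma semi_ge0 ab f : 0 <= semi ab f.
Proof. exact: le_trans (cabs_ge0 _) (semi_ub ab f 0). Qed.

Lemma semi_lin ab (k : C) f g : semi ab (k *: f + g) <= cabs k * semi ab f + semi ab g.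
Proof.
apply: semi_le => x; rewrite weighted_linE; apply: le_trans (cabsD _ _) _.
by rewrite cabsM lerD ?semi_ub // ler_wpM2l ?cabs_ge0 ?semi_ub.
Qed.

Lemma semi0 ab : semi ab 0 = 0.
Proof.
apply/eqP; rewrite eq_le semi_ge0 andbT; apply: semi_le => x.
by rewrite /weighted -[schwartz_fun _]/(0 : X -> C) pderiv0 mulr0 cabs0.
Qed.

Lemma semiZ ab (k : C) f : semi ab (k *: f) <= cabs k * semi ab f.
Proof. by have := semi_lin ab k f 0; rewrite semi0 !addr0. Qed.

Definition qs (s : seq (seq (axes X) * seq (axes X))) f : R :=
  \sum_(ab <- s) semi ab f.

Lemma qs_ge0 s f : 0 <= qs s f.
Proof. by apply: sumr_ge0 => ab _; exact: semi_ge0. Qed.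

Lemma qsZ s (k : C) f : qs s (k *: f) <= cabs k * qs s f.
Proof. by rewrite /qs mulr_sumr ler_sum // => ab _; exact: semiZ. Qed.

(* Continuity at 0 of m, in seminorm form. *)
Definition domd (m : S -> R) : Prop :=
  exists s M, 0 <= M /\ forall f, m f <= M * qs s f.

Lemma domd0 : domd (fun=> 0).
Proof. by exists [::], 0; split=> // f; rewrite mul0r. Qed.

Lemma domd_semi ab : domd (semi ab).
Proof. by exists [:: ab], 1; split=> // f; rewrite mul1r /qs big_seq1. Qed.

Lemma domdD m n : domd m -> domd n -> domd (fun f => m f + n f).
Proof.
move=> [s [M [M0 HM]]] [t [N [N0 HN]]]; exists (s ++ t), (M + N).
split=> [|f]; first exact: addr_ge0.
rewrite /qs big_cat /= -/(qs s f) -/(qs t f).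
apply: le_trans (lerD (HM f) (HN f)) _.
have := qs_ge0 s f; have := qs_ge0 t f => h1 h2.
by rewrite mulrDl lerD // mulrDr ?lerDl ?lerDr mulr_ge0.
Qed.

Lemma domd_le m n : (forall f, m f <= n f) -> domd n -> domd m.
Proof.
move=> mn [s [M [M0 HM]]]; exists s, M; split=> // f; exact: le_trans (mn f) (HM f).
Qed.

Lemma domdZ (k : R) m : 0 <= k -> domd m -> domd (fun f => k * m f).
Proof.
move=> k0 [s [M [M0 HM]]]; exists s, (k * M); split=> [|f]; first exact: mulr_ge0.
by rewrite -mulrA ler_wpM2l.
Qed.

Lemma domd_sum (J : Type) (s : seq J) (m : J -> S -> R) :
  (forall j, domd (m j)) -> domd (fun f => \sum_(j <- s) m j f).
Proof.
move=> H; elim: s => [|j s IH].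
  by apply: domd_le domd0 => f; rewrite big_nil.
by apply: domd_le (domdD (H j) IH) => f; rewrite big_cons.
Qed.

End Seminorms.

Section ContinuousLinear.
Variable R : realType.
Local Notation C := R[i].
Implicit Types X Y Z : frame R.

(* Continuous linear maps and functionals, in seminorm form: see
   [contlin_operatorP] and [contlin_functionalP]. *)
Definition clin X Y (L : schwartz X -> schwartz Y) : Prop :=
  linear L /\ forall ab, domd (fun f => semi ab (L f)).

Definition clinf X (l : schwartz X -> C) : Prop :=
  linear l /\ domd (fun f => cabs (l f)).

Lemma domd_clin X Y (L : schwartz X -> schwartz Y) (m : schwartz Y -> R) :
  clin L -> domd m -> domd (fun f => m (L f)).
Proof.
move=> [_ Ld] [s [M [M0 HM]]]; apply: domd_le (domdZ M0 (domd_sum s Ld)) => f.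
exact: HM.
Qed.

Lemma clin_comp X Y Z (L : schwartz Y -> schwartz Z) (L' : schwartz X -> schwartz Y) :
  clin L -> clin L' -> clin (L \o L').
Proof.
move=> cL cL'; split=> [k f g /=|ab]; first by rewrite cL'.1 cL.1.
exact: (domd_clin cL' (cL.2 ab)).
Qed.

Lemma clinf_comp X Y (l : schwartz Y -> C) (L : schwartz X -> schwartz Y) :
  clinf l -> clin L -> clinf (l \o L).
Proof.
move=> cl cL; split=> [k f g /=|]; first by rewrite cL.1 cl.1.
exact: (domd_clin cL cl.2).
Qed.

Lemma clin_id X : clin (@id (schwartz X)).
Proof. by split=> // ab; exact: domd_semi. Qed.

Lemma clin_lin X Y (k : C) (L M : schwartz X -> schwartz Y) :
  clin L -> clin M -> clin (fun f => k *: L f + M f).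
Proof.
move=> cL cM; split=> [c f g|ab].
  by rewrite cL.1 cM.1 scalerDr addrACA !scalerDr !scalerA [k * c]mulrC.
apply: domd_le (domdD (domdZ (cabs_ge0 k) (cL.2 ab)) (cM.2 ab)) => f.
exact: semi_lin.
Qed.

Lemma clin0 X Y : clin (fun _ : schwartz X => 0 : schwartz Y).
Proof.
split=> [k f g|ab]; first by rewrite scaler0 addr0.
by apply: domd_le (domd0 X) => f; rewrite semi0.
Qed.

Lemma clinZ X Y (k : C) (L : schwartz X -> schwartz Y) :
  clin L -> clin (fun f => k *: L f).
Proof.
move=> cL; have := clin_lin k cL (clin0 X Y).
by congr clin; apply/funext => f; rewrite addr0.
Qed.

Lemma clinf_lin X (k : C) (l m : schwartz X -> C) :
  clinf l -> clinf m -> clinf (fun f => k * l f + m f).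
Proof.
move=> cl cm; split=> [c f g|].
  rewrite cl.1 cm.1 /GRing.scale /=; ring.
apply: domd_le (domdD (domdZ (cabs_ge0 k) cl.2) cm.2) => f.
by rewrite (le_trans (cabsD _ _)) // cabsM.
Qed.

Lemma clinfZ X (k : C) (l : schwartz X -> C) :
  clinf l -> clinf (fun f => k * l f).
Proof.
move=> cl; split=> [c f g|]; first by rewrite cl.1 /GRing.scale /=; ring.
by apply: domd_le (domdZ (cabs_ge0 k) cl.2) => f; rewrite cabsM.
Qed.

Section LinearFacts.
Variables (X Y : frame R) (L : schwartz X -> schwartz Y) (l : schwartz X -> C).
Hypotheses (cL : clin L) (cl : clinf l).

Lemma clin0E : L 0 = 0.
Proof. by have := cL.1 (-1) 0 0; rewrite scaleN1r addNr scaleN1r addNr. Qed.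

Lemma clinDE f g : L (f + g) = L f + L g.
Proof. by have := cL.1 1 f g; rewrite !scale1r. Qed.

Lemma clinZE k f : L (k *: f) = k *: L f.
Proof. by have := cL.1 k f 0; rewrite clin0E !addr0. Qed.

Lemma clinBE f g : L (f - g) = L f - L g.
Proof. by rewrite -[in LHS]scaleN1r clinDE clinZE scaleN1r. Qed.

Lemma clinf0E : l 0 = 0.
Proof. by have := cl.1 (-1) 0 0; rewrite scaleN1r addNr scaleN1r addNr. Qed.

Lemma clinfDE f g : l (f + g) = l f + l g.
Proof. by have := cl.1 1 f g; rewrite !scale1r. Qed.

Lemma clinfZE k f : l (k *: f) = k * l f.
Proof. by have := cl.1 k f 0; rewrite clinf0E !addr0. Qed.

Lemma clinfBE f g : l (f - g) = l f - l g.
Proof. by rewrite -[in LHS]scaleN1r clinfDE clinfZE mulN1r. Qed.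

End LinearFacts.

(** With [domd] as the class of bounds, one verification gives both that the values lie in S and
    that the map is continuous. The index of the family usually contains an operator, so that the
    derivative of a formula is the same formula for another operator. *)
Lemma class_clin X Y (regY : regular_frame Y) (I : Type)
    (F : I -> schwartz X -> Y -> C) (i : I) :
  (forall i, exists2 m, domd m &
     forall f x, cabs (F i f x) <= m f) ->
  (forall i j, exists s : seq I, forall f x,
     isd (F i f) x (axis j) (\sum_(k <- s) F k f x)) ->
  (forall i j, exists s : seq I, forall f x,
     (coord j x)%:C * F i f x = \sum_(k <- s) F k f x) ->
  (forall k f g x, F i (k *: f + g) x = k * F i f x + F i g x) ->
  exists2 L, clin L & forall f x, L f x = F i f x.
Proof.
move=> Fb Fd Fc Flin.
have FS := class_schwartz regY (domd0 X) (@domdD _ X) Fb Fd Fc i.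
exists (fun f => mk_schwartz (FS f)) => //; split=> [k f g|ab].
  by apply: schwartz_ext => x; rewrite schwartz_linE /= Flin.
have [m md mE] := class_bound (domd0 X) (@domdD _ X) Fb Fd Fc i ab.1 ab.2.
by apply: domd_le md => f; apply: semi_le => x; exact: mE.
Qed.

End ContinuousLinear.

Section DerivativeAndCoordinate.
Variables (R : realType) (X : frame R).
Hypothesis regX : regular_frame X.
Local Notation C := R[i].
Local Notation S := (schwartz X).
Implicit Types (f g : S) (a b : seq (axes X)).

Lemma isd_coord (i j : axes X) x : isd (fun y => (coord i y)%:C) x (axis j) (i == j)%:R.
Proof.
apply: (isd_quadratic (K := 0)) => h _; rewrite regX.1 rmorphD /= rmorphM /= rmorph_nat.
by rewrite mul0r [X in cabs X](_ : _ = 0) ?cabs0 //; ring.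
Qed.

Lemma isd_pderiv b f x i : isd (pderiv b f) x (axis i) (pderiv (i :: b) f x).
Proof. exact/cderivable_isd/((schwartzP f).1 b).2. Qed.

Let W (ab : seq (axes X) * seq (axes X)) (f : S) := weighted ab.1 ab.2 f.

Let Wderiv ab j : exists s, forall f x, isd (W ab f) x (axis j) (\sum_(k <- s) W k f x).
Proof.
case: ab => a b; elim: a => [|i a [s IH]].
  exists [:: ([::], j :: b)] => f x; rewrite big_seq1 /W /weighted /monomial big_nil mul1r.
  by apply: isd_ext (isd_pderiv b f x j) => y; rewrite big_nil mul1r.
exists ((if i == j then [:: (a, b)] else [::]) ++ [seq (i :: ab.1, ab.2) | ab <- s]) => f x.
have E : (coord i x)%:C * (\sum_(k <- s) W k f x) =
    \sum_(k <- [seq (i :: ab.1, ab.2) | ab <- s]) W k f x.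
  rewrite big_map mulr_sumr; apply: eq_bigr => ab _.
  by rewrite /W /weighted /monomial /= big_cons rmorphM /= mulrA.
rewrite big_cat /= -E.
have -> : \sum_(k <- (if i == j then [:: (a, b)] else [::])) W k f x = (i == j)%:R * W (a, b) f x.
  by case: eqP => _; rewrite ?big_seq1 ?big_nil ?mul1r ?mul0r.
apply: isd_ext (isdM (isd_coord i j x) (IH f x)) => y.
by rewrite /W /weighted /monomial /= big_cons rmorphM /= mulrA.
Qed.

Let Wcoord ab j : exists s, forall f x, (coord j x)%:C * W ab f x = \sum_(k <- s) W k f x.
Proof.
exists [:: (j :: ab.1, ab.2)] => f x.
by rewrite big_seq1 /W /weighted /monomial /= big_cons rmorphM /= mulrA.
Qed.

(** The family of all x^a D^b f is closed by the Leibniz rule: differentiating along j a word that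
    starts with i produces, when i = j, the extra term without that letter. *)
Lemma weighted_clin a b : exists2 L, clin L & forall f x, L f x = weighted a b f x.
Proof.
apply: (class_clin regX (F := W) (i := (a, b)) _ Wderiv Wcoord).
  by move=> ab; exists (semi ab); [exact: domd_semi|move=> f x; exact: semi_ub].
move=> k f g x; exact: weighted_linE.
Qed.

Definition sw a b : S -> S := s2val (cid2 (weighted_clin a b)).
Lemma sw_clin a b : clin (sw a b). Proof. exact: (s2valP (cid2 (weighted_clin a b))). Qed.
Lemma swE a b f x : sw a b f x = weighted a b f x.
Proof. exact: (s2valP' (cid2 (weighted_clin a b))). Qed.

Definition sD (i : axes X) : S -> S := sw [::] [:: i].
Definition sX (i : axes X) : S -> S := sw [:: i] [::].

Lemma sXE i f x : sX i f x = (coord i x)%:C * f x.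
Proof. by rewrite swE /weighted /monomial big_seq1. Qed.

Lemma sDE i f x : sD i f x = cderive f (axis i) x.
Proof. by rewrite swE /weighted /monomial big_nil mul1r. Qed.

Lemma sD_clin i : clin (sD i). Proof. exact: sw_clin. Qed.
Lemma sX_clin i : clin (sX i). Proof. exact: sw_clin. Qed.

Lemma isd_schwartz f x i : isd f x (axis i) (sD i f x).
Proof. rewrite sDE; exact: (isd_pderiv [::]). Qed.

Lemma sw_foldr a b f : sw a b f = foldr sX (foldr sD f b) a.
Proof.
apply: schwartz_ext => x; rewrite swE /weighted.
have -> : pderiv b f = foldr sD f b :> (X -> C).
  by elim: b => //= i b ->; apply/funext => y; rewrite sDE.
elim: a => [|i a IH]; first by rewrite /monomial big_nil mul1r.
by rewrite /monomial big_cons rmorphM /= -mulrA -/(monomial a x) IH sXE.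
Qed.

Lemma semi_sup f x : cabs (f x) <= semi ([::], [::]) f.
Proof. by have := semi_ub ([::], [::]) f x; rewrite /weighted /monomial big_nil mul1r. Qed.

Lemma semi_sw a b f : semi ([::], [::]) (sw a b f) = semi (a, b) f.
Proof.
congr (sup _); rewrite eqEsubset; split=> _ [x _ <-]; exists x => //=;
by rewrite [in X in _ = X]/weighted /= /monomial ?big_nil ?mul1r /weighted /= /monomial ?big_nil ?mul1r swE.
Qed.

End DerivativeAndCoordinate.

(** * The topology of S described by seminorms *)

Section SchwartzTopology.
Variables (R : realType).
Local Notation C := R[i].

Lemma entourage_cabs (E : set (C * C)) : entourage E ->
  exists2 e : R, 0 < e & forall x y, cabs (x - y) < e -> E (x, y).
Proof.
rewrite -entourage_ballE => -[[a b] /andP[/= /eqP -> a0]] sub; exists a => // x y xy.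
by apply: sub => /=; rewrite -ball_normE /= normCE -[(a +i* 0)]/(a%:C) ltcR.
Qed.

Lemma cabs_entourage (e : R) : 0 < e ->
  entourage [set xy : C * C | cabs (xy.1 - xy.2) < e].
Proof.
move=> e0; rewrite -entourage_ballE; exists e%:C => /=; first by rewrite ltcR.
by move=> [x y] /=; rewrite -ball_normE /= normCE ltcR.
Qed.

Variable X : frame R.
Local Notation S := (schwartz X).

Let Phi (f : S) : {ptws (seq (axes X) * seq (axes X)) -> {uniform X -> C}} :=
  fun ab => weighted ab.1 ab.2 f.

Lemma near_semi (f0 : S) ab (e : R) : 0 < e ->
  \forall f \near f0, semi ab (f - f0) <= e.
Proof.
move=> e0.
have c1 := @initial_continuous S _ Phi f0.
have c2 := @proj_continuous _ (fun=> {uniform X -> C}) ab (Phi f0).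
have := cvg_comp _ _ c1 c2.
have /uniform_nbhs H : exists E, entourage E /\
    [set h : X -> C | forall y, [set: X] y -> E (Phi f0 ab y, h y)] `<=`
    [set h | forall y, cabs (Phi f0 ab y - h y) < e].
  exists [set xy : C * C | cabs (xy.1 - xy.2) < e].
  by split; [exact: cabs_entourage|move=> h /= H y; exact: H].
move=> /(_ _ H) H'.
have : \forall f \near f0, forall y, cabs (Phi f0 ab y - Phi f ab y) < e by exact: H'.
apply: filterS => f /= fe.
apply: semi_le => x; have := fe x.
by rewrite cabsBC weightedBE => /ltW.
Qed.

(** The sets on which a finite sum of seminorms is below e generate a filter that converges to 0 in
    the initial topology; hence this filter contains every neighbourhood of 0. *)
Lemma nbhs_qs (U : set S) : nbhs (0 : S) U ->
  exists s e, 0 < e /\ forall f : S, qs s f < e -> U f.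
Proof.
pose F : set_system S := filter_from [set se : seq (seq (axes X) * seq (axes X)) * R | 0 < se.2]
  (fun se => [set f | qs se.1 f < se.2]).
have FF : Filter F.
  apply: filter_from_filter; first by exists ([::], 1); exact: ltr01.
  move=> [s d] [t e] /= d0 e0; exists (s ++ t, Num.min d e) => /=.
    by rewrite lt_min d0.
  move=> f /=; rewrite lt_min /qs big_cat /= -!/(qs _ f) => /andP[h1 h2].
  have := qs_ge0 s f; have := qs_ge0 t f => t0 s0; split.
    by apply: le_lt_trans h1; rewrite lerDl.
  by apply: le_lt_trans h2; rewrite lerDr.
suff cF : F --> (0 : S).
  by move=> /cF [[s e] /= e0 sub]; exists s, e; split=> // f fe; exact: sub.
have cP : Phi @ F --> Phi 0.
  apply/cvg_sup => ab A [_ [[/= B Bo <-] B0 sub]].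
  apply: (@filterS _ (Phi @ F) _ _ _ sub).
  have /uniform_nbhs[E [/entourage_cabs[e e0 eE] EB]] : nbhs (Phi 0 ab : {uniform X -> C}) B.
    exact: open_nbhs_nbhs.
  exists ([:: ab], e) => // f /=; rewrite /qs big_seq1 => fe.
  apply: EB => x _; apply: eE.
  rewrite /Phi {1}/weighted pderiv0 mulr0 sub0r cabsN.
  exact: le_lt_trans (semi_ub ab f x) fe.
move=> A [_ [[/= B Bo <-] B0 sub]]; apply: (@filterS _ F _ _ _ sub).
by apply: cP; exact: open_nbhs_nbhs.
Qed.

Lemma domd_near (m : S -> R) (f0 : S) (e : R) : 0 < e -> domd m ->
  \forall f \near f0, m (f - f0) < e.
Proof.
move=> e0 [s [M [M0 HM]]].
have H : forall d : R, 0 < d -> \forall f \near f0, qs s (f - f0) <= d * (size s)%:R.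
  move=> d d0; elim: s {HM} => [|ab s IH].
    by apply: filterS (near_semi f0 ([::], [::]) d0) => f _; rewrite /qs big_nil mulr0.
  apply: filterS2 (near_semi f0 ab d0) IH => f h1 h2.
  by rewrite /qs big_cons -/(qs s _) /= -add1n natrD mulrDr mulr1 lerD.
pose d := e / ((M + 1) * ((size s)%:R + 1)).
have M1 : 0 < M + 1 by rewrite ltr_wpDl.
have s1 : 0 < (size s)%:R + 1 :> R by rewrite ltr_wpDl.
have d0 : 0 < d by rewrite divr_gt0 // mulr_gt0.
apply: filterS (H d d0) => f fd; apply: le_lt_trans (HM _) _.
apply: le_lt_trans (ler_wpM2l M0 fd) _.
have -> : e = (M + 1) * (d * ((size s)%:R + 1)).
  by rewrite /d; field; rewrite !gt_eqF.
apply: ltr_pM => //; last 2 first.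
- by rewrite ltrDl.
- by rewrite ltr_pM2l // ltrDl.
- by rewrite mulr_ge0 // ltW.
Qed.

Lemma clinf_continuous (l : S -> C) : clinf l -> continuous l.
Proof.
move=> cl f0; have FF : Filter (nbhs f0) by exact: nbhs_filter.
apply/(cvg_cabsP FF) => e e0.
apply: (@filterS _ (nbhs f0) _ _ _ _ (domd_near f0 e0 cl.2)) => f.
by rewrite (clinfBE cl) cabsBC.
Qed.

(** The usual scaling argument: f is scaled into the neighbourhood on which m < e, and the
    homogeneity hypothesis turns this into a bound on [m f]. The factor 2 keeps the scaled f
    strictly inside. *)
Lemma nbhs_domd (m : S -> R) (e : R) : 0 < e ->
  (forall (k : R) f, 0 <= k -> k * m f <= m (k%:C *: f)) ->
  (\forall f \near (0 : S), m f < e) -> domd m.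
Proof.
move=> e0 mZ /nbhs_qs[s [d [d0 sub]]]; exists s, (2 * e / d).
split=> [|f]; first by rewrite divr_ge0 ?mulr_ge0 ?ltW.
have H : forall k : R, 0 <= k -> k * qs s f < d -> k * m f < e.
  move=> k k0 kd; apply: le_lt_trans (mZ _ _ k0) (sub _ _).
  by apply: le_lt_trans (qsZ _ _ _) _; rewrite cabsR ger0_norm.
(* If [qs s f] vanishes, every multiple of f lies in the neighbourhood, and a positive [m f] is
   refuted by the multiple [e / m f]. *)
have [q0|q0] := eqVneq (qs s f) 0.
  rewrite q0 mulr0 leNgt; apply/negP => m0.
  have := H (e / m f); rewrite q0 mulr0 divfK ?gt_eqF // ltxx => H'.
  by suff : false by []; apply: H' => //; rewrite divr_ge0 ?ltW.
have qp : 0 < qs s f by rewrite lt0r q0 qs_ge0.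
have -> : 2 * e / d * qs s f = (d / (2 * qs s f))^-1 * e.
  by field; rewrite !gt_eqF.
rewrite ler_pdivlMl ?divr_gt0 ?mulr_gt0 //; apply/ltW/H.
  by rewrite divr_ge0 ?mulr_ge0 ?ltW.
rewrite -mulrA [X in _ * X](_ : _ = 2^-1) ?ltr_pdivrMr ?ltr_pMr ?ltr1n //.
by field; rewrite gt_eqF.
Qed.

Lemma continuous_clinf (l : S -> C) : linear l -> continuous l -> clinf l.
Proof.
move=> ll cl; split=> //.
have l0 : l 0 = 0 by have := ll (-1) 0 0; rewrite scaleN1r addNr scaleN1r addNr.
apply: (nbhs_domd ltr01) => [k f k0|].
  have -> : l (k%:C *: f) = k%:C * l f by have := ll k%:C f 0; rewrite l0 !addr0.
  by rewrite cabsM cabsR ger0_norm.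
have FF : Filter (nbhs (0 : S)) by exact: nbhs_filter.
have /(cvg_cabsP FF)/(_ 1 ltr01) := cl 0; apply: filterS => f.
by rewrite l0 sub0r cabsN.
Qed.

Lemma contlin_functionalP (l : S -> C) : contlin S C l <-> clinf l.
Proof.
split=> [[ll cl]|cl]; first exact: continuous_clinf.
by split; [exact: cl.1|exact: clinf_continuous].
Qed.

End SchwartzTopology.

Lemma contlin_operatorP (R : realType) (X Y : frame R) (L : schwartz X -> schwartz Y) :
  contlin (schwartz X) (schwartz Y) L <-> clin L.
Proof.
split=> [[lL cL]|cL].
  split=> // ab.
  have L0 : L 0 = 0 by have := lL (-1) 0 0; rewrite scaleN1r addNr scaleN1r addNr.
  apply: (nbhs_domd ltr01) => [k f k0|].
    have -> : L (k%:C *: f) = k%:C *: L f by have := lL k%:C f 0; rewrite L0 !addr0.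
    have [->|kN0] := eqVneq k 0; first by rewrite mul0r semi_ge0.
    have k_gt0 : 0 < k by rewrite lt0r kN0.
    rewrite -ler_pdivlMl //; have := semiZ ab (k^-1)%:C (k%:C *: L f).
    rewrite cabsR scalerA -rmorphM mulVf // scale1r ger0_norm //.
    by rewrite invr_ge0.
  have half : 0 < 2^-1 :> R by rewrite invr_gt0.
  have H : \forall f \near (0 : schwartz X), semi ab (L f - L 0) <= 2^-1.
    exact: cL 0 _ (near_semi (L 0) ab half).
  apply: (@filterS _ (nbhs (0 : schwartz X)) _ _ _ _ H) => f /=.
  rewrite L0 subr0 => /le_lt_trans; apply.
  by rewrite invf_lt1 ?ltr1n.
split; first exact: cL.1.
apply: continuous_comp_initial => f0.
have F0 : Filter (nbhs f0) by exact: nbhs_filter.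
apply/cvg_sup => ab A [_ [[/= B Bo <-] B0 sub]].
apply: (@filterS _ (nbhs f0) _ _ _ (preimage_subset sub)).
have /uniform_nbhs[E [/entourage_cabs[e e0 eE] EB]] :
  nbhs (weighted ab.1 ab.2 (L f0) : {uniform Y -> R[i]}) B by exact: open_nbhs_nbhs.
apply: (@filterS _ (nbhs f0) _ _ _ _ (domd_near f0 e0 (cL.2 ab))) => f fe.
apply: EB => x _; apply: eE; rewrite cabsBC.
apply: le_lt_trans fe; rewrite (clinBE cL).
apply: le_trans (semi_ub ab _ x).
by rewrite weightedBE.
Qed.

(** * Integrals on the line and on the plane *)

Section ComplexIntegral.
Context d (T : measurableType d) (R : realType) (mu : {measure set T -> \bar R}).
Local Notation C := R[i].

Definition cmeasurable (f : T -> C) : Prop :=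
  measurable_fun setT (fun x => Re (f x)) /\ measurable_fun setT (fun x => Im (f x)).

Definition cintegrable (f : T -> C) : Prop :=
  mu.-integrable setT (fun x => (Re (f x))%:E) /\
  mu.-integrable setT (fun x => (Im (f x))%:E).

Lemma cintegrable_dom (f : T -> C) (g : T -> R) : cmeasurable f ->
  mu.-integrable setT (fun x => (g x)%:E) -> (forall x, cabs (f x) <= g x) ->
  cintegrable f.
Proof.
move=> [mf1 mf2] ig fg; split; apply: le_integrable ig => //.
- exact/measurable_EFinP.
- move=> x _; rewrite !abse_EFin lee_fin.
  exact: le_trans (abs_Re _) (le_trans (fg x) (ler_norm _)).
- exact/measurable_EFinP.
- move=> x _; rewrite !abse_EFin lee_fin.
  exact: le_trans (abs_Im _) (le_trans (fg x) (ler_norm _)).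
Qed.

Lemma cintegrable_lin (k : C) f g : cintegrable f -> cintegrable g ->
  cintegrable (fun x => k * f x + g x) /\
  cintegral mu (fun x => k * f x + g x) = k * cintegral mu f + cintegral mu g.
Proof.
move=> [f1 f2] [g1 g2].
have lin3 (p q : R) (r s t : T -> R) : mu.-integrable setT (fun x => (r x)%:E) ->
  mu.-integrable setT (fun x => (s x)%:E) -> mu.-integrable setT (fun x => (t x)%:E) ->
  mu.-integrable setT (fun x => (p * r x + q * s x + t x)%:E) /\
  \int[mu]_x (p * r x + q * s x + t x) = p * \int[mu]_x r x + q * \int[mu]_x s x + \int[mu]_x t x.
  move=> ir is_ it.
  have ipr : mu.-integrable setT (EFin \o (fun x => p * r x)) := integrableZl measurableT p ir.
  have iqs : mu.-integrable setT (EFin \o (fun x => q * s x)) := integrableZl measurableT q is_.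
  have ipq : mu.-integrable setT (EFin \o (fun x => p * r x + q * s x)) := integrableD measurableT ipr iqs.
  split; first exact: (integrableD measurableT ipq it).
  by rewrite RintegralD // RintegralD // !RintegralZl.
have E1 : (fun x => Re (k * f x + g x)) =
    (fun x => Re k * Re (f x) + - Im k * Im (f x) + Re (g x)).
  by apply/funext => x; exact: ReZD.
have E2 : (fun x => Im (k * f x + g x)) =
    (fun x => Re k * Im (f x) + Im k * Re (f x) + Im (g x)).
  by apply/funext => x; exact: ImZD.
have [h1 h1'] := lin3 (Re k) (- Im k) _ _ _ f1 f2 g1.
have [h2 h2'] := lin3 (Re k) (Im k) _ _ _ f2 f1 g2.
split.
  split.
    by move: h1; congr (_.-integrable _ _); apply/funext => x; rewrite ReZD.
  by move: h2; congr (_.-integrable _ _); apply/funext => x; rewrite ImZD.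
by rewrite /cintegral E1 E2 h1' h2'; apply: complex_ext; rewrite ?ReZD ?ImZD.
Qed.

(** The factor 2 comes from bounding the integrals of the real and of the imaginary part separately;
    it reappears as the [2 * pi] of all later bounds. *)
Lemma cintegral_bound f (g : T -> R) : cmeasurable f ->
  mu.-integrable setT (fun x => (g x)%:E) -> (forall x, cabs (f x) <= g x) ->
  cabs (cintegral mu f) <= 2 * \int[mu]_x g x.
Proof.
move=> mf ig fg; have [f1 f2] := cintegrable_dom mf ig fg.
have H (h : T -> R) : mu.-integrable setT (fun x => (h x)%:E) ->
    (forall x, `|h x| <= g x) -> `|\int[mu]_x h x| <= \int[mu]_x g x.
  move=> ih hg; apply: le_trans (le_normr_Rintegral measurableT ih) _.
  apply: le_Rintegral => // .
  exact: integrable_norm ih.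
rewrite mulr_natl mulr2n; apply: le_trans (cabs_ReIm _) _; apply: lerD; apply: H => // x.
  exact: le_trans (abs_Re _) (fg x).
exact: le_trans (abs_Im _) (fg x).
Qed.

Lemma cmeasurable_lin (k : C) f g : cmeasurable f -> cmeasurable g ->
  cmeasurable (fun x => k * f x + g x).
Proof.
move=> [f1 f2] [g1 g2].
split.
  rewrite (_ : (fun x => _) = (fun x => Re k * Re (f x) + - Im k * Im (f x) + Re (g x))).
    by apply: measurable_funD => //; apply: measurable_funD; apply: measurable_funM.
  by apply/funext => x; exact: ReZD.
rewrite (_ : (fun x => _) = (fun x => Re k * Im (f x) + Im k * Re (f x) + Im (g x))).
  by apply: measurable_funD => //; apply: measurable_funD; apply: measurable_funM.
by apply/funext => x; exact: ImZD.
Qed.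

Lemma cmeasurableM f g : cmeasurable f -> cmeasurable g ->
  cmeasurable (fun x => f x * g x).
Proof.
move=> [f1 f2] [g1 g2]; split.
  rewrite (_ : (fun x => _) = (fun x => Re (f x) * Re (g x) - Im (f x) * Im (g x))).
    by apply: measurable_funB; apply: measurable_funM.
  by apply/funext => x; exact: cReM.
rewrite (_ : (fun x => _) = (fun x => Re (f x) * Im (g x) + Im (f x) * Re (g x))).
  by apply: measurable_funD; apply: measurable_funM.
by apply/funext => x; exact: cImM.
Qed.

End ComplexIntegral.

Section ContinuousParts.
Variables (R : realType) (T : topologicalType).
Local Notation C := R[i].

Lemma continuous_ReIm (f : T -> C) : continuous f ->
  continuous (fun x => Re (f x)) /\ continuous (fun x => Im (f x)).
Proof.
move=> cf; split=> x; apply/cvgrPdist_lt => e e0; have /cvg_cabsP/(_ e e0) := cf x;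
  apply: filterS => y; apply: le_lt_trans.
  by apply: le_trans (abs_Re _); rewrite cReD cReN.
by apply: le_trans (abs_Im _); rewrite cImD cImN.
Qed.

Lemma continuous_parts (f : T -> C) : continuous (fun x => Re (f x)) ->
  continuous (fun x => Im (f x)) -> continuous f.
Proof.
move=> c1 c2 x; apply/cvg_cabsP => e e0.
have e2 : 0 < e / 2 by exact: divr_gt0.
have /cvgrPdist_lt/(_ _ e2) H1 := c1 x; have /cvgrPdist_lt/(_ _ e2) H2 := c2 x.
apply: filterS2 H1 H2 => y h1 h2; apply: le_lt_trans (cabs_ReIm _) _.
by rewrite (splitr e) cReD cReN cImD cImN; exact: ltrD.
Qed.

Lemma ccontinuousM (f g : T -> C) : continuous f -> continuous g ->
  continuous (fun x => f x * g x).
Proof.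
move=> /continuous_ReIm[f1 f2] /continuous_ReIm[g1 g2]; apply: continuous_parts.
  rewrite (_ : (fun x => _) = (fun x => Re (f x) * Re (g x) - Im (f x) * Im (g x))).
    by move=> x; apply: cvgB; apply: cvgM; [exact: f1|exact: g1|exact: f2|exact: g2].
  by apply/funext => x; exact: cReM.
rewrite (_ : (fun x => _) = (fun x => Re (f x) * Im (g x) + Im (f x) * Re (g x))).
  by move=> x; apply: cvgD; apply: cvgM; [exact: f1|exact: g2|exact: f2|exact: g1].
by apply/funext => x; exact: cImM.
Qed.

End ContinuousParts.

Section LineIntegral.
Variable R : realType.
Local Notation C := R[i].
Local Notation mu := (@lebesgue_measure R).
Local Notation cmeasurableR := (@cmeasurable _ (measurableTypeR R) R).

(** The common majorant of the integrands: its integral is [pi], and multiplication by its inverse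
    is an operator on S, so every Schwartz function is dominated by a multiple of it. *)
Definition wt (x : R) : R := (1 + x ^+ 2)^-1.

Lemma wt_den x : 0 < 1 + x ^+ 2 :> R.
Proof. by rewrite ltr_pwDl // sqr_ge0. Qed.

Lemma wt_gt0 x : 0 < wt x.
Proof. by rewrite invr_gt0 wt_den. Qed.

Lemma wt_ge0 x : 0 <= wt x.
Proof. exact/ltW/wt_gt0. Qed.

Lemma wt_le1 x : wt x <= 1.
Proof. by rewrite invf_le1 ?wt_den // lerDl sqr_ge0. Qed.

Lemma wt_oneDsqr : wt = (fun x => (oneDsqr x)^-1).
Proof. by apply/funext => x; rewrite /wt /oneDsqr. Qed.

Lemma continuous_wt : continuous wt.
Proof. by rewrite wt_oneDsqr; exact: continuous_oneDsqrV. Qed.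

Lemma measurable_wt : measurable_fun setT wt.
Proof. exact: continuous_measurable_fun continuous_wt. Qed.

Lemma integral_wt : (\int[mu]_x (wt x)%:E = pi%:E)%E.
Proof.
rewrite ge0_symfun_integralT.
- rewrite (_ : [set x | _] = `[0, +oo[%classic); last first.
    by apply/seteqP; split => x/=; rewrite in_itv/= andbT.
  by rewrite wt_oneDsqr integral0y_oneDsqr -EFinM mulrCA divff // mulr1.
- exact: wt_ge0.
- exact: continuous_wt.
- by move=> x /=; rewrite /wt sqrrN.
Qed.

Lemma integrable_wt : mu.-integrable setT (fun x => (wt x)%:E).
Proof.
apply/integrableP; split; first by apply/measurable_EFinP; exact: measurable_wt.
under eq_integral do rewrite gee0_abs ?lee_fin ?wt_ge0 //.
by rewrite integral_wt ltry.
Qed.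

Lemma integrable_Mwt (M : R) : mu.-integrable setT (fun x => (M * wt x)%:E).
Proof. exact: (integrableZl measurableT M integrable_wt). Qed.

Lemma Rintegral_Mwt (M : R) : \int[mu]_x (M * wt x) = M * pi.
Proof.
by rewrite (RintegralZl _ measurableT (integrable_wt)) /Rintegral integral_wt.
Qed.

Lemma continuous_cmeasurable (f : R -> C) : continuous f -> cmeasurableR f.
Proof.
by move=> /continuous_ReIm[c1 c2]; split; exact: continuous_measurable_fun.
Qed.

(** A form of integrability with an explicit majorant; it is inherited by products with bounded
    measurable functions, such as phases and cut-offs. *)
Definition nice (f : R -> C) : Prop :=
  cmeasurableR f /\ exists M, forall x, cabs (f x) <= M * wt x.

Lemma nice_cintegrable f : nice f -> cintegrable mu f.
Proof.
move=> [mf [M fM]].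
exact: (@cintegrable_dom _ _ _ mu f (fun x => M * wt x) mf (integrable_Mwt M) fM).
Qed.

Lemma nice_lin (k : C) f g : nice f -> nice g -> nice (fun x => k * f x + g x).
Proof.
move=> [mf [M fM]] [mg [N gN]]; split; first exact: (@cmeasurable_lin _ (measurableTypeR R)).
exists (cabs k * M + N) => x; apply: le_trans (cabsD _ _) _.
by rewrite cabsM mulrDl -mulrA lerD // ler_wpM2l ?cabs_ge0.
Qed.

Lemma int1_lin (k : C) f g : nice f -> nice g ->
  int1 (fun x => k * f x + g x) = k * int1 f + int1 g.
Proof.
move=> /nice_cintegrable nf /nice_cintegrable ng.
by have [] := cintegrable_lin k nf ng.
Qed.

Lemma int1_bound f (M : R) : cmeasurableR f -> (forall x, cabs (f x) <= M * wt x) ->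
  cabs (int1 f) <= 2 * pi * M.
Proof.
move=> mf fM; have := @cintegral_bound _ _ _ mu f _ mf (integrable_Mwt M) fM.
by rewrite Rintegral_Mwt mulrCA mulrC -mulrA mulrCA mulrA.
Qed.

Lemma eq_int1 (f g : R -> C) : f =1 g -> int1 f = int1 g.
Proof. by move=> /funext ->. Qed.

Lemma int1_0 : int1 (fun _ : R => 0 : C) = 0.
Proof. by rewrite /int1 /cintegral /= /Rintegral integral0. Qed.

Lemma nice0 : nice (fun=> 0 : C).
Proof.
split; first by split; exact: measurable_cst.
by exists 0 => x; rewrite cabs0 mul0r.
Qed.

Lemma niceZ (k : C) f : nice f -> nice (fun x => k * f x).
Proof.
move=> nf; have := nice_lin k nf nice0; congr nice; apply/funext => x.
by rewrite addr0.
Qed.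

Lemma niceB f g : nice f -> nice g -> nice (fun x => f x - g x).
Proof.
move=> nf ng; have := nice_lin (-1) ng nf; congr nice; apply/funext => x.
by rewrite mulN1r addrC.
Qed.

Lemma int1Z (k : C) f : nice f -> int1 (fun x => k * f x) = k * int1 f.
Proof.
move=> nf; have := int1_lin k nf nice0; rewrite int1_0 addr0 => <-.
by apply: eq_int1 => x; rewrite addr0.
Qed.

Lemma int1B f g : nice f -> nice g -> int1 (fun x => f x - g x) = int1 f - int1 g.
Proof.
move=> nf ng; have := int1_lin (-1) ng nf; rewrite mulN1r addrC => <-.
by apply: eq_int1 => x; rewrite mulN1r addrC.
Qed.

End LineIntegral.

(** * Primitives and affine changes of variable on the line *)

Section Antiderivative.
Variable R : realType.
Local Notation C := R[i].
Local Notation mu := (@lebesgue_measure R).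
Local Notation cmeasurableR := (@cmeasurable _ (measurableTypeR R) R).

(** The Lipschitz bound makes a primitive differentiable with quadratic remainder. Of the two
    factors [wt], one is integrated and the other survives as the rate at which the primitive
    reaches its limits. *)
Definition tame (f : R -> C) : Prop :=
  (exists2 L, 0 <= L & forall x y, cabs (f x - f y) <= L * `|x - y|) /\
  (exists2 M, 0 <= M & forall x, cabs (f x) <= M * (wt x * wt x)).

Lemma tame_continuous f : tame f -> continuous f.
Proof. by move=> [[L _ fL] _]; exact: lipschitz_continuous fL. Qed.

Lemma tame_nice f : tame f -> nice f.
Proof.
move=> tf; split; first exact: continuous_cmeasurable (tame_continuous tf).
have [_ [M M0 fM]] := tf; exists M => x; apply: le_trans (fM x) _.
by rewrite ler_wpM2l // ler_piMr ?wt_le1 ?wt_ge0.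
Qed.

(** The cut-off is put into the integrand, not into the domain, so that a primitive is again an
    integral over the whole line against a bounded weight. *)
Definition chi (s t : R) : C := (\1_(`]-oo, s]%classic) t)%:C.

Lemma chiE s t : chi s t = if t <= s then 1 else 0.
Proof. by rewrite /chi indicE mem_setE in_itv /=; case: ifP. Qed.

Lemma chi_measurable s : cmeasurableR (chi s).
Proof.
by split=> /=; [apply: measurable_indic; exact: measurable_itv|exact: measurable_cst].
Qed.

Lemma cabs_chi s t : cabs (chi s t) <= 1.
Proof. by rewrite chiE; case: ifP; rewrite ?cabs0 ?cabs1. Qed.

Lemma nice_chi f s : nice f -> nice (fun t => chi s t * f t).
Proof.
move=> [mf [M fM]]; split; first exact: (@cmeasurableM _ (measurableTypeR R)) (chi_measurable s) mf.
exists M => x; rewrite cabsM; apply: le_trans (fM x).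
by rewrite ler_piMl ?cabs_ge0 ?cabs_chi.
Qed.

Definition prim (f : R -> C) (s : R) : C := int1 (fun t => chi s t * f t).

Lemma prim_step_pos f L : nice f -> 0 <= L ->
  (forall x y, cabs (f x - f y) <= L * `|x - y|) ->
  forall s h, 0 <= h -> cabs (prim f (s + h) - prim f s - h%:C * f s) <= 2 * L * h ^+ 2.
Proof.
move=> nf L0 fL s h h0.
(* The remainder is the integral of [g t * (f t - f s)], where f differs from [f s] by at most
   [L * h] on an interval of length h. *)
pose g t : R := \1_(`]s, s + h]%classic) t.
have gE t : (g t)%:C = chi (s + h) t - chi s t.
  rewrite /g !chiE indicE mem_setE in_itv /=; case: (ltP s t) => st /=.
    by case: ifP => _; rewrite subr0.
  by rewrite (le_trans st) ?lerDl // subrr.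
have i1 : mu.-integrable setT (fun t => (g t)%:E) by exact: integrable_indic_itv.
have ig (c : R) : mu.-integrable setT (fun t => (c * g t)%:E).
  exact: (integrableZl measurableT c i1).
have intg : \int[mu]_t g t = h.
  rewrite /Rintegral integral_indic //= setIT lebesgue_measure_itv /= lte_fin.
  case: ltP => [_|]; first by rewrite -EFinB /= addrAC subrr add0r.
  by rewrite gerDl => h1; apply/eqP; rewrite eq_le h1 h0.
have mg : cmeasurableR (fun t => (g t)%:C).
  by split=> /=; [apply: measurable_indic; exact: measurable_itv|exact: measurable_cst].
have cg : cintegrable mu (fun t => (g t)%:C).
  apply: (@cintegrable_dom _ _ _ mu _ (fun t => 1 * g t) mg (ig 1)) => t.
  by rewrite mul1r cabsR ger0_norm // /g indicE.
have n1 := nice_cintegrable (nice_chi (s + h) nf).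
have n2 := nice_cintegrable (nice_chi s nf).
have [n3 E3] := cintegrable_lin (-1) n2 n1.
have [n4 E4] := cintegrable_lin (- f s) cg n3.
have Eg : cintegral mu (fun t => (g t)%:C) = h%:C.
  by apply: complex_ext; rewrite /= ?intg // /Rintegral integral0.
have -> : prim f (s + h) - prim f s - h%:C * f s =
    cintegral mu (fun t => - f s * (g t)%:C + (-1 * (chi s t * f t) + chi (s + h) t * f t)).
  by rewrite E4 E3 Eg -/(int1 _) -/(prim f s) -/(int1 _) -/(prim f (s + h)); ring.
have -> : 2 * L * h ^+ 2 = 2 * \int[mu]_t (L * h * g t).
  rewrite (RintegralZl _ measurableT) ?intg //.
  ring.
apply: (@cintegral_bound _ _ _ mu _ _ _ (ig _)).
  apply: (@cmeasurable_lin _ (measurableTypeR R)) => //.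
  by apply: (@cmeasurable_lin _ (measurableTypeR R)); [exact: (nice_chi s nf).1|exact: (nice_chi _ nf).1].
move=> t; rewrite (_ : _ + _ = (g t)%:C * (f t - f s)); last by rewrite gE; ring.
rewrite cabsM cabsR /g indicE mem_setE in_itv /=.
have [/andP[st ts]|_] := boolP ((s < t) && (t <= s + h)).
  rewrite normr1 mul1r mulr1; apply: le_trans (fL _ _) _; apply: ler_wpM2l => //.
  by rewrite ger0_norm ?subr_ge0 ?(ltW st) // lerBlDl.
by rewrite normr0 mul0r mulr0.
Qed.

Lemma prim_step f L : nice f -> 0 <= L ->
  (forall x y, cabs (f x - f y) <= L * `|x - y|) ->
  forall s h, cabs (prim f (s + h) - prim f s - h%:C * f s) <= 3 * L * h ^+ 2.
Proof.
move=> nf L0 fL s h; have [h0|h0] := leP 0 h.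
  apply: le_trans (prim_step_pos nf L0 fL s h0) _.
  by rewrite -!mulrA ler_wpM2r ?mulr_ge0 ?sqr_ge0 // ler_nat.
(* A negative step is read backwards from s + h. Replacing the derivative at s + h by the one at s
   costs another [L * h ^+ 2], whence the constant 3. *)
have hn : 0 <= - h by rewrite oppr_ge0 ltW.
have := prim_step_pos nf L0 fL (s + h) hn; rewrite addrK sqrrN => H.
rewrite (_ : _ - _ = - (prim f s - prim f (s + h) - (- h)%:C * f (s + h)) +
   h%:C * (f (s + h) - f s)); last by rewrite rmorphN /=; ring.
apply: le_trans (cabsD _ _) _; rewrite cabsN cabsM cabsR.
have -> : 3 * L * h ^+ 2 = 2 * L * h ^+ 2 + L * h ^+ 2 by ring.
apply: lerD => //; have := fL (s + h) s; rewrite addrAC subrr add0r => H2.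
apply: le_trans (ler_wpM2l (normr_ge0 h) H2) _.
by rewrite -(real_normK (num_real h)) mulrCA expr2.
Qed.

Lemma wt_mono (s t : R) : `|s| <= `|t| -> wt t <= wt s.
Proof.
move=> st; rewrite lef_pV2 ?posrE ?wt_den // lerD2l.
by rewrite -(real_normK (num_real s)) -(real_normK (num_real t)) lerXn2r ?nnegrE.
Qed.

(** For t <= s <= 0 one of the two factors [wt t] is at most [wt s] and leaves the integral. *)
Lemma prim_left f M : nice f -> 0 <= M -> (forall x, cabs (f x) <= M * (wt x * wt x)) ->
  forall s, s <= 0 -> cabs (prim f s) <= 2 * pi * M * wt s.
Proof.
move=> nf M0 fM s s0; rewrite -mulrA; apply: int1_bound; first exact: (nice_chi s nf).1.
move=> t; rewrite cabsM chiE; case: ifP => ts; last first.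
  by rewrite cabs0 mul0r !mulr_ge0 ?wt_ge0.
rewrite cabs1 mul1r; apply: le_trans (fM t) _; rewrite -mulrA ler_wpM2l //.
rewrite ler_wpM2r ?wt_ge0 //; apply: wt_mono.
by rewrite (ler0_norm s0) (ler0_norm (le_trans ts s0)) lerN2.
Qed.

Lemma prim_right f M : nice f -> 0 <= M -> (forall x, cabs (f x) <= M * (wt x * wt x)) ->
  forall s, 0 <= s -> cabs (prim f s - int1 f) <= 2 * pi * M * wt s.
Proof.
move=> nf M0 fM s s0; rewrite -int1B //; last exact: nice_chi.
rewrite -mulrA; apply: int1_bound.
  have := nice_lin (-1) nf (nice_chi s nf); case=> + _.
  by congr cmeasurable; apply/funext => x; rewrite mulN1r addrC.
move=> t; rewrite chiE; case: ifP => ts.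
  by rewrite mul1r subrr cabs0 !mulr_ge0 ?wt_ge0.
rewrite mul0r sub0r cabsN; apply: le_trans (fM t) _; rewrite -mulrA ler_wpM2l //.
have {}ts : s < t by rewrite ltNge ts.
rewrite ler_wpM2r ?wt_ge0 //; apply: wt_mono.
by rewrite (ger0_norm s0) (ger0_norm (ltW (le_lt_trans s0 ts))) ltW.
Qed.

Lemma quadratic_const (H : R -> C) K :
  (forall s h, `|h| <= 1 -> cabs (H (s + h) - H s) <= K * h ^+ 2) ->
  forall s t, H s = H t.
Proof.
move=> HK s t.
have d0 u : isd H (t + u *: (1 : R)) (1 : R) 0.
  apply: (isd_quadratic (K := K)) => h h1.
  by rewrite mulr0 subr0 [h *: 1]mulr1; exact: HK.
have c0 : R -> cabs (0 : C) <= 0 by rewrite cabs0.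
have := isd_mvt d0 c0 (s - t); rewrite mulr0 mul0r [_ *: _]mulr1 subrKC => H0.
by apply/eqP; rewrite -subr_eq0; apply/eqP/cabs_eq0/eqP; rewrite eq_le H0 cabs_ge0.
Qed.

Lemma le_wt_eq0 (z : C) K S : (forall N, S <= N -> cabs z <= K * wt N) -> z = 0.
Proof.
move=> H; apply/cabs_eq0/eqP; rewrite eq_le cabs_ge0 andbT leNgt; apply/negP => z0.
have K0 : 0 <= K.
  by have := le_trans (cabs_ge0 z) (H S (lexx _)); rewrite pmulr_lge0 // wt_gt0.
(* N exceeds [K / cabs z] and S, and [1 <= N] gives [N <= 1 + N ^+ 2]; thus [K * wt N] falls below
   [cabs z]. *)
pose N := K / cabs z + (1 + `|S|).
have Kz : 0 <= K / cabs z by rewrite divr_ge0 // ltW.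
have N1 : 1 <= N by rewrite /N addrCA lerDl addr_ge0.
have SN : S <= N by rewrite (le_trans (ler_norm S)) // /N addrA lerDr addr_ge0.
have := H N SN; apply/negP; rewrite -ltNge.
rewrite ltr_pdivrMr ?wt_den //.
have : K < cabs z * N.
  have S1 : 0 < 1 + `|S| by rewrite ltr_pwDl.
  by rewrite /N mulrDr mulrCA divff ?gt_eqF // mulr1 ltrDl mulr_gt0.
move=> /lt_le_trans; apply; apply: ler_wpM2l; first exact: ltW.
by rewrite (le_trans (_ : _ <= N ^+ 2)) ?lerDr // expr2 ler_peMl // (le_trans ler01).
Qed.

(* F - prim f is constant because its increments are quadratic in the step. *)
Lemma int1_antiderivative (F f : R -> C) (A B : C) (K S : R) : tame f ->
  (forall s h, `|h| <= 1 -> cabs (F (s + h) - F s - h%:C * f s) <= K * h ^+ 2) ->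
  (forall s, s <= - S -> cabs (F s - A) <= K * wt s) ->
  (forall s, S <= s -> cabs (F s - B) <= K * wt s) ->
  int1 f = B - A.
Proof.
move=> tf FK FA FB; have nf := tame_nice tf.
have [[L L0 fL] [M M0 fM]] := tf.
pose H s := F s - prim f s.
have HE : forall s t, H s = H t.
  apply: (quadratic_const (K := K + 3 * L)) => s h h1.
  rewrite (_ : _ - _ = (F (s + h) - F s - h%:C * f s) -
    (prim f (s + h) - prim f s - h%:C * f s)); last by rewrite /H; ring.
  apply: le_trans (cabsB _ _) _; rewrite mulrDl lerD //; first exact: FK.
  exact: prim_step.
apply/eqP; rewrite -subr_eq0; apply/eqP.
apply: (@le_wt_eq0 _ (K + K + (2 * pi * M + 2 * pi * M)) `|S|) => N SN.
have N0 : 0 <= N by exact: le_trans SN.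
have Nn : - N <= 0 by rewrite oppr_le0.
have {}SN : S <= N by exact: le_trans (ler_norm S) SN.
have E : int1 f - (B - A) = (F N - B) - (F (- N) - A) -
   ((prim f N - int1 f) - prim f (- N)).
  have : H N - H (- N) = 0 by rewrite (HE N (- N)) subrr.
  by rewrite /H => E0; rewrite -[LHS]addr0 -E0; ring.
rewrite E mulrDl [X in _ <= X + _]mulrDl [X in _ <= _ + X]mulrDl.
have wN : wt (- N) = wt N by rewrite /wt sqrrN.
apply: le_trans (cabsB _ _) _; apply: lerD; apply: le_trans (cabsB _ _) _; apply: lerD.
- exact: FB.
- by rewrite -wN; apply: FA; rewrite lerN2.
- exact: prim_right.
- by rewrite -wN; exact: prim_left.
Qed.

Lemma wt_affine (a b : R) : a != 0 -> exists2 K, 0 <= K &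
  forall x, wt (a * x + b) <= K * wt x.
Proof.
(* K comes from (y - b)^2 <= 2 (1 + b^2)(1 + y^2) with y = a x + b; the difference of the two sides
   is 2 + (y + b)^2 + 2 (b y)^2. *)
move=> a0; pose K := 1 + 2 * (1 + b ^+ 2) / a ^+ 2.
have a2 : 0 < a ^+ 2 by rewrite lt0r sqrf_eq0 a0 sqr_ge0.
have K1 : 0 <= 2 * (1 + b ^+ 2) / a ^+ 2 by rewrite divr_ge0 ?(ltW a2) // mulr_ge0 // addr_ge0 ?sqr_ge0.
exists K => [|x]; first by rewrite addr_ge0.
rewrite /wt ler_pdivlMr ?wt_den // mulrC ler_pdivrMr ?wt_den //.
set y := a * x + b.
have xE : x ^+ 2 = (y - b) ^+ 2 / a ^+ 2 by rewrite /y addrK exprMn mulrAC divff ?mul1r ?gt_eqF.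
have h : (y - b) ^+ 2 <= 2 * (1 + b ^+ 2) * (1 + y ^+ 2).
  rewrite -subr_ge0.
  have -> : 2 * (1 + b ^+ 2) * (1 + y ^+ 2) - (y - b) ^+ 2 = 2 + (y + b)^+2 + 2 * (b * y) ^+ 2 by ring.
  by rewrite !addr_ge0 ?sqr_ge0 // mulr_ge0 // sqr_ge0.
rewrite xE /K mulrDl mul1r lerD //.
  by rewrite lerDl sqr_ge0.
by rewrite [X in _ <= X]mulrAC ler_pM2r ?invr_gt0.
Qed.

Lemma tame_affine f (a b : R) : a != 0 -> tame f -> tame (fun x => f (a * x + b)).
Proof.
move=> a0 [[L L0 fL] [M M0 fM]]; split.
  exists (L * `|a|) => [|x y]; first by rewrite mulr_ge0.
  apply: le_trans (fL _ _) _; rewrite -mulrA -normrM ler_wpM2l //.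
  by rewrite (_ : _ - _ = a * (x - y)) //; ring.
have [K K0 KE] := wt_affine b a0; exists (M * (K * K)); first by rewrite !mulr_ge0.
move=> x; apply: le_trans (fM _) _; rewrite -mulrA ler_wpM2l // mulrACA.
by apply: ler_pM; rewrite ?wt_ge0.
Qed.

(** The function a^-1 [prim f] (a s + b) is an antiderivative of the transformed integrand. Its
    limit [a^-1 * int1 f] is taken at the right end for a > 0 and at the left end for a < 0, which
    produces the absolute value. *)
Lemma int1_affine f (a b : R) : a != 0 -> tame f ->
  int1 f = `|a|%:C * int1 (fun x => f (a * x + b)).
Proof.
move=> a0 tf; have nf := tame_nice tf.
have [[L L0 fL] [M M0 fM]] := tf.
have [K K0 KE] := wt_affine b a0.
suff H : int1 (fun x => f (a * x + b)) = a^-1%:C * (Num.sg a)%:C * int1 f.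
  rewrite H !mulrA -!rmorphM /= [X in X%:C * _](_ : _ = 1) ?mul1r //.
  by rewrite mulrC mulrA -numEsg mulfV.
pose F s := a^-1%:C * prim f (a * s + b).
have FK s h : `|h| <= 1 ->
    cabs (F (s + h) - F s - h%:C * f (a * s + b)) <= (`|a^-1| * (3 * L * a ^+ 2)) * h ^+ 2.
  move=> _; rewrite (_ : _ - _ = a^-1%:C * (prim f (a * s + b + a * h) - prim f (a * s + b)
     - (a * h)%:C * f (a * s + b))).
    rewrite cabsM cabsR -mulrA ler_wpM2l //.
    by have := prim_step nf L0 fL (a * s + b) (a * h); rewrite exprMn mulrA.
  rewrite /F (_ : a * (s + h) + b = a * s + b + a * h); last by ring.
  rewrite !mulrBr; congr (_ - _).
  by rewrite rmorphM !mulrA -rmorphM mulVf // rmorph1 mul1r.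
have CC s (c : C) : cabs (prim f (a * s + b) - c) <= 2 * pi * M * wt (a * s + b) ->
   cabs (F s - a^-1%:C * c) <= (`|a^-1| * (2 * pi * M * K)) * wt s.
  move=> H; rewrite /F -mulrBr cabsM cabsR -mulrA ler_wpM2l //.
  by apply: le_trans H _; rewrite -[X in _ <= X]mulrA ler_wpM2l // !mulr_ge0 // ?pi_ge0.
pose K1 := `|a^-1| * (3 * L * a ^+ 2); pose K2 := `|a^-1| * (2 * pi * M * K).
have K1le : K1 <= K1 + K2 by rewrite lerDl /K2 !mulr_ge0 // ?pi_ge0.
have K2le : K2 <= K1 + K2 by rewrite lerDr mulr_ge0 // mulr_ge0 ?sqr_ge0 // mulr_ge0.
have CL s : a * s + b <= 0 -> cabs (F s - 0) <= (K1 + K2) * wt s.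
  move=> sb; rewrite -[0](mulr0 a^-1%:C); apply: le_trans (CC _ _ _) _.
    by rewrite subr0; exact: prim_left.
  by rewrite ler_wpM2r ?wt_ge0.
have CR s : 0 <= a * s + b -> cabs (F s - a^-1%:C * int1 f) <= (K1 + K2) * wt s.
  move=> sb; apply: le_trans (CC _ _ _) _; first exact: prim_right.
  by rewrite ler_wpM2r ?wt_ge0.
have FK' s h : `|h| <= 1 ->
    cabs (F (s + h) - F s - h%:C * f (a * s + b)) <= (K1 + K2) * h ^+ 2.
  by move=> h1; apply: le_trans (FK s h h1) _; rewrite ler_wpM2r ?sqr_ge0.
have tf' := tame_affine b a0 tf.
(* Beyond this distance from 0 the sign of a s + b is that of a s. *)
pose S := `|b| / `|a|.
case: (ltrgt0P a) a0 => // a0 _.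
  rewrite (gtr0_sg a0) rmorph1 mulr1 (int1_antiderivative (S := S) (A := 0) (B := a^-1%:C * int1 f) tf' FK') ?subr0 //.
    move=> s sS; apply: CL.
    have : a * s <= - `|b|.
      by rewrite -ler_pdivlMl // mulrC mulNr; move: sS; rewrite /S (gtr0_norm a0).
    by move=> /(lerD)/(_ (ler_norm b)); rewrite addNr.
  move=> s sS; apply: CR.
  have : `|b| <= a * s by rewrite -ler_pdivrMl // mulrC; move: sS; rewrite /S (gtr0_norm a0).
  have := ler_norm (- b); rewrite normrN => h1 h2.
  by have := le_trans h1 h2; rewrite lerNl -subr_ge0 opprK addrC.
rewrite (ltr0_sg a0) rmorphN1 mulrN1 mulNr (int1_antiderivative (S := S) (A := a^-1%:C * int1 f) (B := 0) tf' FK') ?sub0r //.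
  move=> s sS; apply: CR.
  have : `|b| <= a * s.
    by rewrite -ler_ndivlMl // mulrC; move: sS; rewrite /S (ltr0_norm a0) invrN mulrN opprK.
  have := ler_norm (- b); rewrite normrN => h1 h2.
  by have := le_trans h1 h2; rewrite lerNl -subr_ge0 opprK addrC.
move=> s sS; apply: CL.
have : a * s <= - `|b|.
  by rewrite -ler_ndivrMl // mulrC mulNr; move: sS; rewrite /S (ltr0_norm a0) invrN mulrN.
by move=> /(lerD)/(_ (ler_norm b)); rewrite addNr.
Qed.

End Antiderivative.

(** * Fubini's theorem for continuous functions dominated by the weight *)

Section PlaneIntegral.
Variable R : realType.
Local Notation C := R[i].
Local Notation mu := (@lebesgue_measure R).
Local Notation mR := (measurableTypeR R).

Lemma pair_cvg (T : Type) (F : set_system T) (FF : Filter F) (u v : T -> R) (a b : R) :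
  u @ F --> a -> v @ F --> b -> (fun t => (u t, v t)) @ F --> ((a, b) : R * R).
Proof. by move=> ua vb; exact: (cvg_pair ua vb). Qed.

(** Measurability is meant for the product sigma-algebra. Rounding the first coordinate down to a
    grid of mesh 1/(n+1) gives a function that is measurable on each of countably many strips; these
    functions converge pointwise by continuity. *)
Lemma continuous2_measurable (f : R * R -> R) : continuous f ->
  measurable_fun setT (f : mR * mR -> R).
Proof.
move=> cf.
pose r (n : nat) (x : R) : R := (Num.floor (x * n.+1%:R))%:~R / n.+1%:R.
apply: (@measurable_fun_cvg _ _ _ setT (fun n p => f (r n p.1, p.2))).
  move=> n _ /= A mA; rewrite setTI.
  pose cell (k : int) : set R := [set x | Num.floor (x * n.+1%:R) = k].
  rewrite (_ : _ @^-1` A = \bigcup_k (cell k `*` [set y | A (f (k%:~R / n.+1%:R, y))])).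
    apply: countable_bigcupT_measurable; first exact: countableP.
    move=> k; apply: measurableX.
      have n0 : 0 < n.+1%:R :> R by rewrite ltr0n.
      rewrite (_ : cell k = `[k%:~R / n.+1%:R, (k + 1)%:~R / n.+1%:R[%classic).
        exact: measurable_itv.
      apply/seteqP; split => x; rewrite /cell /= in_itv /= ler_pdivrMr // ltr_pdivlMr //.
        by move=> <-; exact: floor_itv.
      by move=> H; apply: floor_def.
    rewrite -[X in measurable X]setTI.
    have cfk : continuous (fun y => f (k%:~R / n.+1%:R, y)).
      move=> y; apply: (cvg_comp (fun y => (k%:~R / n.+1%:R, y)) f _ (cf _)).
      by apply: pair_cvg; [exact: cvg_cst|exact: cvg_id].
    exact: (continuous_measurable_fun cfk).
  apply/seteqP; split => [[x y] /= Ap|[x y] [k _ [/= <- //]]].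
  by exists (Num.floor (x * n.+1%:R)).
move=> [x y] _.
apply: (cvg_comp (fun n => (r n x, y)) f _ (cf _)).
apply: pair_cvg; last exact: cvg_cst.
apply/cvgrPdist_lt => e e0; near=> n.
have n0 : 0 < n.+1%:R :> R by rewrite ltr0n.
have /andP[h1 h2] := floor_itv (x * n.+1%:R).
rewrite ger0_norm /r; last by rewrite subr_ge0 ler_pdivrMr.
rewrite ltrBlDl; apply: lt_trans (_ : (Num.floor (x * n.+1%:R) + 1)%:~R / n.+1%:R < _).
  by rewrite ltr_pdivlMr.
rewrite intrD mulrDl ltrD2l mul1r.
near: n; exact: near_infty_natSinv_lt (PosNum e0).
Unshelve. all: by end_near.
Qed.

Definition nice2 (F : R * R -> C) : Prop :=
  continuous F /\ exists M, forall p, cabs (F p) <= M * (wt p.1 * wt p.2).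

Lemma continuous_fst (F : R * R -> C) y : continuous F -> continuous (fun x => F (x, y)).
Proof.
move=> cF x; apply: (cvg_comp (fun x => (x, y)) F _ (cF _)).
by apply: pair_cvg; [exact: cvg_id|exact: cvg_cst].
Qed.

Lemma continuous_snd (F : R * R -> C) x : continuous F -> continuous (fun y => F (x, y)).
Proof.
move=> cF y; apply: (cvg_comp (fun y => (x, y)) F _ (cF _)).
by apply: pair_cvg; [exact: cvg_cst|exact: cvg_id].
Qed.

Lemma nice2_snd F x : nice2 F -> nice (fun y => F (x, y)).
Proof.
move=> [cF [M FM]]; split; first exact/continuous_cmeasurable/continuous_snd.
by exists (M * wt x) => y; rewrite -mulrA; exact: FM.
Qed.

Lemma nice2_fst F y : nice2 F -> nice (fun x => F (x, y)).
Proof.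
move=> [cF [M FM]]; split; first exact/continuous_cmeasurable/continuous_fst.
by exists (M * wt y) => x; rewrite -mulrA [wt y * _]mulrC; exact: FM.
Qed.

Lemma integrable_wt2 (M : R) :
  (mu \x mu)%E.-integrable setT (fun p : mR * mR => (M * (wt p.1 * wt p.2))%:E).
Proof.
apply: (integrableZl measurableT M (f := fun p : mR * mR => (wt p.1 * wt p.2)%:E)).
apply/integrable12ltyP.
  apply/measurable_EFinP; apply: measurable_funM.
    exact: (measurableT_comp (@measurable_wt R) measurable_fst).
  exact: (measurableT_comp (@measurable_wt R) measurable_snd).
rewrite (_ : (fun x => _) = (fun x => (pi * wt x)%:E)).
  have := integrable_lty measurableT (@integrable_Mwt R pi).
  by [].
apply/funext => x; under eq_integral do rewrite /= ger0_norm ?mulr_ge0 ?wt_ge0 // EFinM.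
rewrite ge0_integralZl_EFin //.
- by rewrite integral_wt -EFinM mulrC.
- by move=> y _; rewrite lee_fin wt_ge0.
- by apply/measurable_EFinP; exact: measurable_wt.
- exact: wt_ge0.
Qed.

Lemma nice2_integrable F : nice2 F -> cintegrable (mu \x mu)%E F.
Proof.
move=> [cF [M FM]].
have [c1 c2] := continuous_ReIm cF.
have mF : cmeasurable (F : mR * mR -> C) by split; exact: continuous2_measurable.
exact: (@cintegrable_dom _ _ _ (mu \x mu)%E F _ mF (integrable_wt2 M) FM).
Qed.

Lemma int2_iter12 F : nice2 F -> int2 F = int1 (fun x => int1 (fun y => F (x, y))).
Proof.
move=> nF; have [i1 i2] := nice2_integrable nF.
have H (G : mR * mR -> R) : (mu \x mu)%E.-integrable setT (EFin \o G) ->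
    (forall x, mu.-integrable setT (fun y => (G (x, y))%:E)) ->
    \int[(mu \x mu)%E]_p G p = \int[mu]_x (\int[mu]_y G (x, y)).
  move=> iG iGx; rewrite /Rintegral; congr fine.
  rewrite -(integral12_prod_meas1 iG); apply: eq_integral => x _.
  by rewrite fineK //; exact: integrable_fin_num.
rewrite /int2 /int1 /cintegral; apply: complex_ext => /=; apply: H => // x.
  exact: (nice_cintegrable (nice2_snd x nF)).1.
exact: (nice_cintegrable (nice2_snd x nF)).2.
Qed.

Lemma int2_iter21 F : nice2 F -> int2 F = int1 (fun y => int1 (fun x => F (x, y))).
Proof.
move=> nF; have [i1 i2] := nice2_integrable nF.
have H (G : mR * mR -> R) : (mu \x mu)%E.-integrable setT (EFin \o G) ->
    (forall y, mu.-integrable setT (fun x => (G (x, y))%:E)) ->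
    \int[(mu \x mu)%E]_p G p = \int[mu]_y (\int[mu]_x G (x, y)).
  move=> iG iGx; rewrite /Rintegral; congr fine.
  rewrite -(integral21_prod_meas1 iG); apply: eq_integral => y _.
  by rewrite fineK //; exact: integrable_fin_num.
rewrite /int2 /int1 /cintegral; apply: complex_ext => /=; apply: H => // y.
  exact: (nice_cintegrable (nice2_fst y nF)).1.
exact: (nice_cintegrable (nice2_fst y nF)).2.
Qed.

Lemma int1_swap F : nice2 F ->
  int1 (fun x => int1 (fun y => F (x, y))) = int1 (fun y => int1 (fun x => F (x, y))).
Proof. by move=> nF; rewrite -int2_iter12 // int2_iter21. Qed.

End PlaneIntegral.

(** * Operators on Schwartz functions of one and two variables *)

Section DifferenceQuotients.
Variables (R : realType) (E E' : normedModType R).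
Local Notation C := R[i].

(** Only the values along the two lines enter, so a derivative can be carried between spaces, for
    instance from the plane to one of its slices. *)
Lemma is_derive_quotient (f : E -> R) (g : E' -> R) a v b w d :
  (forall h : R, g (b + h *: w) = f (a + h *: v)) -> is_derive a v f d -> is_derive b w g d.
Proof.
move=> fg [h1 h2].
have E0 : (fun h : R => h^-1 *: ((g \o shift b) (h *: w) - g b)) =
    (fun h : R => h^-1 *: ((f \o shift a) (h *: v) - f a)).
  apply/funext => h /=; rewrite [_ + b]addrC fg [a + _]addrC.
  by have := fg 0; rewrite !scale0r !addr0 => ->.
by split; rewrite /derivable /derive E0.
Qed.

Lemma isd_quotient (f : E -> C) (g : E' -> C) a v b w d :
  (forall h : R, g (b + h *: w) = f (a + h *: v)) -> isd f a v d -> isd g b w d.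
Proof.
by move=> fg [h1 h2]; split; [apply: is_derive_quotient h1|apply: is_derive_quotient h2] => h;
  rewrite fg.
Qed.

End DifferenceQuotients.

Section SchwartzToolkit.
Variables (R : realType) (X : frame R).
Hypothesis regX : regular_frame X.
Local Notation C := R[i].
Local Notation S := (schwartz X).
Implicit Types (f g : S) (i j : axes X).
Local Notation sD := (sD regX).
Local Notation sX := (sX regX).

Definition snorm f : R := semi ([::], [::]) f.

Lemma cabs_snorm f x : cabs (f x) <= snorm f.
Proof. exact: semi_sup. Qed.

Lemma snorm_le f M : (forall x, cabs (f x) <= M) -> snorm f <= M.
Proof. by move=> H; apply: semi_le => x; rewrite /weighted /monomial big_nil mul1r; exact: H. Qed.

Lemma snorm_ge0 f : 0 <= snorm f.
Proof. exact: semi_ge0. Qed.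

Lemma domd_snorm : domd snorm.
Proof. exact: domd_semi. Qed.

Lemma isd_unique (f : X -> C) x v d e : isd f x v d -> isd f x v e -> d = e.
Proof. by move=> /isd_cderive <- /isd_cderive. Qed.

Lemma sD_eq f g i : (forall x, isd f x (axis i) (g x)) -> sD i f = g.
Proof.
by move=> H; apply: schwartz_ext => x; apply: isd_unique (isd_schwartz regX f x i) (H x).
Qed.

Lemma schwartz_mvt f x i (h : R) :
  cabs (f (x + h *: axis i) - f x) <= 2 * snorm (sD i f) * `|h|.
Proof.
exact: (isd_mvt (fun t => isd_schwartz regX f (x + t *: axis i) i) (fun t => cabs_snorm _ _)).
Qed.

Lemma schwartz_taylor f x i (h : R) :
  cabs (f (x + h *: axis i) - f x - h%:C * sD i f x) <=
    4 * snorm (sD i (sD i f)) * h ^+ 2.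
Proof.
have H t : cabs (sD i f (x + t *: axis i) - sD i f (x + 0 *: axis i)) <=
    2 * snorm (sD i (sD i f)) * `|t| by rewrite scale0r addr0; exact: schwartz_mvt.
have := isd_taylor (fun t => isd_schwartz regX f (x + t *: axis i) i) H h.
by rewrite scale0r addr0 => /le_trans; apply; rewrite !mulrA -natrM.
Qed.

(** The second difference is symmetric in i and j, while its leading term is not visibly so;
    comparing both expansions proves that partial derivatives commute. The first difference along j
    is expanded along i by Taylor's formula. *)
Lemma mixed_difference f i j x : exists2 K, 0 <= K & forall h : R,
  cabs (f (x + h *: axis i + h *: axis j) - f (x + h *: axis i) - f (x + h *: axis j) + f x
    - (h ^+ 2)%:C * sD j (sD i f) x) <= K * `|h| ^+ 3.
Proof.
pose g := sD i f.
pose K := 8 * snorm (sD i (sD j g)) + 4 * snorm (sD j (sD j g)).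
exists K => [|h]; first by rewrite addr_ge0 // mulr_ge0 // snorm_ge0.
pose G y := f (y + h *: axis j) - f y.
have dG t : isd G (x + t *: axis i) (axis i)
    (g (x + t *: axis i + h *: axis j) - g (x + t *: axis i)).
  have d1 : isd (fun y => f (y + h *: axis j)) (x + t *: axis i) (axis i)
      (g (x + t *: axis i + h *: axis j)).
    by apply: isd_quotient (isd_schwartz regX f _ i) => k; rewrite addrAC.
  have := isd_lin (-1) (isd_schwartz regX f (x + t *: axis i) i) d1.
  rewrite mulN1r [- _ + _]addrC; apply: isd_ext => y.
  by rewrite mulN1r addrC.
have LG t : cabs ((g (x + t *: axis i + h *: axis j) - g (x + t *: axis i)) -
    (g (x + 0 *: axis i + h *: axis j) - g (x + 0 *: axis i))) <=
    (4 * snorm (sD i (sD j g)) * `|h|) * `|t|.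
  pose G2 y := g (y + t *: axis i) - g y.
  have dG2 s : isd G2 (x + s *: axis j) (axis j)
      (sD j g (x + s *: axis j + t *: axis i) - sD j g (x + s *: axis j)).
    have d1 : isd (fun y => g (y + t *: axis i)) (x + s *: axis j) (axis j)
        (sD j g (x + s *: axis j + t *: axis i)).
      by apply: isd_quotient (isd_schwartz regX g _ j) => k; rewrite addrAC.
    have := isd_lin (-1) (isd_schwartz regX g (x + s *: axis j) j) d1.
    rewrite mulN1r [- _ + _]addrC; apply: isd_ext => y.
    by rewrite mulN1r addrC.
  have := isd_mvt dG2 (fun s => schwartz_mvt (sD j g) (x + s *: axis j) i t) h.
  rewrite scale0r addr0 /G2 [x + h *: _ + t *: _]addrAC.
  rewrite (_ : _ - _ - (_ - _) = g (x + t *: axis i + h *: axis j) - g (x + t *: axis i) -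
    (g (x + h *: axis j) - g x)); last by ring.
  move=> /le_trans; apply; rewrite le_eqVlt; apply/orP; left; apply/eqP; ring.
have H1 := isd_taylor dG LG h.
have H2 := schwartz_taylor g x j h.
rewrite scale0r addr0 in H1.
rewrite (_ : _ - _ - _ + _ - _ = (G (x + h *: axis i) - G x - h%:C * (g (x + h *: axis j) - g x)) +
   h%:C * (g (x + h *: axis j) - g x - h%:C * sD j g x)); last by rewrite /G rmorphXn /=; ring.
apply: le_trans (cabsD _ _) _; rewrite cabsM cabsR.
apply: le_trans (lerD H1 (ler_wpM2l (normr_ge0 h) H2)) _.
have -> : h ^+ 2 = `|h| ^+ 2 by rewrite real_normK ?num_real.
rewrite /K; move: (snorm _) (snorm _) => A B.
rewrite le_eqVlt; apply/orP; left; apply/eqP; ring.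
Qed.

Lemma sDC f i j : sD i (sD j f) = sD j (sD i f).
Proof.
apply: schwartz_ext => x.
have [K K0 H1] := mixed_difference f i j x; have [L L0 H2] := mixed_difference f j i x.
apply/eqP; rewrite -subr_eq0; apply/eqP/cabs_eq0/eqP; rewrite eq_le cabs_ge0 andbT.
apply/ler_addgt0Pl => e e0; rewrite addr0.
pose h := e / (K + L + 1).
have KL : 0 < K + L + 1 by rewrite ltr_wpDl // addr_ge0.
have h0 : 0 < h by rewrite divr_gt0.
have := lerD (H1 h) (H2 h); rewrite -mulrDl.
set A := sD i _ x; set B := sD j _ x => H.
have : h ^+ 2 * cabs (A - B) <= (K + L) * `|h| ^+ 3.
  apply: le_trans H; rewrite -[X in X * _]ger0_norm ?sqr_ge0 // -cabsR -cabsM.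
  rewrite [x + h *: axis j + _]addrAC; apply: le_trans (cabsB _ _).
  rewrite le_eqVlt; apply/orP; left; apply/eqP; congr cabs; ring.
rewrite (ger0_norm (ltW h0)) (_ : _ * h ^+ 3 = h ^+ 2 * ((K + L) * h)); last by ring.
rewrite ler_pM2l ?exprn_gt0 //.
move=> /le_trans; apply; rewrite /h mulrCA ger_pMr // ler_pdivrMr // mul1r.
by rewrite lerDl.
Qed.

Lemma sDX f i j : i != j -> sD i (sX j f) = sX j (sD i f).
Proof.
move=> ij; apply: sD_eq => x; rewrite sXE.
have := isdM (isd_coord regX j i x) (isd_schwartz regX f x i).
by rewrite eq_sym (negbTE ij) mul0r add0r; apply: isd_ext => y; rewrite sXE.
Qed.

(** This operator undoes the weight [wt]: decay of f along a coordinate is read off from the sup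
    norm of [sP i f]. *)
Definition sP i f : S := f + sX i (sX i f).

Lemma sPE i f x : sP i f x = (1 + coord i x ^+ 2)%:C * f x.
Proof. by rewrite /sP schwartzDE !sXE rmorphD rmorphXn /=; ring. Qed.

Lemma sP_clin i : clin (sP i).
Proof.
have := clin_lin 1 (@clin_id R X) (clin_comp (sX_clin regX i) (sX_clin regX i)).
by congr clin; apply/funext => f; rewrite scale1r.
Qed.

Lemma cabs_sP i f x : cabs (f x) = wt (coord i x) * cabs (sP i f x).
Proof.
rewrite sPE cabsM cabsR ger0_norm; last exact: ltW (wt_den _).
by rewrite mulrA mulVf ?mul1r // gt_eqF // wt_den.
Qed.

Lemma schwartz_lipschitz f : exists2 L, 0 <= L &
  forall x y, cabs (f x - f y) <= L * `|x - y|.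
Proof.
apply: (regX.2 f (fun i x => sD i f x) (\sum_i snorm (sD i f))) => i x.
  exact: isd_schwartz.
apply: le_trans (cabs_snorm _ _) _.
by rewrite (bigD1 i) //= lerDl sumr_ge0 // => j _; exact: snorm_ge0.
Qed.

Lemma schwartz_continuous f : continuous f.
Proof. by have [L _ H] := schwartz_lipschitz f; exact: lipschitz_continuous H. Qed.

End SchwartzToolkit.

Section Expi.
Variable R : realType.
Local Notation C := R[i].

Lemma expiD (s t : R) : expi (s + t) = expi s * expi t.
Proof.
by apply: complex_ext; rewrite ?cReM ?cImM /= ?cosD ?sinD; ring.
Qed.

Lemma expi0 : expi (0 : R) = 1.
Proof. by rewrite /expi cos0 sin0. Qed.

Lemma cabs_expi (t : R) : cabs (expi t) = 1.
Proof. by rewrite /cabs /= cos2Dsin2 sqrtr1. Qed.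

Lemma isd_expi (t : R) : isd (@expi R) t (1 : R) ('i * expi t).
Proof.
split; rewrite ?cReM ?cImM /= ?mul0r ?mul1r ?sub0r ?add0r ?addr0.
  exact: is_derive_cos.
exact: is_derive_sin.
Qed.

Lemma expi_lipschitz (s t : R) : cabs (expi s - expi t) <= 2 * `|s - t|.
Proof.
have H u : cabs ('i * expi u : C) <= 1 by rewrite cabsM cabsi cabs_expi mul1r.
have := isd_mvt (fun u => isd_expi (t + u *: (1 : R))) (fun u => H _) (s - t).
by rewrite [_ *: _]mulr1 subrKC mulr1.
Qed.

Lemma expi_taylor (s h : R) :
  cabs (expi (s + h) - expi s - h%:C * ('i * expi s)) <= 4 * h ^+ 2.
Proof.
have H u : cabs ('i * expi (s + u *: (1 : R)) - 'i * expi (s + 0 *: (1 : R)) : C) <= 2 * `|u|.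
  rewrite scale0r addr0 -mulrBr cabsM cabsi mul1r.
  by apply: le_trans (expi_lipschitz _ _) _; rewrite addrAC subrr add0r [_ *: _]mulr1.
have := isd_taylor (fun u => isd_expi (s + u *: (1 : R))) H h.
by rewrite scale0r addr0 [_ *: _]mulr1 -natrM.
Qed.

End Expi.

(** Continuous operators are bundled in order to index the families of [class_clin]: differentiation
    and multiplication by a coordinate replace an operator by a composite. *)
Record clmap (R : realType) (X Y : frame R) := CLMap {
  cl_fun :> schwartz X -> schwartz Y;
  cl_clin : clin cl_fun }.

Section ClMaps.
Variables (R : realType).
Implicit Types X Y Z : frame R.

Definition cl_id X : clmap X X := CLMap (@clin_id R X).
Definition cl_comp X Y Z (L : clmap Y Z) (M : clmap X Y) : clmap X Z :=
  CLMap (clin_comp (cl_clin L) (cl_clin M)).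
Definition cl_lin X Y (k : R[i]) (L M : clmap X Y) : clmap X Y :=
  CLMap (clin_lin k (cl_clin L) (cl_clin M)).
Definition cl_scale X Y (k : R[i]) (L : clmap X Y) : clmap X Y :=
  CLMap (clinZ k (cl_clin L)).
Definition cl_D X (regX : regular_frame X) i : clmap X X := CLMap (sD_clin regX i).
Definition cl_X X (regX : regular_frame X) i : clmap X X := CLMap (sX_clin regX i).

Lemma domd_cl X Y (L : clmap X Y) (m : schwartz Y -> R) :
  domd m -> domd (fun f => m (L f)).
Proof. exact: domd_clin (cl_clin L). Qed.

Lemma domd_cl_snorm X Y (L : clmap X Y) : domd (fun f => snorm (L f)).
Proof. exact: (domd_cl L (domd_snorm Y)). Qed.

Lemma cl_linE X Y (L : clmap X Y) k f g x : L (k *: f + g) x = k * L f x + L g x.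
Proof. by rewrite (cl_clin L).1. Qed.

Lemma cl_linearE X Y (k : R[i]) (L M : clmap X Y) f x : cl_lin k L M f x = k * L f x + M f x.
Proof. by []. Qed.

Lemma cl_scaleE X Y (k : R[i]) (L : clmap X Y) f x : cl_scale k L f x = k * L f x.
Proof. by []. Qed.

Lemma cl_compE X Y Z (L : clmap Y Z) (M : clmap X Y) f : cl_comp L M f = L (M f).
Proof. by []. Qed.

Lemma cl_XE X (regX : regular_frame X) i f x : cl_X regX i f x = (coord i x)%:C * f x.
Proof. exact: sXE. Qed.

Lemma cl_DE X (regX : regular_frame X) i f : cl_D regX i f = sD regX i f.
Proof. by []. Qed.

End ClMaps.

Section GenericOperators.
Variables (R : realType) (X : frame R).
Hypothesis regX : regular_frame X.
Local Notation C := R[i].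
Local Notation S := (schwartz X).
Local Notation sD := (sD regX).
Local Notation sX := (sX regX).
Implicit Types f g : S.

(** The step is taken first along j, then along i. The mixed constant B pays for the derivative
    along i being evaluated at the shifted point. *)
Lemma isd_direction f x i j (a b : R) :
  isd f x (a *: axis i + b *: axis j) (a%:C * sD i f x + b%:C * sD j f x).
Proof.
pose A := snorm (sD i (sD i f)); pose B := snorm (sD j (sD i f)).
pose D := snorm (sD j (sD j f)).
apply: (isd_quadratic (K := 4 * A * a ^+ 2 + 2 * B * (`|a| * `|b|) + 4 * D * b ^+ 2)) => h _.
have H1 := schwartz_taylor regX f (x + (h * b) *: axis j) i (h * a).
have H2 := schwartz_taylor regX f x j (h * b).
have H3 := schwartz_mvt regX (sD i f) x j (h * b).
have -> : x + h *: (a *: axis i + b *: axis j) = x + (h * b) *: axis j + (h * a) *: axis i.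
  by rewrite scalerDr !scalerA -addrA; congr (_ + _); exact: addrC.
set y := x + (h * b) *: axis j in H1 H3 *.
rewrite (_ : _ - _ - _ = (f (y + (h * a) *: axis i) - f y - (h * a)%:C * sD i f y) +
   (h * a)%:C * (sD i f y - sD i f x) + (f y - f x - (h * b)%:C * sD j f x)); last first.
  by rewrite !rmorphM /=; ring.
apply: le_trans (cabsD _ _) _; apply: le_trans (lerD (cabsD _ _) H2) _.
rewrite cabsM cabsR; apply: le_trans (lerD (lerD H1 (ler_wpM2l (normr_ge0 _) H3)) (lexx _)) _.
rewrite -/A -/B -/D !normrM.
have -> : `|h| * `|a| * (2 * B * (`|h| * `|b|)) = 2 * B * (`|a| * `|b|) * `|h| ^+ 2 by ring.
rewrite real_normK ?num_real // le_eqVlt; apply/orP; left; apply/eqP; ring.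
Qed.

Lemma mul_clin g : exists2 L, clin L & forall f x, L f x = g x * f x.
Proof.
pose F (i : S * clmap X X) f x := i.1 x * i.2 f x.
apply: (class_clin regX (F := F) (i := (g, cl_id X))).
- move=> [h L]; exists (fun f => snorm h * snorm (L f)).
    by apply: domdZ (domd_cl_snorm L); exact: snorm_ge0.
  by move=> f x; rewrite cabsM ler_pM ?cabs_ge0 ?cabs_snorm.
- move=> [h L] j; exists [:: (sD j h, L); (h, cl_comp (cl_D regX j) L)] => f x.
  rewrite big_cons big_seq1; apply: isdM; exact: isd_schwartz.
- move=> [h L] j; exists [:: (h, cl_comp (cl_X regX j) L)] => f x.
  by rewrite big_seq1 /F /= sXE mulrCA.
- by move=> k f h x; rewrite /F cl_linE; ring.
Qed.

Definition smul g : S -> S := s2val (cid2 (mul_clin g)).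
Lemma smul_clin g : clin (smul g). Proof. exact: (s2valP (cid2 (mul_clin g))). Qed.
Lemma smulE g f x : smul g f x = g x * f x.
Proof. exact: (s2valP' (cid2 (mul_clin g))). Qed.

Lemma isd_expi_coord (c : R) i j (x : X) :
  isd (fun y => expi (c * coord i y)) x (axis j)
    ((c * (i == j)%:R)%:C * ('i * expi (c * coord i x))).
Proof.
apply: (isd_quadratic (K := 4 * (c * (i == j)%:R) ^+ 2)) => h _.
rewrite regX.1 mulrDr (mulrCA c h).
have H := expi_taylor (c * coord i x) (h * (c * (i == j)%:R)).
have -> : 4 * (c * (i == j)%:R) ^+ 2 * h ^+ 2 = 4 * (h * (c * (i == j)%:R)) ^+ 2 by ring.
apply: le_trans H; rewrite le_eqVlt; apply/orP; left; apply/eqP; congr cabs.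
by congr (_ - _); rewrite (rmorphM _ h) /= -[RHS]mulrA.
Qed.

Lemma modulation_clin (c : R) i : exists2 L, clin L &
  forall f x, L f x = expi (c * coord i x) * f x.
Proof.
pose F (L : clmap X X) f x := expi (c * coord i x) * L f x.
apply: (class_clin regX (F := F) (i := cl_id X)).
- move=> L; exists (fun f => snorm (L f)); first exact: domd_cl_snorm.
  by move=> f x; rewrite cabsM cabs_expi mul1r cabs_snorm.
- move=> L j; exists [:: cl_scale ((c * (i == j)%:R)%:C * 'i) L; cl_comp (cl_D regX j) L] => f x.
  rewrite big_cons big_seq1 /F cl_scaleE cl_compE cl_DE.
  have := isdM (isd_expi_coord c i j x) (isd_schwartz regX (L f) x j).
  congr isd; ring.
- move=> L j; exists [:: cl_comp (cl_X regX j) L] => f x.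
  by rewrite big_seq1 /F /= sXE mulrCA.
- by move=> k f h x; rewrite /F cl_linE; ring.
Qed.

Definition smod (c : R) i : S -> S := s2val (cid2 (modulation_clin c i)).
Lemma smodE c i f x : smod c i f x = expi (c * coord i x) * f x.
Proof. exact: (s2valP' (cid2 (modulation_clin c i))). Qed.

End GenericOperators.

Section PlaneOperators.
Variable R : realType.
Local Notation C := R[i].
Local Notation S1 := (schwartz (line R)).
Local Notation S2 := (schwartz (plane R)).
Local Notation regL := (line_regular R).
Local Notation regP := (plane_regular R).

Lemma affine1_clin (a b : R) : a != 0 -> exists2 L : S1 -> S1, clin L &
  forall f x, L f x = f (a * x + b).
Proof.
move=> a0.
pose F (L : clmap (line R) (line R)) (f : S1) (x : R) := L f (a * x + b).
apply: (class_clin regL (F := F) (i := cl_id (line R))).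
- move=> L; exists (fun f => snorm (L f)); first exact: domd_cl_snorm.
  by move=> f x; exact: cabs_snorm.
- move=> L []; exists [:: cl_scale a%:C (cl_comp (cl_D regL tt) L)] => f x.
  rewrite big_seq1 {2}/F cl_scaleE cl_compE cl_DE.
  apply: (isd_quadratic (K := 4 * snorm (sD regL tt (sD regL tt (L f))) * a ^+ 2)) => h _.
  have H := schwartz_taylor regL (L f) (a * x + b) tt (h * a).
  have -> : F L f (x + h *: (1 : R)) = L f (a * x + b + (h * a) *: (1 : R)).
    by rewrite /F; congr (L f _); rewrite /GRing.scale /=; ring.
  rewrite -mulrA -exprMn [a * h]mulrC; apply: le_trans H.
  by rewrite le_eqVlt; apply/orP; left; apply/eqP; congr cabs; rewrite rmorphM /= mulrA.
- move=> L []; exists [:: cl_lin (- (b / a))%:C L (cl_scale a^-1%:C (cl_comp (cl_X regL tt) L))] => f x.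
  rewrite big_seq1 /F cl_linearE cl_scaleE cl_compE cl_XE !mulrA -mulrDl; congr (_ * _).
  by rewrite -rmorphM -rmorphD; congr (_%:C) => /=; field.
- by [].
Qed.

Definition aff1 (a b : R) (a0 : a != 0) : S1 -> S1 := s2val (cid2 (affine1_clin b a0)).
Lemma aff1E a b a0 f (x : R) : @aff1 a b a0 f x = f (a * x + b).
Proof. exact: (s2valP' (cid2 (affine1_clin b a0))). Qed.

Lemma affine2_clin (a b c d e g : R) : a * d - b * c != 0 ->
  exists2 L : S2 -> S2, clin L &
  forall f x, L f x = f (a * x.1 + b * x.2 + e, c * x.1 + d * x.2 + g).
Proof.
move=> det0; set det := a * d - b * c in det0.
pose F (L : clmap (plane R) (plane R)) (f : S2) (x : R * R) :=
  L f (a * x.1 + b * x.2 + e, c * x.1 + d * x.2 + g).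
pose D1 := cl_D regP false; pose D2 := cl_D regP true.
pose X1 := cl_X regP false; pose X2 := cl_X regP true.
apply: (class_clin regP (F := F) (i := cl_id (plane R))).
- move=> L; exists (fun f => snorm (L f)); first exact: domd_cl_snorm.
  by move=> f x; exact: cabs_snorm.
- move=> L j; pose u := if j then b else a; pose v := if j then d else c.
  exists [:: cl_lin u%:C (cl_comp D1 L) (cl_scale v%:C (cl_comp D2 L))] => f x.
  rewrite big_seq1 /F cl_linearE cl_scaleE !cl_compE !cl_DE.
  apply: isd_quotient (isd_direction regP (L f) _ false true u v) => h /=.
  congr (L f _); rewrite /u /v; move: j {u v} => j.
  case: j; congr pair; rewrite /= /GRing.scale /=; ring.
- move=> L j.
  pose u := (if j then - c else d) / det; pose v := (if j then a else - b) / det.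
  exists [:: cl_lin u%:C (cl_comp X1 L) (cl_lin v%:C (cl_comp X2 L) (cl_scale (- (u * e + v * g))%:C L))] => f x.
  rewrite big_seq1 /F !cl_linearE cl_scaleE !cl_compE !cl_XE !mulrA -!mulrDl -!rmorphM -!rmorphD.
  congr (_%:C * _); rewrite /= /u /v /det; move: det0; rewrite /det.
  by move: j {u v} => j; case: j => det0 /=; field.
- by [].
Qed.

Definition aff2 (a b c d e g : R) (det0 : a * d - b * c != 0) : S2 -> S2 :=
  s2val (cid2 (affine2_clin e g det0)).
Lemma aff2_clin a b c d e g det0 : clin (@aff2 a b c d e g det0).
Proof. exact: (s2valP (cid2 (affine2_clin e g det0))). Qed.
Lemma aff2E a b c d e g det0 f (x : R * R) :
  @aff2 a b c d e g det0 f x = f (a * x.1 + b * x.2 + e, c * x.1 + d * x.2 + g).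
Proof. exact: (s2valP' (cid2 (affine2_clin e g det0))). Qed.

Lemma isd_snd (F : R -> C) (t y : R) d :
  isd F y (1 : R) d -> isd (fun p : R * R => F p.2) ((t, y) : R * R) ((0, 1) : R * R) d.
Proof. by apply: isd_quotient. Qed.

Lemma isd_fst (F : R -> C) (t y : R) d :
  isd F t (1 : R) d -> isd (fun p : R * R => F p.1) ((t, y) : R * R) ((1, 0) : R * R) d.
Proof. by apply: isd_quotient. Qed.

Lemma isd_snd0 (F : R -> C) (t y : R) :
  isd (fun p : R * R => F p.2) ((t, y) : R * R) ((1, 0) : R * R) 0.
Proof.
apply: (@isd_quotient _ _ _ (fun=> F y) _ (0 : R) (0 : R)); last exact: isd_cst.
by move=> h /=; rewrite scaler0 addr0.
Qed.

Lemma isd_fst0 (F : R -> C) (t y : R) :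
  isd (fun p : R * R => F p.1) ((t, y) : R * R) ((0, 1) : R * R) 0.
Proof.
apply: (@isd_quotient _ _ _ (fun=> F t) _ (0 : R) (0 : R)); last exact: isd_cst.
by move=> h /=; rewrite scaler0 addr0.
Qed.

Lemma tensor_right_clin (psi : S1) : exists2 L : S1 -> S2, clin L &
  forall phi p, L phi p = psi p.1 * phi p.2.
Proof.
pose F (i : S1 * clmap (line R) (line R)) (phi : S1) (p : R * R) := i.1 p.1 * i.2 phi p.2.
apply: (class_clin regP (F := F) (i := (psi, cl_id (line R)))).
- move=> [h L]; exists (fun f => snorm h * snorm (L f)).
    by apply: domdZ (domd_cl_snorm L); exact: snorm_ge0.
  by move=> f x; rewrite cabsM ler_pM ?cabs_ge0 ?cabs_snorm.
- move=> [h L] []; last first.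
    exists [:: (sD regL tt h, L)] => f [t y]; rewrite big_seq1.
    have := isdM (isd_fst y (isd_schwartz regL h t tt)) (isd_snd0 (L f) t y).
    by rewrite mulr0 addr0.
  exists [:: (h, cl_comp (cl_D regL tt) L)] => f [t y]; rewrite big_seq1.
  have := isdM (isd_fst0 h t y) (isd_snd t (isd_schwartz regL (L f) y tt)).
  by rewrite mul0r add0r.
- move=> [h L] []; last first.
    by exists [:: (sX regL tt h, L)] => f [t y]; rewrite big_seq1 /F /= sXE mulrA.
  by exists [:: (h, cl_comp (cl_X regL tt) L)] => f [t y]; rewrite big_seq1 /F /= sXE mulrCA.
- by move=> k f h x; rewrite /F cl_linE; ring.
Qed.

Lemma tensorE (psi phi : S1) (p : R * R) : tensor psi phi p = psi p.1 * phi p.2.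
Proof.
have [L _ LE] := tensor_right_clin psi.
rewrite /tensor to_schwartzE //.
suff -> : (fun u : plane R => psi u.1 * phi u.2) = L phi by exact: schwartzP.
by apply/funext => u; rewrite LE.
Qed.

Lemma tensor_clin (psi : S1) : clin (tensor psi).
Proof.
have [L cL LE] := tensor_right_clin psi.
suff -> : tensor psi = L by [].
by apply/funext => phi; apply: schwartz_ext => p; rewrite tensorE LE.
Qed.

End PlaneOperators.

(** * Slices of functions on the plane, and operators in the second variable *)

Section Slices.
Variable R : realType.
Local Notation C := R[i].
Local Notation S1 := (schwartz (line R)).
Local Notation S2 := (schwartz (plane R)).
Local Notation regL := (line_regular R).
Local Notation regP := (plane_regular R).
Local Notation D1 := (sD (plane_regular R) false).
Local Notation D2 := (sD (plane_regular R) true).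
Local Notation X1 := (sX (plane_regular R) false).
Local Notation X2 := (sX (plane_regular R) true).
Local Notation P1 := (sP (plane_regular R) false).
Local Notation D := (sD (line_regular R) tt).
Local Notation Q := (sX (line_regular R) tt).
Implicit Types (l : S2) (t y h : R).

Lemma plane_step1 t y h : ((t, y) : plane R) + h *: @axis R (plane R) false = (t + h, y).
Proof. by congr pair; rewrite /= /GRing.scale /= ?mulr1 ?mulr0 ?addr0. Qed.

Lemma isd_slice2 l t y : isd (fun z : R => l (t, z)) y (1 : R) (D2 l (t, y)).
Proof.
apply: isd_quotient (isd_schwartz regP l (t, y) true) => h /=.
by congr (l _); congr pair; rewrite /= scaler0 addr0.
Qed.

Lemma is_schwartz_slice l t : @is_schwartz R (line R) (fun y => l (t, y)).
Proof.
pose F (m : S2) (s : unit) (y : line R) := m (t, y).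
(* Only membership in S is at stake, so the parameter of the family is trivial and every bound is
   admissible. *)
pose Dm (m : unit -> R) := True.
apply: (@class_schwartz R (line R) regL S2 unit Dm F I (fun _ _ _ _ => I) _ _ _ l tt).
- move=> m; exists (fun=> snorm m) => // s y; exact: cabs_snorm.
- by move=> m []; exists [:: D2 m] => s y; rewrite big_seq1; exact: isd_slice2.
- by move=> m []; exists [:: X2 m] => s y; rewrite big_seq1 /F sXE.
Qed.

Definition slice l t : S1 := mk_schwartz (is_schwartz_slice l t).

Lemma sliceE l t y : slice l t y = l (t, y).
Proof. by []. Qed.

Lemma slice_lin k l m t : slice (k *: l + m) t = k *: slice l t + slice m t.
Proof. exact: schwartz_ext. Qed.

Lemma slice_X1 l t : slice (X1 l) t = t%:C *: slice l t.
Proof. by apply: schwartz_ext => y; rewrite schwartzZE !sliceE sXE. Qed.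

Lemma slice_D2 l t : D (slice l t) = slice (D2 l) t.
Proof. by apply: sD_eq => y; exact: isd_slice2. Qed.

Lemma slice_X2 l t : Q (slice l t) = slice (X2 l) t.
Proof. by apply: schwartz_ext => y; rewrite sXE !sliceE sXE. Qed.

Lemma slice_P1 l t : slice l t = (wt t)%:C *: slice (P1 l) t.
Proof.
apply: schwartz_ext => y; rewrite schwartzZE !sliceE sPE mulrA -rmorphM /= mulVf ?mul1r //.
by rewrite gt_eqF // wt_den.
Qed.

(** A word on the line becomes the same word in the second variable of the plane. *)
Definition up (a : seq unit) : seq bool := [seq true | _ <- a].

Lemma slice_sw a b l t : sw regL a b (slice l t) = slice (sw regP (up a) (up b) l) t.
Proof.
rewrite !sw_foldr; have -> : foldr (sD regL) (slice l t) b = slice (foldr (sD regP) l (up b)) t.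
  by elim: b => //= -[] b ->; rewrite slice_D2.
by elim: a => //= -[] a ->; rewrite slice_X2.
Qed.

Lemma D1_sw a b l : D1 (sw regP (up a) (up b) l) = sw regP (up a) (up b) (D1 l).
Proof.
rewrite !sw_foldr; elim: a => [|[] a IH] /=; last by rewrite sDX // IH.
by elim: b => //= -[] b IH; rewrite sDC IH.
Qed.

Lemma semi_snorm_line a b (f : S1) : semi (a, b) f = snorm (sw regL a b f).
Proof. by rewrite /snorm semi_sw. Qed.

Lemma snorm_slice l t : snorm (slice l t) <= snorm l.
Proof. by apply: snorm_le => y; exact: (cabs_snorm l (t, y)). Qed.

Lemma semi_slice ab l t :
  semi ab (slice l t) <= wt t * snorm (sw regP (up ab.1) (up ab.2) (P1 l)).
Proof.
case: ab => a b; rewrite slice_P1; apply: le_trans (semiZ _ _ _) _.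
rewrite cabsR (ger0_norm (wt_ge0 _)) ler_wpM2l ?wt_ge0 // semi_snorm_line slice_sw.
exact: snorm_slice.
Qed.

Lemma domd_slice (m : S1 -> R) : domd m ->
  exists2 n : S2 -> R, domd n & forall l t, m (slice l t) <= wt t * n l.
Proof.
move=> [s [M [M0 HM]]].
exists (fun l => M * \sum_(ab <- s) snorm (sw regP (up ab.1) (up ab.2) (P1 l))).
  apply: domdZ => //; apply: domd_sum => ab.
  exact: (domd_clin (clin_comp (sw_clin regP (up ab.1) (up ab.2)) (sP_clin regP false)) (domd_snorm _)).
move=> l t; apply: le_trans (HM _) _; rewrite mulrCA ler_wpM2l //.
by rewrite /qs mulr_sumr ler_sum // => ab _; exact: semi_slice.
Qed.

Definition slice_remainder l t h : S1 :=
  slice l (t + h) - slice l t - h%:C *: slice (D1 l) t.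

(** This is differentiability of t -> [slice l t] as a map into S(R), in each continuous seminorm;
    it holds because the derivative in t commutes with the words in the second variable. It lets a
    derivative in t pass through any continuous operator. *)
Lemma domd_slice_remainder (m : S1 -> R) : domd m ->
  exists2 n : S2 -> R, domd n & forall l t h, m (slice_remainder l t h) <= n l * h ^+ 2.
Proof.
move=> [s [M [M0 HM]]].
exists (fun l => M * \sum_(ab <- s) 4 * snorm (D1 (D1 (sw regP (up ab.1) (up ab.2) l)))).
  apply: domdZ => //; apply: domd_sum => ab; apply: domdZ => //.
  apply: (domd_clin _ (domd_snorm _)); apply: clin_comp; first exact: sD_clin.
  by apply: clin_comp; [exact: sD_clin|exact: sw_clin].
move=> l t h; apply: le_trans (HM _) _; rewrite -mulrA ler_wpM2l // mulr_suml ler_sum //.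
move=> [a b] _; rewrite semi_snorm_line.
have cs := sw_clin regL a b.
rewrite /slice_remainder (clinBE cs) (clinBE cs) (clinZE cs) !slice_sw -D1_sw.
apply: snorm_le => y; rewrite !schwartzBE schwartzZE !sliceE /=.
have := schwartz_taylor regP (sw regP (up a) (up b) l) (t, y) false h.
by rewrite plane_step1.
Qed.

(** The family is closed because derivatives and coordinates in the second variable are composed
    with A on the left, while those in the first variable act on l before A is applied. *)
Lemma tensored_clin (A : S1 -> S1) : clin A -> exists2 L : S2 -> S2, clin L &
  forall l p, L l p = A (slice l p.1) p.2.
Proof.
move=> cA0.
pose F (i : clmap (line R) (line R) * clmap (plane R) (plane R)) l (p : R * R) :=
  i.1 (slice (i.2 l) p.1) p.2.
apply: (class_clin regP (F := F) (i := (CLMap cA0, cl_id (plane R)))).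
- move=> [A' L]; have [n dn nE] := domd_slice (domd_cl_snorm A').
  exists (fun l => n (L l)) => [|l [t y]]; first exact: domd_cl.
  rewrite /F; apply: le_trans (cabs_snorm _ _) _; apply: le_trans (nE _ _) _.
  have n0 : 0 <= n (L l).
    have := le_trans (snorm_ge0 (A' (slice (L l) t))) (nE _ _).
    by rewrite pmulr_rge0 // wt_gt0.
  by rewrite ler_piMl // wt_le1.
- move=> [A' L] [].
    exists [:: (cl_comp (cl_D regL tt) A', L)] => l [t y]; rewrite big_seq1 /F.
    have := isd_schwartz regL (A' (slice (L l) t)) y tt.
    apply: isd_quotient => h /=; rewrite scaler0 addr0 //.
  exists [:: (A', cl_comp (cl_D regP false) L)] => l [t y]; rewrite big_seq1 /F.
  have [n dn nE] := domd_slice_remainder (domd_cl_snorm A').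
  apply: (isd_quadratic (K := n (L l))) => h _.
  rewrite plane_step1.
  have cA' := cl_clin A'.
  have H := cabs_snorm (A' (slice_remainder (L l) t h)) y.
  apply: le_trans (le_trans H (nE (L l) t h)).
  by rewrite /slice_remainder (clinBE cA') (clinBE cA') (clinZE cA').
- move=> [A' L] [].
    by exists [:: (cl_comp (cl_X regL tt) A', L)] => l [t y]; rewrite big_seq1 /F cl_compE cl_XE.
  exists [:: (A', cl_comp (cl_X regP false) L)] => l [t y].
  by rewrite big_seq1 /F cl_compE slice_X1 (clinZE (cl_clin A')) schwartzZE.
- move=> k f g x; rewrite /F /= slice_lin; exact: (cl_linE (CLMap cA0)).
Qed.

End Slices.

Section Tensored.
Variable R : realType.
Local Notation S1 := (schwartz (line R)).
Local Notation S2 := (schwartz (plane R)).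

(* The operator 1 (x) A, acting on the second variable. *)
Definition opt (A : S1 -> S1) (cA : clin A) : S2 -> S2 := s2val (cid2 (tensored_clin cA)).
Lemma opt_clin A cA : clin (@opt A cA).
Proof. exact: (s2valP (cid2 (tensored_clin cA))). Qed.
Lemma optE A cA l (p : R * R) : @opt A cA l p = A (slice l p.1) p.2.
Proof. exact: (s2valP' (cid2 (tensored_clin cA))). Qed.
Lemma slice_opt A cA l t : slice (@opt A cA l) t = A (slice l t).
Proof. by apply: schwartz_ext => y; rewrite sliceE optE. Qed.

Lemma slice_tensor (psi phi : S1) t : slice (tensor psi phi) t = psi t *: phi.
Proof. by apply: schwartz_ext => y; rewrite sliceE tensorE. Qed.

Lemma plane_ext (l m : S2) : (forall t, slice l t = slice m t) -> l = m.
Proof.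
move=> H; apply: schwartz_ext => -[t y].
by rewrite -[l _]sliceE H.
Qed.

End Tensored.

(** * Integration over the first variable *)

Section Integrals.
Variable R : realType.
Local Notation C := R[i].
Local Notation S1 := (schwartz (line R)).
Local Notation S2 := (schwartz (plane R)).
Local Notation regL := (line_regular R).
Local Notation regP := (plane_regular R).
Local Notation D1 := (sD (plane_regular R) false).
Local Notation D2 := (sD (plane_regular R) true).
Local Notation X2 := (sX (plane_regular R) true).
Local Notation P1 := (sP (plane_regular R) false).
Local Notation P2 := (sP (plane_regular R) true).
Local Notation D := (sD (line_regular R) tt).
Local Notation Q := (sX (line_regular R) tt).
Local Notation P := (sP (line_regular R) tt).
Local Notation cmeasurableR := (@cmeasurable _ (measurableTypeR R) R).
Implicit Types (l : S2) (f g phi psi : S1) (t y h : R).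

Lemma norm_fst t t' y : `|((t, y) : R * R) - (t', y)| = `|t - t'|.
Proof.
have -> : `|((t, y) : R * R) - (t', y)| = Num.max `|t - t'| `|y - y| by [].
by rewrite subrr normr0 max_l.
Qed.

Lemma s1_bound f t : cabs (f t) <= snorm (P f) * wt t.
Proof. by rewrite (cabs_sP regL tt f t) mulrC ler_wpM2r ?wt_ge0 // cabs_snorm. Qed.

Lemma s1_bound2 f t : cabs (f t) <= snorm (P (P f)) * (wt t * wt t).
Proof.
rewrite (cabs_sP regL tt f t) mulrCA ler_wpM2l ?wt_ge0 //; exact: s1_bound.
Qed.

Lemma s1_tame f : tame f.
Proof.
split; first exact: (schwartz_lipschitz regL).
exists (snorm (P (P f))); [exact: snorm_ge0|exact: s1_bound2].
Qed.

Lemma s1_nice f : nice f.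
Proof. exact: tame_nice (s1_tame f). Qed.

Lemma s2_bound1 l t y : cabs (l (t, y)) <= snorm (P1 l) * wt t.
Proof. by rewrite (cabs_sP regP false l (t, y)) mulrC ler_wpM2r ?wt_ge0 // cabs_snorm. Qed.

Lemma s2_bound11 l t y : cabs (l (t, y)) <= snorm (P1 (P1 l)) * (wt t * wt t).
Proof.
rewrite (cabs_sP regP false l (t, y)) mulrCA ler_wpM2l ?wt_ge0 //; exact: s2_bound1.
Qed.

Lemma s2_bound12 l (p : R * R) : cabs (l p) <= snorm (P2 (P1 l)) * (wt p.1 * wt p.2).
Proof.
rewrite (cabs_sP regP false l p) mulrCA ler_wpM2l ?wt_ge0 //.
by rewrite (cabs_sP regP true (P1 l) p) mulrC ler_wpM2r ?wt_ge0 // cabs_snorm.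
Qed.

Lemma s2_nice2 l : nice2 l.
Proof.
split; first exact: (schwartz_continuous regP).
by exists (snorm (P2 (P1 l))) => p; exact: s2_bound12.
Qed.

Lemma s2_fst_tame l y : tame (fun t => l (t, y)).
Proof.
split.
  have [L L0 lL] := schwartz_lipschitz regP l; exists L => // t t'.
  apply: le_trans (lL _ _) _; rewrite ler_wpM2l //.
  by rewrite norm_fst.
exists (snorm (P1 (P1 l))) => [|t]; [exact: snorm_ge0|exact: s2_bound11].
Qed.

Lemma int_clinf : clinf (fun f : S1 => int1 f).
Proof.
split=> [k f g|]; first exact: (int1_lin k (s1_nice f) (s1_nice g)).
apply: domd_le (domdZ (_ : 0 <= 2 * pi) (domd_clin (sP_clin regL tt) (domd_snorm _))).
  move=> f; apply: int1_bound; first exact: (s1_nice f).1.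
  exact: s1_bound.
by rewrite mulr_ge0 // pi_ge0.
Qed.

Lemma int1_sD f : int1 (D f) = 0.
Proof.
pose K := 4 * snorm (D (D f)) + snorm (P f).
have K1 : 0 <= 4 * snorm (D (D f)) by rewrite mulr_ge0 // snorm_ge0.
have H s : cabs (f s - 0) <= K * wt s.
  rewrite subr0; apply: le_trans (s1_bound f s) _.
  by rewrite ler_wpM2r ?wt_ge0 // lerDr.
rewrite (@int1_antiderivative _ f (D f) 0 0 K 0) ?subrr //; first exact: s1_tame.
move=> s h _; have := schwartz_taylor regL f s tt h; rewrite /= [h *: 1]mulr1.
by move=> /le_trans; apply; rewrite ler_wpM2r ?sqr_ge0 // lerDl snorm_ge0.
Qed.

Section KernelIntegral.
Variables (w : R -> C) (N : R).
Hypotheses (mw : cmeasurableR w) (wN : forall t, cabs (w t) <= N).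

Let N0 : 0 <= N. Proof. exact: le_trans (cabs_ge0 _) (wN 0). Qed.

Lemma kernel_nice l y : nice (fun t => w t * l (t, y)).
Proof.
split.
  apply: (@cmeasurableM _ (measurableTypeR R)) => //.
  exact: (tame_nice (s2_fst_tame l y)).1.
exists (N * snorm (P1 l)) => t; rewrite cabsM -mulrA ler_pM ?cabs_ge0 //.
exact: s2_bound1.
Qed.

(** A bounded weight w covers three uses: a cut-off, giving the partial integrals [part]; the
    constant 1, giving [total]; and a Schwartz function, giving the integral operator [kop]. *)
Definition kernel_fun l (y : line R) : C := int1 (fun t => w t * l (t, y)).

Lemma kernel_bound l y : cabs (kernel_fun l y) <= 2 * pi * snorm (P1 l) * N.
Proof.
rewrite -mulrA; apply: int1_bound; first exact: (kernel_nice l y).1.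
move=> t; rewrite cabsM mulrAC mulrC ler_pM ?cabs_ge0 //; exact: s2_bound1.
Qed.

Lemma P1D2 l : P1 (D2 l) = D2 (P1 l).
Proof.
by rewrite /sP (clinDE (sD_clin regP true)) !sDX.
Qed.

Lemma kernel_isd l y : isd (kernel_fun l) y (1 : R) (kernel_fun (D2 l) y).
Proof.
pose M := 4 * snorm (D2 (D2 (P1 l))).
apply: (isd_quadratic (K := 2 * pi * (N * M))) => h _.
rewrite [h *: _]mulr1 /kernel_fun -int1B; [|exact: kernel_nice|exact: kernel_nice].
rewrite -int1Z; [|exact: kernel_nice].
rewrite -int1B; [|by apply: niceB; exact: kernel_nice|by apply: niceZ; exact: kernel_nice].
rewrite -[X in _ <= X]mulrA; apply: int1_bound.
  have n1 := nice_lin (-1) (kernel_nice l y) (kernel_nice l (y + h)).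
  have := (nice_lin (- h%:C) (kernel_nice (D2 l) y) n1).1.
  by congr cmeasurable; apply/funext => t; ring.
move=> t; rewrite (_ : _ - _ - _ = w t * (l (t, y + h) - l (t, y) - h%:C * D2 l (t, y))); last by ring.
rewrite cabsM mulrAC -[X in _ <= X]mulrA -[X in _ <= X]mulrA ler_pM ?cabs_ge0 //.
(* Taylor's formula is applied to [P1 l] and then divided by 1 + t^2; this makes the remainder
   integrable in t. *)
have := schwartz_taylor regP (P1 l) (t, y) true h.
have -> : ((t, y) : plane R) + h *: @axis R (plane R) true = (t, y + h).
  by congr pair; rewrite /= /GRing.scale /= ?mulr1 ?mulr0 ?addr0.
rewrite -P1D2 !sPE /= -/M.
rewrite (_ : _ - _ - _ = (1 + t ^+ 2)%:C * (l (t, y + h) - l (t, y) - h%:C * D2 l (t, y))); last by ring.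
rewrite cabsM cabsR ger0_norm; last exact: ltW (wt_den _).
rewrite -ler_pdivlMl ?wt_den // -/(wt t) => /le_trans; apply.
rewrite /M ?P1D2 /wt; move: (snorm _) => A.
by rewrite le_eqVlt; apply/orP; left; apply/eqP; ring.
Qed.

Lemma kernel_X l y : y%:C * kernel_fun l y = kernel_fun (X2 l) y.
Proof.
rewrite /kernel_fun -int1Z; last exact: kernel_nice.
by apply: eq_int1 => t; rewrite sXE /= mulrCA.
Qed.

Lemma kernel_schwartz l : is_schwartz (kernel_fun l).
Proof.
pose F (m : S2) (s : unit) (y : line R) := kernel_fun m y.
apply: (@class_schwartz R (line R) regL S2 unit (fun _ => True) F I (fun _ _ _ _ => I) _ _ _ l tt).
- move=> m; exists (fun=> 2 * pi * snorm (P1 m) * N) => // s y; exact: kernel_bound.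
- by move=> m []; exists [:: D2 m] => s y; rewrite big_seq1; exact: kernel_isd.
- by move=> m []; exists [:: X2 m] => s y; rewrite big_seq1 /F -kernel_X.
Qed.

Definition kernel_int l : S1 := mk_schwartz (kernel_schwartz l).

Lemma kernel_sw a b l : sw regL a b (kernel_int l) = kernel_int (sw regP (up a) (up b) l).
Proof.
rewrite !sw_foldr.
have -> : foldr (sD regL) (kernel_int l) b = kernel_int (foldr (sD regP) l (up b)).
  elim: b => //= -[] b ->; apply: sD_eq => y; exact: kernel_isd.
elim: a => //= -[] a ->; apply: schwartz_ext => y; rewrite sXE; exact: kernel_X.
Qed.

End KernelIntegral.

Lemma cabs_one t : cabs (1 : C) <= (1 : R).
Proof. by rewrite cabs1. Qed.

Lemma one_measurable : cmeasurableR (fun=> 1 : C).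
Proof. by split; exact: measurable_cst. Qed.

Definition part l s : S1 := kernel_int (chi_measurable s) (cabs_chi s) l.
Definition total l : S1 := kernel_int one_measurable cabs_one l.

Lemma totalE l y : total l y = int1 (fun t => l (t, y)).
Proof. by apply: eq_int1 => t; rewrite mul1r. Qed.

(** Each seminorm may come with its own constant, but m is controlled by finitely many of them. *)
Lemma domd_family (X : frame R) (m : schwartz X -> R) (J : Type) (g : J -> schwartz X) (r : J -> R) :
  domd m -> (forall j, 0 <= r j) ->
  (forall ab, exists2 K, 0 <= K & forall j, semi ab (g j) <= K * r j) ->
  exists2 K, 0 <= K & forall j, m (g j) <= K * r j.
Proof.
move=> [s [M [M0 HM]]] r0 H.
have [K K0 KE] : exists2 K, 0 <= K & forall j, qs s (g j) <= K * r j.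
  elim: s {HM} => [|ab s [K K0 KE]].
    by exists 0 => // j; rewrite /qs big_nil mul0r.
  have [L L0 LE] := H ab; exists (L + K) => [|j]; first exact: addr_ge0.
  by rewrite /qs big_cons mulrDl; exact: lerD (LE j) (KE j).
exists (M * K) => [|j]; first exact: mulr_ge0.
by apply: le_trans (HM _) _; rewrite -mulrA ler_wpM2l.
Qed.

Lemma functional_slice_tame (lam : S1 -> C) : clinf lam -> forall l, tame (fun t => lam (slice l t)).
Proof.
move=> cl l; have [n dn nE] := domd_slice cl.2; split.
  have [r dr rE] := domd_slice_remainder cl.2.
  have d0 t : isd (fun t => lam (slice l t)) t (1 : R) (lam (slice (D1 l) t)).
    apply: (isd_quadratic (K := r l)) => h _; apply: le_trans (rE l t h).
    by rewrite /slice_remainder (clinfBE cl) (clinfBE cl) (clinfZE cl) [h *: 1]mulr1.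
  have b0 t : cabs (lam (slice (D1 l) t)) <= `|n (D1 l)|.
    apply: le_trans (nE _ _) _; apply: le_trans (ler_norm _) _.
    by rewrite normrM (ger0_norm (wt_ge0 _)) ler_piMl // wt_le1.
  exists (2 * `|n (D1 l)|) => [|t t']; first by rewrite mulr_ge0.
  have := isd_mvt (fun u => d0 (t' + u *: (1 : R))) (fun u => b0 _) (t - t').
  by rewrite [_ *: 1]mulr1 subrKC.
exists `|n (P1 l)| => // t; rewrite slice_P1 (clinfZE cl) cabsM cabsR (ger0_norm (wt_ge0 _)).
rewrite mulrCA ler_wpM2l ?wt_ge0 // mulrC.
by apply: le_trans (nE _ _) _; rewrite ler_wpM2l ?wt_ge0 // ler_norm.
Qed.

(* The map s |-> lam (the integral of l(t, .) over t <= s) is an antiderivative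
   of s |-> lam (l(s, .)), which avoids vector-valued integration. *)
Theorem functional_total (lam : S1 -> C) : clinf lam -> forall l,
  lam (total l) = int1 (fun t => lam (slice l t)).
Proof.
move=> cl l; apply/esym; rewrite -[RHS]subr0.
have [K1 K10 K1E] : exists2 K, 0 <= K & forall sh : R * R,
    cabs (lam (part l (sh.1 + sh.2) - part l sh.1 - sh.2%:C *: slice l sh.1)) <= K * sh.2 ^+ 2.
  apply: (domd_family (m := fun f => cabs (lam f))
    (g := fun sh : R * R => part l (sh.1 + sh.2) - part l sh.1 - sh.2%:C *: slice l sh.1)
    (r := fun sh : R * R => sh.2 ^+ 2) cl.2); first by move=> j; exact: sqr_ge0.
  move=> [a b]; set m := sw regP (up a) (up b) l.
  have [L L0 mL] := schwartz_lipschitz regP m.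
  exists (3 * L) => [|[s h] /=]; first by rewrite mulr_ge0.
  have cs := sw_clin regL a b.
  rewrite semi_snorm_line (clinBE cs) (clinBE cs) (clinZE cs) /part !kernel_sw slice_sw -/m.
  apply: snorm_le => y; rewrite !schwartzBE schwartzZE.
  apply: (prim_step (f := fun t => m (t, y))) => //; first exact: tame_nice (s2_fst_tame m y).
  move=> t t'; apply: le_trans (mL _ _) _; rewrite ler_wpM2l //.
  by rewrite norm_fst.
have [K2 K20 K2E] : exists2 K, 0 <= K & forall s : {s : R | s <= 0},
    cabs (lam (part l (sval s))) <= K * wt (sval s).
  apply: (domd_family (m := fun f => cabs (lam f)) (g := fun s : {s : R | s <= 0} => part l (sval s))
    (r := fun s : {s : R | s <= 0} => wt (sval s)) cl.2) => [j|[a b]]; first exact: wt_ge0.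
  set m := sw regP (up a) (up b) l; exists (2 * pi * snorm (P1 (P1 m))).
    by rewrite !mulr_ge0 ?pi_ge0 ?snorm_ge0.
  move=> [s s0] /=; rewrite semi_snorm_line /part kernel_sw -/m.
  apply: snorm_le => y; apply: (prim_left (f := fun t => m (t, y))) => //.
  - exact: tame_nice (s2_fst_tame m y).
  - exact: snorm_ge0.
  - by move=> t; exact: s2_bound11.
have [K3 K30 K3E] : exists2 K, 0 <= K & forall s : {s : R | 0 <= s},
    cabs (lam (part l (sval s) - total l)) <= K * wt (sval s).
  apply: (domd_family (m := fun f => cabs (lam f)) (g := fun s : {s : R | 0 <= s} => part l (sval s) - total l)
    (r := fun s : {s : R | 0 <= s} => wt (sval s)) cl.2) => [j|[a b]]; first exact: wt_ge0.
  set m := sw regP (up a) (up b) l; exists (2 * pi * snorm (P1 (P1 m))).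
    by rewrite !mulr_ge0 ?pi_ge0 ?snorm_ge0.
  have cs := sw_clin regL a b.
  move=> [s s0] /=; rewrite semi_snorm_line (clinBE cs) /part /total !kernel_sw -/m.
  apply: snorm_le => y; rewrite schwartzBE -/(total m) totalE.
  apply: (prim_right (f := fun t => m (t, y))) => //.
  - exact: tame_nice (s2_fst_tame m y).
  - exact: snorm_ge0.
  - by move=> t; exact: s2_bound11.
pose K := K1 + (K2 + K3).
apply: (int1_antiderivative (F := fun s => lam (part l s)) (K := K) (S := 0)).
- exact: functional_slice_tame.
- move=> s h _; rewrite -(clinfBE cl) -(clinfZE cl) -(clinfBE cl).
  apply: le_trans (K1E (s, h)) _; rewrite ler_wpM2r ?sqr_ge0 // lerDl addr_ge0 //.
- rewrite oppr0 => s s0; rewrite subr0; apply: le_trans (K2E (exist _ s s0)) _.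
  by rewrite ler_wpM2r ?wt_ge0 // /K addrCA lerDl addr_ge0.
- move=> s s0; rewrite -(clinfBE cl); apply: le_trans (K3E (exist _ s s0)) _.
  by rewrite ler_wpM2r ?wt_ge0 // /K addrA lerDr addr_ge0.
Qed.

Lemma kernel_operator_clin l : exists2 L : S1 -> S1, clin L &
  forall f y, L f y = int1 (fun t => f t * l (t, y)).
Proof.
have mf (f : S1) : cmeasurableR f by exact: (s1_nice f).1.
have bf (f : S1) t : cabs (f t) <= snorm f by exact: cabs_snorm.
pose F (m : S2) (f : S1) (y : line R) := kernel_fun f m y.
apply: (class_clin regL (F := F) (i := l)).
- move=> m; exists (fun f => 2 * pi * snorm (P1 m) * snorm f).
    by apply: domdZ (domd_snorm _); rewrite !mulr_ge0 ?pi_ge0 ?snorm_ge0.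
  by move=> f y; exact: (kernel_bound (mf f) (bf f)).
- move=> m []; exists [:: D2 m] => f y; rewrite big_seq1; exact: (kernel_isd (mf f) (bf f)).
- move=> m []; exists [:: X2 m] => f y; rewrite big_seq1; exact: (kernel_X (mf f) (bf f)).
- move=> k f g y; rewrite /F /kernel_fun -int1_lin; [|exact: kernel_nice (mf _) (bf _) _ _..].
  by apply: eq_int1 => t; rewrite schwartz_linE; ring.
Qed.

Definition kop l : S1 -> S1 := s2val (cid2 (kernel_operator_clin l)).
Lemma kop_clin l : clin (kop l).
Proof. exact: (s2valP (cid2 (kernel_operator_clin l))). Qed.
Lemma kopE l f y : kop l f y = int1 (fun t => f t * l (t, y)).
Proof. exact: (s2valP' (cid2 (kernel_operator_clin l))). Qed.

(** Averages over small dilates of g recover the values of f at a rate independent of x. This serves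
    Fourier inversion, the separation of functions by integrals, and the recovery of a sup norm from
    a bounded family of functionals. *)
Lemma mollify f g : exists2 K, 0 <= K & forall x e : R, 0 <= e ->
  cabs (int1 (fun s => f (x + e * s) * g s) - f x * int1 g) <= K * e.
Proof.
pose K := 2 * pi * (2 * snorm (D f) * snorm (P (Q g))).
have K0 : 0 <= K by rewrite !mulr_ge0 ?pi_ge0 ?snorm_ge0.
exists K => // x e e0.
have cf : continuous (fun s : R => f (x + e * s)).
  apply: (@lipschitz_continuous R R _ (2 * snorm (D f) * e)) => s s'.
  have := schwartz_mvt regL f (x + e * s') tt (e * (s - s')).
  rewrite /= [_ *: 1]mulr1 -addrA -mulrDr subrKC normrM (ger0_norm e0) mulrA //.
have n1 : nice (fun s => f (x + e * s) * g s).
  split; first exact: (@cmeasurableM _ (measurableTypeR R)) (continuous_cmeasurable cf) (s1_nice g).1.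
  exists (snorm f * snorm (P g)) => s; rewrite cabsM -mulrA ler_pM ?cabs_ge0 ?cabs_snorm //.
  exact: s1_bound.
rewrite -int1Z; last exact: s1_nice.
rewrite -int1B //; last exact/niceZ/s1_nice.
have -> : K * e = 2 * pi * (2 * snorm (D f) * snorm (P (Q g)) * e) by rewrite /K -[LHS]mulrA.
apply: int1_bound.
  have := (nice_lin (- f x) (s1_nice g) n1).1.
  by congr cmeasurable; apply/funext => s; ring.
move=> s; rewrite -mulrBl cabsM.
have H1 := schwartz_mvt regL f x tt (e * s).
rewrite /= [_ *: 1]mulr1 normrM (ger0_norm e0) in H1.
apply: le_trans (ler_wpM2r (cabs_ge0 _) H1) _.
have H2 : `|s| * cabs (g s) <= snorm (P (Q g)) * wt s.
  by have := s1_bound (Q g) s; rewrite sXE cabsM cabsR.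
have -> : 2 * snorm (D f) * (e * `|s|) * cabs (g s) = 2 * snorm (D f) * e * (`|s| * cabs (g s)) by ring.
have -> : 2 * snorm (D f) * snorm (P (Q g)) * e * wt s = 2 * snorm (D f) * e * (snorm (P (Q g)) * wt s) by ring.
by rewrite ler_wpM2l // !mulr_ge0 ?snorm_ge0.
Qed.

End Integrals.

(** * Fourier inversion *)

Section Fourier.
Variable R : realType.
Local Notation C := R[i].
Local Notation S1 := (schwartz (line R)).
Local Notation regL := (line_regular R).
Local Notation D := (sD (line_regular R) tt).
Local Notation Q := (sX (line_regular R) tt).
Local Notation P := (sP (line_regular R) tt).
Local Notation mod := (fun c => smod (line_regular R) c tt).
Implicit Types (f g phi psi : S1) (s t x y h : R).

Lemma modE c f t : mod c f t = expi (c * t) * f t.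
Proof. exact: smodE. Qed.

(** The exponent has the sign + that occurs in the conjugate inverse Wigner transform, and there is
    no prefactor; the normalisation enters with [ft]. *)
Definition ft_fun f y : C := int1 (fun t => expi (y * t) * f t).

Lemma ft_nice f y : nice (fun t => expi (y * t) * f t).
Proof.
by have := s1_nice (mod y f); congr nice; apply/funext => t; rewrite modE.
Qed.

Lemma ft_tame f y : tame (fun t => expi (y * t) * f t).
Proof.
by have := s1_tame (mod y f); congr tame; apply/funext => t; rewrite modE.
Qed.

Lemma ft_bound f y : cabs (ft_fun f y) <= 2 * pi * snorm (P f).
Proof.
apply: int1_bound; first exact: (ft_nice f y).1.
by move=> t; rewrite cabsM cabs_expi mul1r; exact: s1_bound.
Qed.

Lemma ft_lin k f g y : ft_fun (k *: f + g) y = k * ft_fun f y + ft_fun g y.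
Proof.
rewrite /ft_fun -int1_lin; [|exact: ft_nice|exact: ft_nice].
by apply: eq_int1 => t; rewrite schwartz_linE; ring.
Qed.

Lemma ft_scale k f y : ft_fun (k *: f) y = k * ft_fun f y.
Proof.
rewrite /ft_fun -int1Z; last exact: ft_nice.
by apply: eq_int1 => t; rewrite schwartzZE; ring.
Qed.

Lemma ft_isd f y : isd (ft_fun f) y (1 : R) (ft_fun ('i *: Q f) y).
Proof.
pose M := 4 * snorm (P (Q (Q f))).
apply: (isd_quadratic (K := 2 * pi * M)) => h _.
rewrite [h *: _]mulr1 /ft_fun -int1B; [|exact: ft_nice|exact: ft_nice].
rewrite -int1Z; [|exact: ft_nice].
rewrite -int1B; [|by apply: niceB; exact: ft_nice|by apply: niceZ; exact: ft_nice].
rewrite -[X in _ <= X]mulrA; apply: int1_bound.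
  have n1 : nice (fun t => expi ((y + h) * t) * f t - expi (y * t) * f t).
    by apply: niceB; exact: ft_nice.
  by have := niceB n1 (niceZ h%:C (ft_nice ('i *: Q f) y)); case.
move=> t; rewrite schwartzZE sXE /=.
rewrite (_ : _ - _ - _ = (expi (y * t + h * t) - expi (y * t) - (h * t)%:C * ('i * expi (y * t))) * f t);
  last by rewrite mulrDl rmorphM /=; ring.
rewrite cabsM; apply: le_trans (ler_wpM2r (cabs_ge0 _) (expi_taylor (y * t) (h * t))) _.
have := s1_bound (Q (Q f)) t; rewrite !sXE /= !cabsM !cabsR => H.
rewrite exprMn /M.
have -> : 4 * (h ^+ 2 * t ^+ 2) * cabs (f t) = 4 * h ^+ 2 * (`|t| * (`|t| * cabs (f t))).
  by rewrite -[t ^+ 2]real_normK ?num_real //; ring.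
have -> : 4 * snorm (P (Q (Q f))) * h ^+ 2 * wt t = 4 * h ^+ 2 * (snorm (P (Q (Q f))) * wt t).
  by move: (snorm _) => A; ring.
by rewrite ler_wpM2l // mulr_ge0 // sqr_ge0.
Qed.

Lemma mod_D y f t : D (mod y f) t = expi (y * t) * D f t + y%:C * ('i * (expi (y * t) * f t)).
Proof.
apply: isd_unique (isd_schwartz regL (mod y f) t tt) _.
have H := isdM (isd_expi_coord regL y tt tt t) (isd_schwartz regL f t tt).
have -> : expi (y * t) * D f t + y%:C * ('i * (expi (y * t) * f t)) =
    (y * 1)%:C * ('i * expi (y * t)) * f t + expi (y * t) * D f t by rewrite mulr1; ring.
by apply: isd_ext H => u; rewrite modE.
Qed.

(** The derivative of e^(i y t) f(t) has integral 0, and the product rule splits it into the two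
    transforms. *)
Lemma ft_X f y : y%:C * ft_fun f y = ft_fun ('i *: D f) y.
Proof.
have := int1_sD (mod y f).
rewrite (eq_int1 (g := fun t => y%:C * 'i * (expi (y * t) * f t) + expi (y * t) * D f t)); last first.
  by move=> t; rewrite mod_D addrC !mulrA.
rewrite int1_lin; [|exact: ft_nice|exact: ft_nice].
rewrite -!/(ft_fun _ _) => /eqP; rewrite addr_eq0 => /eqP H.
rewrite ft_scale -[ft_fun (D f) y]opprK -H.
have i2 : 'i * 'i = - 1 :> C by apply: complex_ext => /=; ring.
rewrite mulrN (_ : 'i * _ = 'i * 'i * (y%:C * ft_fun f y)); last by ring.
by rewrite i2 mulN1r opprK.
Qed.

Lemma ft0_clin : exists2 L : S1 -> S1, clin L & forall f y, L f y = ft_fun f y.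
Proof.
pose F (L : clmap (line R) (line R)) f (y : line R) := ft_fun (L f) y.
apply: (class_clin regL (F := F) (i := cl_id (line R))).
- move=> L; exists (fun f => 2 * pi * snorm (P (L f))) => [|f y]; last exact: ft_bound.
  apply: domdZ; first by rewrite mulr_ge0 // pi_ge0.
  exact: (domd_cl L (domd_clin (sP_clin regL tt) (domd_snorm _))).
- move=> L []; exists [:: cl_scale 'i (cl_comp (cl_X regL tt) L)] => f y.
  by rewrite big_seq1; exact: ft_isd.
- move=> L []; exists [:: cl_scale 'i (cl_comp (cl_D regL tt) L)] => f y.
  by rewrite big_seq1; exact: ft_X.
- by move=> k f g y; exact: ft_lin.
Qed.

Definition ft0 : S1 -> S1 := s2val (cid2 ft0_clin).
Lemma ft0_clinP : clin ft0.
Proof. exact: (s2valP (cid2 ft0_clin)). Qed.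
Lemma ft0E f y : ft0 f y = int1 (fun t => expi (y * t) * f t).
Proof. exact: (s2valP' (cid2 ft0_clin)). Qed.

Lemma continuous_expi2 : continuous (fun p : R * R => @expi R (p.1 * p.2)).
Proof.
have c1 : continuous (fun p : R * R => p.1 * p.2).
  by move=> p; apply: cvgM; [exact: cvg_fst|exact: cvg_snd].
have c2 : continuous (@expi R).
  by apply: (@lipschitz_continuous R R _ 2) => s t; exact: expi_lipschitz.
by move=> p; apply: (cvg_comp _ _ (c1 p) (c2 _)).
Qed.

Lemma nice2_phase f g (w : R * R -> C) : continuous w -> (forall p, cabs (w p) <= 1) ->
  nice2 (fun p => w p * (f p.1 * g p.2)).
Proof.
move=> cw w1; split.
  have ct : continuous (fun p : R * R => f p.1 * g p.2).
    have -> : (fun p : R * R => f p.1 * g p.2) = tensor f g.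
      by apply/funext => p; rewrite tensorE.
    exact: (schwartz_continuous (plane_regular R)).
  exact: ccontinuousM cw ct.
exists (snorm (P f) * snorm (P g)) => p; rewrite !cabsM.
apply: le_trans (ler_piMl (mulr_ge0 (cabs_ge0 _) (cabs_ge0 _)) (w1 p)) _.
by rewrite mulrACA ler_pM ?cabs_ge0 ?s1_bound.
Qed.

Lemma ft0_mult f g : int1 (fun y => f y * ft0 g y) = int1 (fun x => ft0 f x * g x).
Proof.
have n2 : nice2 (fun p : R * R => expi (p.1 * p.2) * (f p.1 * g p.2)).
  apply: nice2_phase; first exact: continuous_expi2.
  by move=> p; rewrite cabs_expi.
have := int1_swap n2; rewrite (eq_int1 (g := fun y => f y * ft0 g y)); last first.
  move=> y; rewrite ft0E -int1Z; last exact: ft_nice.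
  by apply: eq_int1 => t /=; ring.
move=> ->; apply: eq_int1 => x.
rewrite ft0E mulrC -int1Z; last exact: ft_nice.
by apply: eq_int1 => t /=; rewrite [t * x]mulrC; ring.
Qed.

(* Compare the integrals of g(d s) (ft0 f)(s) and f(d s) (ft0 g)(s) as d -> 0. *)
Lemma ft0_inversion0_const f g : int1 (ft0 f) * g 0 = f 0 * int1 (ft0 g).
Proof.
have [K1 K10 K1E] := mollify g (ft0 f); have [K2 K20 K2E] := mollify f (ft0 g).
apply/eqP; rewrite -subr_eq0; apply/eqP/cabs_eq0/eqP; rewrite eq_le cabs_ge0 andbT.
apply/ler_addgt0Pl => e e0; rewrite addr0.
pose d := e / (K1 + K2 + 1).
have K12 : 0 < K1 + K2 + 1 by rewrite ltr_wpDl // addr_ge0.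
have d0 : 0 < d by rewrite divr_gt0.
have dN0 : d != 0 by rewrite gt_eqF.
have dVN0 : d^-1 != 0 by rewrite invr_eq0.
have H : int1 (fun s => g (0 + d * s) * ft0 f s) = int1 (fun s => f (0 + d * s) * ft0 g s).
  have E1 : int1 (fun s => g (0 + d * s) * ft0 f s) = int1 (fun s => aff1 0 dN0 g s * ft0 f s).
    by apply: eq_int1 => s; rewrite aff1E addr0 add0r.
  rewrite E1 ft0_mult.
  have E2 s : ft0 (aff1 0 dN0 g) s = d^-1%:C * ft0 g (d^-1 * s + 0).
    rewrite !ft0E (int1_affine 0 dN0 (ft_tame g _)) mulrA -rmorphM gtr0_norm // mulVf // rmorph1 mul1r.
    apply: eq_int1 => t; rewrite aff1E !addr0.
    by congr (expi _ * _); field.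
  rewrite (eq_int1 (g := fun x => d^-1%:C * (ft0 g (d^-1 * x + 0) * f x))); last first.
    by move=> x; rewrite E2 mulrA.
  have t1 : tame (fun x => aff1 0 dVN0 (ft0 g) x * f x).
    by have := s1_tame (smul regL (aff1 0 dVN0 (ft0 g)) f); congr tame; apply/funext => x; rewrite smulE.
  rewrite (eq_int1 (g := fun x => d^-1%:C * (aff1 0 dVN0 (ft0 g) x * f x))); last first.
    by move=> x; rewrite aff1E.
  rewrite int1Z; last exact: tame_nice.
  rewrite (int1_affine 0 dN0 t1) mulrA -rmorphM gtr0_norm // mulVf // rmorph1 mul1r.
  by apply: eq_int1 => s; rewrite aff1E !addr0 add0r mulrA mulVf // mul1r mulrC.
have h1 := K1E 0 d (ltW d0); have h2 := K2E 0 d (ltW d0).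
rewrite H in h1.
have -> : int1 (ft0 f) * g 0 - f 0 * int1 (ft0 g) =
  (int1 (fun s => f (0 + d * s) * ft0 g s) - f 0 * int1 (ft0 g)) -
  (int1 (fun s => f (0 + d * s) * ft0 g s) - g 0 * int1 (ft0 f)) by ring.
apply: le_trans (cabsB _ _) _; apply: le_trans (lerD h2 h1) _.
rewrite -mulrDl /d mulrCA ger_pMr // ler_pdivrMr // mul1r [K2 + _]addrC lerDl //.
Qed.

Definition gauss (x : R) : R := expR (- (x ^+ 2 / 2)).

Lemma gauss_gt0 x : 0 < gauss x.
Proof. exact: expR_gt0. Qed.

Lemma is_derive_gauss (k x : R) :
  is_derive x (1 : R) (fun y => expR (k * (y ^+ 2 / 2))) (k * x * expR (k * (x ^+ 2 / 2))).
Proof.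
have d1 : is_derive x (1 : R) (fun y : R => k * (y ^+ 2 / 2)) (k * x).
  apply: (is_derive_quadratic (K := `|k|)) => h _.
  rewrite [h *: _]mulr1 (_ : _ - _ - _ = k * (h ^+ 2 / 2)); last by field.
  rewrite normrM ler_wpM2l // ger0_norm ?divr_ge0 ?sqr_ge0 //.
  by rewrite ler_pdivrMr // ler_peMr ?sqr_ge0 // ler1n.
have H := @is_derive1_comp R expR (fun y => k * (y ^+ 2 / 2)) x _ _ (is_derive_expR _) d1.
by apply: (is_derive_eq H); rewrite mulrC.
Qed.

Lemma isd_gauss (k x : R) :
  isd (fun y : R => (expR (k * (y ^+ 2 / 2)))%:C) x (1 : R) ((k * x)%:C * (expR (k * (x ^+ 2 / 2)))%:C).
Proof.
split; last by rewrite cImM /= mulr0 mul0r addr0; exact: is_derive_cst.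
by rewrite cReM /= mulr0 subr0; exact: is_derive_gauss.
Qed.

Lemma pow_gauss_bound n : exists2 M, 0 <= M & forall x, `|x| ^+ n * gauss x <= M.
Proof.
(* With u = x^2 / c one has e^(x^2/2) = (e^u)^(n+1) >= (1 + u)^(n+1), while |x| <= c (1 + u). *)
pose c := 2 * n.+1%:R : R.
have c1 : 1 <= c by rewrite /c -natrM ler1n.
have c0 : 0 < c by exact: lt_le_trans c1.
exists (c ^+ n) => [|x]; first by rewrite exprn_ge0 // ltW.
rewrite /gauss expRN ler_pdivrMr ?expR_gt0 //.
pose u := x ^+ 2 / c.
have u0 : 0 <= u by rewrite divr_ge0 ?sqr_ge0 // ltW.
have -> : x ^+ 2 / 2 = u *+ n.+1.
  have m0 : n.+1%:R != 0 :> R by rewrite pnatr_eq0.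
  by rewrite /u /c -[RHS]mulr_natr; move: n.+1%:R m0 => m m0; field.
rewrite -[u *+ _]mulr_natl expRM_natl.
apply: le_trans (_ : (c * (1 + u)) ^+ n <= _).
  rewrite lerXn2r ?nnegrE ?mulr_ge0 ?addr_ge0 ?(ltW c0) //.
  have cu : c * u = x ^+ 2 by rewrite /u mulrCA divff ?mulr1 // gt_eqF.
  rewrite mulrDr mulr1 cu; apply: le_trans (_ : 1 + x ^+ 2 <= _); last by rewrite lerD2r.
  rewrite -subr_ge0 -(real_normK (num_real x)).
  have -> : 1 + `|x| ^+ 2 - `|x| = (1 - `|x|) ^+ 2 + `|x| by ring.
  by rewrite addr_ge0 ?sqr_ge0.
rewrite exprMn ler_wpM2l ?exprn_ge0 ?(ltW c0) //.
apply: le_trans (_ : (1 + u) ^+ n.+1 <= _).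
  by rewrite exprS ler_peMl ?exprn_ge0 ?addr_ge0 // lerDl.
by rewrite lerXn2r ?nnegrE ?addr_ge0 ?expR_ge0 ?expR_ge1Dx.
Qed.

End Fourier.

Section FourierInversion.
Variable R : realType.
Local Notation C := R[i].
Local Notation S1 := (schwartz (line R)).
Local Notation regL := (line_regular R).
Local Notation D := (sD (line_regular R) tt).
Local Notation Q := (sX (line_regular R) tt).
Local Notation ft0 := (@ft0 R).
Implicit Types (f g phi psi : S1) (s t x y h : R).

Let G (i : R * nat) (p : unit) (x : line R) : C := (i.1 * (x : R) ^+ i.2)%:C * (gauss (x : R))%:C.

Let G_coord i x : (x : R)%:C * G i tt x = G (i.1, i.2.+1) tt x.
Proof. by rewrite /G /= exprS mulrA -rmorphM mulrCA. Qed.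

Let isd_G i : exists s : seq (R * nat), forall x : line R,
  isd (G i tt) x (1 : R) (\sum_(k <- s) G k tt x).
Proof.
case: i => c; elim=> [|n [s IH]].
  exists [:: (- c, 1%N)] => x; rewrite big_seq1.
  have H := isdZ c%:C (isd_gauss (-1) x).
  have -> : G (- c, 1%N) tt x = c%:C * ((-1 * x)%:C * (expR (-1 * (x ^+ 2 / 2)))%:C).
    by rewrite [-1 * (x ^+ 2 / 2)]mulN1r /G /gauss expr1 -!rmorphM; congr (_%:C); rewrite /=; ring.
  by apply: isd_ext H => y; rewrite /G /gauss /= expr0 mulr1 mulN1r.
exists ((c, n) :: [seq (k.1, k.2.+1) | k <- s]) => x.
have H := isdM (isd_coord regL tt tt x) (IH x).
rewrite big_cons big_map.
have -> : G (c, n) tt x + \sum_(k <- s) G (k.1, k.2.+1) tt x =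
    1 * G (c, n) tt x + (x : R)%:C * \sum_(k <- s) G k tt x.
  rewrite mul1r; congr (_ + _); rewrite mulr_sumr; apply: eq_bigr => k _.
  by rewrite G_coord.
by apply: isd_ext H => y; exact: G_coord.
Qed.

Lemma gauss_schwartz : @is_schwartz R (line R) (fun x : R => (gauss x)%:C).
Proof.
have := (@class_schwartz R (line R) regL (R * nat)%type unit (fun _ => True) G I (fun _ _ _ _ => I)
   _ _ _ (1, 0%N) tt).
have -> : G (1, 0%N) tt = (fun x : R => (gauss x)%:C).
  by apply/funext => x; rewrite /G /= expr0 mulr1 mul1r.
apply.
- move=> [c n]; have [M M0 MH] := @pow_gauss_bound R n.
  exists (fun=> `|c| * M) => // -[] x; rewrite /G cabsM !cabsR (ger0_norm (ltW (gauss_gt0 _))).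
  by rewrite normrM normrX -mulrA ler_wpM2l.
- by move=> i []; have [s H] := isd_G i; exists s => -[] x; exact: H.
- by move=> i []; exists [:: (i.1, i.2.+1)] => -[] x; rewrite big_seq1; exact: G_coord.
Qed.

Definition gaussS : S1 := mk_schwartz gauss_schwartz.

Lemma gaussSE x : gaussS x = (gauss x)%:C.
Proof. by []. Qed.

Lemma gaussS_D : D gaussS = - Q gaussS.
Proof.
apply: sD_eq => x; have H := isd_gauss (-1) x.
have -> : (- Q gaussS) x = (-1 * x)%:C * (expR (-1 * (x ^+ 2 / 2)))%:C.
  rewrite -[(- Q gaussS) x]/(- (Q gaussS x)) sXE gaussSE /gauss mulN1r -mulNr -rmorphN.
  by rewrite mulN1r.
by apply: isd_ext H => y; rewrite mulN1r.
Qed.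

Lemma ft0_D f : D (ft0 f) = ft0 ('i *: Q f).
Proof.
apply: sD_eq => y; rewrite ft0E; apply: isd_ext (ft_isd f y) => z; exact/esym/ft0E.
Qed.

Lemma ft0_X f : Q (ft0 f) = ft0 ('i *: D f).
Proof. by apply: schwartz_ext => y; rewrite sXE !ft0E; exact: ft_X. Qed.

Lemma ft0_0 f : ft0 f 0 = int1 f.
Proof. by rewrite ft0E; apply: eq_int1 => t; rewrite mul0r expi0 mul1r. Qed.

(* ft0 gaussS satisfies the differential equation y' = - x y of the Gaussian. *)
Lemma ft0_gauss x : ft0 gaussS x = int1 gaussS * (gauss x)%:C.
Proof.
have c0 := @ft0_clinP R.
have E : D (ft0 gaussS) = - Q (ft0 gaussS).
  by rewrite ft0_D ft0_X gaussS_D scalerN -[- ('i *: _)]scaleN1r (clinZE c0 (-1)) scaleN1r opprK.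
pose H (y : R) : C := ft0 gaussS y * (expR (1 * (y ^+ 2 / 2)))%:C.
have dH y : isd H (0 + y *: (1 : R)) (1 : R) 0.
  rewrite add0r [y *: 1]mulr1.
  have := isdM (isd_schwartz regL (ft0 gaussS) y tt) (isd_gauss 1 y).
  rewrite E -[(- Q _) y]/(- (Q (ft0 gaussS) y)) sXE mul1r /=.
  by congr isd; ring.
have b0 : R -> cabs (0 : C) <= 0 by rewrite cabs0.
have := isd_mvt dH b0 x; rewrite mulr0 mul0r add0r [x *: 1]mulr1 => H0.
have {}H0 : H x = H 0.
  by apply/eqP; rewrite -subr_eq0; apply/eqP/cabs_eq0/eqP; rewrite eq_le H0 cabs_ge0.
rewrite -ft0_0; have -> : ft0 gaussS 0 = H 0.
  by rewrite /H expr0n /= mul0r mulr0 expR0 mulr1.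
rewrite -H0 /H -mulrA -rmorphM /gauss mul1r -expRD subrr expR0 mulr1 //.
Qed.

Lemma int_gauss : int1 gaussS = (Num.sqrt 2 * Num.sqrt pi)%:C.
Proof.
have s2 : Num.sqrt 2 != 0 :> R by rewrite gt_eqF // sqrtr_gt0.
(* Scaling by sqrt 2 turns the integrand into e^(-x^2), whose integral is sqrt pi. *)
rewrite (int1_affine 0 s2 (s1_tame gaussS)) ger0_norm ?sqrtr_ge0 // rmorphM; congr (_ * _).
rewrite /int1 /cintegral; apply: complex_ext => /=; last first.
  by rewrite /Rintegral integral0.
rewrite /Rintegral; have := @integralT_gauss R => H.
rewrite -[RHS]/(fine (Num.sqrt pi)%:E) -H; congr fine; apply: eq_integral => x _.
congr (_%:E); rewrite /gauss /gauss_fun addr0 exprMn sqr_sqrtr //.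
by rewrite mulrAC divff ?mul1r.
Qed.

(** Comparison with the Gaussian fixes the constant: its integral sqrt(2 pi) occurs once as a factor
    of its transform and once more when that transform is integrated. *)
Lemma ft0_integral f : int1 (ft0 f) = (2 * pi)%:C * f 0.
Proof.
have := ft0_inversion0_const f gaussS.
rewrite gaussSE /gauss expr0n /= mul0r oppr0 expR0 mulr1 => ->.
rewrite (eq_int1 (ft0_gauss)) int1Z; last exact: s1_nice gaussS.
rewrite -[int1 (fun x => _)]/(int1 gaussS) int_gauss -rmorphM mulrACA -!expr2.
by rewrite !sqr_sqrtr ?pi_ge0 // mulrC.
Qed.

Lemma ft0_ft0 f y : ft0 (ft0 f) y = (2 * pi)%:C * f (- y).
Proof.
have o0 : (1 : R) != 0 by exact: oner_neq0.
have -> : f (- y) = aff1 (- y) o0 f 0 by rewrite aff1E mulr0 add0r.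
rewrite -ft0_integral ft0E; apply: eq_int1 => t.
rewrite [RHS]ft0E ft0E.
rewrite (int1_affine y o0 (ft_tame (aff1 (- y) o0 f) t)) normr1 rmorph1 mul1r.
rewrite -int1Z; last exact: ft_nice.
apply: eq_int1 => x; rewrite aff1E !mul1r addrK mulrA -expiD.
by congr (expi _ * _); ring.
Qed.

Definition s2pi : C := (Num.sqrt (2 * pi))%:C.

Lemma s2pi_neq0 : s2pi != 0.
Proof.
have h : 0 < Num.sqrt (2 * pi) :> R by rewrite sqrtr_gt0 mulr_gt0 // pi_gt0.
by apply/negP => /eqP/(congr1 (@complex.Re R)) /= H; rewrite H ltxx in h.
Qed.

Lemma s2pi_sqr : s2pi * s2pi = (2 * pi)%:C.
Proof. by rewrite -rmorphM -expr2 sqr_sqrtr // mulr_ge0 // pi_ge0. Qed.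

Definition ft f : S1 := s2pi^-1 *: ft0 f.

Lemma ft_clin : clin ft.
Proof. exact: clinZ (@ft0_clinP R). Qed.

Lemma ft_ft f y : ft (ft f) y = f (- y).
Proof.
rewrite /ft (clinZE (@ft0_clinP R)) !schwartzZE ft0_ft0 -s2pi_sqr.
have := s2pi_neq0; move: s2pi => k k0; field => //.
Qed.

(** As [ft] squared is the reflection, its fourth power is the identity and its cube is the
    inverse. *)
Definition ift f : S1 := ft (ft (ft f)).

Lemma ift_clin : clin ift.
Proof. exact: clin_comp ft_clin (clin_comp ft_clin ft_clin). Qed.

Lemma ift_ft f : ift (ft f) = f.
Proof. by apply: schwartz_ext => y; rewrite /ift !ft_ft opprK. Qed.

Lemma ft_ift f : ft (ift f) = f.
Proof. by apply: schwartz_ext => y; rewrite /ift !ft_ft opprK. Qed.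

(** Testing the difference against Gaussians centred at x with width tending to 0 recovers its value
    at x. *)
Lemma emb1_separates f g : (forall psi, int1 (fun x => f x * psi x) = int1 (fun x => g x * psi x)) ->
  f = g.
Proof.
move=> fg; apply/eqP; rewrite -subr_eq0; apply/eqP; set d := f - g.
have d0 psi : int1 (fun x => d x * psi x) = 0.
  have nf (k : S1) : nice (fun x => k x * psi x).
    by have := s1_nice (smul regL k psi); congr nice; apply/funext => x; rewrite smulE.
  rewrite (eq_int1 (g := fun x => f x * psi x - g x * psi x)).
    by rewrite int1B // fg subrr.
  by move=> x; rewrite /d schwartzBE mulrBl.
apply: schwartz_ext => x; have [K K0 H] := mollify d gaussS.
have m0 : 0 < cabs (int1 gaussS).
  rewrite int_gauss cabsR normr_gt0 mulf_neq0 // gt_eqF // sqrtr_gt0 ?pi_gt0 //.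
apply/cabs_eq0/eqP; rewrite eq_le cabs_ge0 andbT -(pmulr_lle0 _ m0).
apply/ler_addgt0Pl => e e0; rewrite addr0.
pose eps := e / (K + 1).
have K1 : 0 < K + 1 by rewrite ltr_wpDl.
have eps0 : 0 < eps by rewrite divr_gt0.
have epsN : eps^-1 != 0 by rewrite invr_eq0 gt_eqF.
have epsN0 : eps != 0 by rewrite gt_eqF.
have E : int1 (fun s => d (x + eps * s) * gaussS s) = 0.
  pose psi := aff1 (- (eps^-1 * x)) epsN gaussS.
  have t1 : tame (fun u => d u * psi u).
    by have := s1_tame (smul regL d psi); congr tame; apply/funext => u; rewrite smulE.
  have := d0 psi; rewrite (int1_affine x epsN0 t1) gtr0_norm // => /eqP.
  rewrite mulf_eq0 => /orP[/eqP/(congr1 (@complex.Re R)) /= h|/eqP <-].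
    by rewrite h ltxx in eps0.
  apply: eq_int1 => s; rewrite /psi aff1E [eps * s + x]addrC; congr (_ * gaussS _).
  by field.
have := H x eps (ltW eps0); rewrite E sub0r cabsN cabsM mulrC => /le_trans; apply.
by rewrite /eps mulrCA ger_pMr // ler_pdivrMr // mul1r lerDl.
Qed.

End FourierInversion.

(** * The twisted product as a composition of kernels *)

Section Weyl.
Variable R : realType.
Local Notation C := R[i].
Local Notation S2 := (schwartz (plane R)).
Local Notation regP := (plane_regular R).
Local Notation ft0 := (@ft0 R).
Local Notation r2 := (Num.sqrt 2 : R)^-1.
Implicit Types (k l f g : S2) (x y z t : R).

Lemma r2_gt0 : 0 < r2.
Proof. by rewrite invr_gt0 sqrtr_gt0. Qed.

Lemma r2_sqr : r2 * r2 = 2^-1.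
Proof. by rewrite -invfM -expr2 sqr_sqrtr. Qed.

Lemma r2_double : 2 * r2 = Num.sqrt 2.
Proof.
have s0 : Num.sqrt 2 != 0 :> R by rewrite gt_eqF // sqrtr_gt0.
have {1}-> : 2 = Num.sqrt 2 * Num.sqrt 2 :> R by rewrite -expr2 sqr_sqrtr.
by rewrite mulfK.
Qed.

Lemma rho_det : r2 * - r2 - r2 * r2 != 0.
Proof.
by rewrite mulrN -opprD r2_sqr oppr_eq0 gt_eqF // addr_gt0 ?invr_gt0.
Qed.

(** Composition with an orthogonal reflection of the plane, hence an involution; it is the change of
    variables inside the Wigner transform. *)
Definition rho : S2 -> S2 := aff2 0 0 rho_det.

Lemma rho_clin : clin rho.
Proof. exact: aff2_clin. Qed.

Lemma rhoE l x y : rho l (x, y) = l (r2 * (x + y), r2 * (x - y)).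
Proof. by rewrite /rho aff2E /=; congr (l (_, _)); ring. Qed.

Lemma rho_rho l : rho (rho l) = l.
Proof.
apply: schwartz_ext => -[x y]; rewrite !rhoE.
have H := r2_sqr.
have E1 : r2 * (r2 * (x + y) + r2 * (x - y)) = x.
  by rewrite -mulrDr mulrA H; field.
have E2 : r2 * (r2 * (x + y) - r2 * (x - y)) = y.
  by rewrite -mulrBr mulrA H; field.
by rewrite E1 E2.
Qed.

Definition pft : S2 -> S2 := opt (@ft_clin R).
Definition pift : S2 -> S2 := opt (@ift_clin R).
Definition pft0 : S2 -> S2 := opt (@ft0_clinP R).

Lemma pft_clin : clin pft. Proof. exact: opt_clin. Qed.
Lemma pift_clin : clin pift. Proof. exact: opt_clin. Qed.

Lemma pft_pift l : pft (pift l) = l.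
Proof. by apply: plane_ext => t; rewrite !slice_opt ft_ift. Qed.

Lemma pift_pft l : pift (pft l) = l.
Proof. by apply: plane_ext => t; rewrite !slice_opt ift_ft. Qed.

(** The formula of [Wbarinv] splits into a reflection and a Fourier transform in the second
    variable. Both are invertible on S, which gives [Vinv], and [WbarinvE] identifies the two
    maps. *)
Definition V : S2 -> S2 := pft \o rho.
Definition Vinv : S2 -> S2 := rho \o pift.

Lemma V_clin : clin V. Proof. exact: clin_comp pft_clin rho_clin. Qed.
Lemma Vinv_clin : clin Vinv. Proof. exact: clin_comp rho_clin pift_clin. Qed.

Lemma VK l : V (Vinv l) = l.
Proof. by rewrite /V /Vinv /= rho_rho pft_pift. Qed.

Lemma VinvK l : Vinv (V l) = l.
Proof. by rewrite /V /Vinv /= pift_pft rho_rho. Qed.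

Lemma pft0E l (u : R * R) : pft0 l u = int1 (fun t => expi (u.2 * t) * l (u.1, t)).
Proof. by rewrite /pft0 optE ft0E. Qed.

Lemma VE l (u : R * R) : V l u = (s2pi R)^-1 * int1 (fun t => expi (u.2 * t) * rho l (u.1, t)).
Proof. by rewrite /V /= /pft optE /ft schwartzZE ft0E. Qed.

Lemma WbarinvE l : Wbarinv l = V l.
Proof.
rewrite /Wbarinv.
have -> : (fun u : plane R => (Num.sqrt (2 * pi))^-1%:C * int1 (fun z =>
    l ((u.1 + z) / Num.sqrt 2, (u.1 - z) / Num.sqrt 2) * expi (u.2 * z))) = V l.
  apply/funext => u; rewrite VE; congr (_ * _); last first.
    by apply: eq_int1 => z; rewrite rhoE mulrC ![_ / Num.sqrt 2]mulrC.
  by rewrite /s2pi fmorphV.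
by apply: schwartz_ext => u; rewrite to_schwartzE //; exact: schwartzP.
Qed.

Lemma pft0_V l x y : pft0 (V l) (x, y) = s2pi R * rho l (x, - y).
Proof.
rewrite /pft0 optE /=.
have -> : slice (V l) x = (s2pi R)^-1 *: ft0 (slice (rho l) x) by rewrite /V /= slice_opt.
rewrite (clinZE (@ft0_clinP R)) schwartzZE ft0_ft0 -s2pi_sqr sliceE -[s2pi R * _ * _]mulrA mulrA.
by rewrite mulVf ?mul1r // s2pi_neq0.
Qed.

Lemma continuous_phase (F : R * R -> R) : continuous F -> continuous (fun p => @expi R (F p)).
Proof.
move=> cF p.
have c2 : continuous (@expi R).
  by apply: (@lipschitz_continuous R R _ 2) => s t; exact: expi_lipschitz.
exact: (cvg_comp _ _ (cF p) (c2 _)).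
Qed.

Lemma continuous_plane_affine (a b c : R) : continuous (fun p : R * R => a * p.1 + b * p.2 + c).
Proof.
move=> p; apply: cvgD; last exact: cvg_cst.
by apply: cvgD; apply: cvgMr; [exact: cvg_fst|exact: cvg_snd].
Qed.

Lemma nice2_modulated (F : R * R -> R) l : continuous F ->
  nice2 (fun p => expi (F p) * l p).
Proof.
move=> cF; have [cl [M lM]] := s2_nice2 l; split.
  exact: ccontinuousM (continuous_phase cF) cl.
by exists M => p; rewrite cabsM cabs_expi mul1r.
Qed.

Lemma nice2Z (k : C) (F : R * R -> C) : nice2 F -> nice2 (fun p => k * F p).
Proof.
move=> [cF [M FM]]; have ck : continuous (fun _ : R * R => k) by move=> p; exact: cvg_cst.
split; first exact: ccontinuousM ck cF.
by exists (cabs k * M) => p; rewrite cabsM -mulrA ler_wpM2l ?cabs_ge0.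
Qed.

Lemma swap_det : (0 : R) * 0 - 1 * 1 != 0.
Proof. by rewrite mul0r mul1r sub0r oppr_eq0 oner_neq0. Qed.

Definition swap : S2 -> S2 := aff2 0 0 swap_det.

Lemma swapE l x y : swap l (x, y) = l (y, x).
Proof. by rewrite /swap aff2E /=; congr (l (_, _)); ring. Qed.

Section TwistIntegral.
Variables (f g : S2) (u : R * R).

Let inner (v : R * R) : int2 (fun w => f v * g w * expi (symp u v + symp v w + symp w u)) =
  expi (u.1 * v.2 - u.2 * v.1) *
    (f v * int1 (fun w1 => expi ((u.2 - v.2) * w1) * pft0 g (w1, v.1 - u.1))).
Proof.
pose F (w : R * R) : R := (u.2 - v.2) * w.1 + (v.1 - u.1) * w.2 + 0.
have n1 : nice2 (fun w => expi (F w) * g w).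
  by apply: nice2_modulated; exact: continuous_plane_affine.
have E : (fun w => f v * g w * expi (symp u v + symp v w + symp w u)) =
   (fun w => (expi (u.1 * v.2 - u.2 * v.1) * f v) * (expi (F w) * g w)).
  apply/funext => w; rewrite (_ : symp u v + _ + _ = (u.1 * v.2 - u.2 * v.1) + F w).
    by rewrite expiD; ring.
  by rewrite /symp /F; ring.
have n2 : nice2 (fun w => (expi (u.1 * v.2 - u.2 * v.1) * f v) * (expi (F w) * g w)).
  exact: nice2Z n1.
rewrite E (int2_iter12 n2) mulrA.
rewrite -int1Z; last by have := ft_nice (slice (swap (pft0 g)) (v.1 - u.1)) (u.2 - v.2);
  congr nice; apply/funext => t; rewrite sliceE swapE.
apply: eq_int1 => w1; rewrite pft0E /= int1Z; last exact: (nice2_snd w1 n1).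
congr (_ * _); rewrite -int1Z; last exact: ft_nice (slice g w1) _.
apply: eq_int1 => w2; rewrite /F /= addr0 expiD mulrA //.
Qed.

Let K : S2 := pft0 (swap (pft0 g)).

Let KE s r : K (s, r) = int1 (fun w1 => expi (r * w1) * pft0 g (w1, s)).
Proof. by rewrite /K pft0E; apply: eq_int1 => t; rewrite swapE. Qed.

Let Kdet : (1 : R) * (- 1) - 0 * 0 != 0.
Proof. by rewrite mul1r mul0r subr0 oppr_eq0 oner_neq0. Qed.

(** Of the four integrations, those over w2 and v2 are partial Fourier transforms of g and f.
    Carrying them out leaves values of [pft0], and on functions of the form [V l] this transform
    undoes the Fourier part of [V]. *)
Lemma twist_iterated :
  int2 (fun v => int2 (fun w => f v * g w * expi (symp u v + symp v w + symp w u))) =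
  int1 (fun v1 => int1 (fun w1 => expi (u.2 * (w1 - v1)) *
    (pft0 g (w1, v1 - u.1) * pft0 f (v1, u.1 - w1)))).
Proof.
(* The integral over w is, up to a phase and the factor [f v], an affine image of the full Fourier
   transform of g. It is thus a Schwartz function of v, which supplies the majorant for Fubini. *)
pose K' := aff2 (- u.1) u.2 Kdet K.
have K'E v : K' v = int1 (fun w1 => expi ((u.2 - v.2) * w1) * pft0 g (w1, v.1 - u.1)).
  rewrite /K' aff2E !mul1r !mul0r addr0 add0r mulN1r KE.
  by apply: eq_int1 => w1; rewrite [- v.2 + _]addrC.
pose F (v : R * R) : R := - u.2 * v.1 + u.1 * v.2 + 0.
have n1 : nice2 (fun v => expi (F v) * smul regP f K' v).
  by apply: nice2_modulated; exact: continuous_plane_affine.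
have -> : (fun v => int2 (fun w => f v * g w * expi (symp u v + symp v w + symp w u))) =
    (fun v => expi (F v) * smul regP f K' v).
  apply/funext => v; rewrite inner smulE K'E; congr (expi _ * _).
  by rewrite /F; ring.
rewrite (int2_iter12 n1); apply: eq_int1 => v1.
pose chi0 := slice (swap (pft0 g)) (v1 - u.1).
have chiE0 w1 : chi0 w1 = pft0 g (w1, v1 - u.1) by rewrite /chi0 sliceE swapE.
pose ph (p : R * R) : R := u.1 * p.1 + (u.2 - p.1) * p.2 - u.2 * v1.
have n2 : nice2 (fun p => expi (ph p) * (slice f v1 p.1 * chi0 p.2)).
  apply: nice2_phase; last by move=> p; rewrite cabs_expi.
  apply: continuous_phase => p; rewrite /ph.
  apply: cvgB; last exact: cvg_cst.
  apply: cvgD; first by apply: cvgMr; exact: cvg_fst.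
  by apply: cvgM; [apply: cvgB; [exact: cvg_cst|exact: cvg_fst]|exact: cvg_snd].
transitivity (int1 (fun v2 => int1 (fun w1 => expi (ph (v2, w1)) * (slice f v1 v2 * chi0 w1)))).
  apply: eq_int1 => v2; rewrite smulE K'E mulrA -int1Z; last first.
    by have := ft_nice chi0 (u.2 - v2); congr nice; apply/funext => t; rewrite chiE0.
  apply: eq_int1 => w1; rewrite chiE0 sliceE /= /F /ph /=.
  rewrite (_ : u.1 * v2 + (u.2 - v2) * w1 - u.2 * v1 = - u.2 * v1 + u.1 * v2 + 0 + (u.2 - v2) * w1).
    by rewrite [expi (_ + (u.2 - v2) * w1)]expiD; ring.
  by ring.
rewrite (int1_swap n2); apply: eq_int1 => w1.
rewrite [pft0 f _]pft0E mulrA -int1Z; last exact: ft_nice (slice f v1) _.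
apply: eq_int1 => v2; rewrite -[chi0 _]/(chi0 w1) chiE0 /ph /=.
rewrite (_ : u.1 * v2 + (u.2 - v2) * w1 - u.2 * v1 = u.2 * (w1 - v1) + (u.1 - w1) * v2); last by ring.
by rewrite expiD; ring.
Qed.

End TwistIntegral.

(** The constant of the kernel action on functions: 1/sqrt 2 from its definition times 1/sqrt(2 pi),
    the quotient of the two normalisations of Lebesgue measure. *)
Definition s4pi : C := (Num.sqrt (4 * pi))%:C.

Lemma s4pi_neq0 : s4pi != 0.
Proof.
have h : 0 < Num.sqrt (4 * pi) :> R by rewrite sqrtr_gt0 mulr_gt0 // pi_gt0.
by apply/negP => /eqP/(congr1 (@complex.Re R)) /= H; rewrite H ltxx in h.
Qed.

(** Written as the operator with kernel l applied to the second variable of k, so that the result is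
    a Schwartz function by construction. *)
Definition kprod k l : S2 := s4pi^-1 *: opt (kop_clin l) k.

Lemma kprodE k l x y : kprod k l (x, y) = s4pi^-1 * int1 (fun t => k (x, t) * l (t, y)).
Proof. by rewrite /kprod schwartzZE optE /= kopE. Qed.

End Weyl.

(** * The product formula for [V], and the trace pairing *)

Section TwistKernel.
Variable R : realType.
Local Notation C := R[i].
Local Notation S1 := (schwartz (line R)).
Local Notation S2 := (schwartz (plane R)).
Local Notation regL := (line_regular R).
Local Notation regP := (plane_regular R).
Local Notation r2 := (Num.sqrt 2 : R)^-1.
Local Notation s2pi := (s2pi R).
Local Notation s4pi := (s4pi R).
Implicit Types (k l m f g : S2) (psi phi : S1).

Let one0 : (1 : R) != 0. Proof. exact: oner_neq0. Qed.
Let r0 : r2 != 0. Proof. by rewrite gt_eqF // r2_gt0. Qed.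
Let rr0 : 2 * r2 != 0. Proof. by rewrite mulf_neq0 // gt_eqF. Qed.

(** The factors are, in order: the prefactor of the twisted product, the square of [s2pi] produced
    by [pft0_V] applied twice, the Jacobian of the substitution, the normalisation of [kprod] and
    that of [V]. *)
Lemma twist_constant : (4 * pi ^+ 2)^-1 * (2 * pi) * (2 * r2)^-1 * Num.sqrt (4 * pi) * Num.sqrt (2 * pi) = 1 :> R.
Proof.
have s0 : Num.sqrt 2 != 0 :> R by rewrite gt_eqF // sqrtr_gt0.
have p0 : pi != 0 :> R by rewrite gt_eqF // pi_gt0.
have -> : 4 * pi = 2 * (2 * pi) :> R by rewrite mulrA -natrM.
rewrite sqrtrM // r2_double -!mulrA -expr2 sqr_sqrtr ?mulr_ge0 ?pi_ge0 //.
move: (pi : R) p0 => p p0; move: (Num.sqrt (2 : R)) s0 => q q0.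
by field; rewrite p0 q0.
Qed.

Section AtPoint.
Variables (k l : S2) (u : R * R).

Let dk : (0 : R) * 0 - r2 * 1 != 0.
Proof. by rewrite mul0r mulr1 sub0r oppr_eq0. Qed.
Let dl : (1 : R) * - r2 - 0 * 0 != 0.
Proof. by rewrite mul1r mul0r subr0 oppr_eq0. Qed.
Let dN : (2 * r2) * 1 - r2 * 0 != 0.
Proof. by rewrite mulr1 mulr0 subr0. Qed.

(** [M (t, z)] is the integrand, over t, of [rho (kprod k l) (u.1, z)] up to [s4pi]. The
    substitutions z = w - v and t = 2 r2 v + r2 (z - u.1) bring the iterated integral to this form;
    N below is M in the variables v, z together with the phase. *)
Let M : S2 := smul regP (aff2 (r2 * u.1) 0 dk k) (aff2 0 (r2 * u.1) dl l).

Let ME t z : M (t, z) = k (r2 * (u.1 + z), t) * l (t, r2 * (u.1 - z)).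
Proof.
rewrite /M smulE !aff2E /=.
by congr (k (_, _) * l (_, _)); ring.
Qed.

Let N : S2 := smod regP u.2 true (aff2 (- (r2 * u.1)) 0 dN M).

Let NE v z : N (v, z) = expi (u.2 * z) * M (2 * r2 * v + (r2 * z - r2 * u.1), z).
Proof.
rewrite /N smodE aff2E /=; congr (_ * M (_, _)); ring.
Qed.

Let integrand v w : expi (u.2 * (w - v)) *
    (pft0 (V k) (w, v - u.1) * pft0 (V l) (v, u.1 - w)) = (2 * pi)%:C * N (v, 1 * w + - v).
Proof.
rewrite !pft0_V !rhoE NE ME -s2pi_sqr mul1r !opprB.
have H : r2 * (2 * r2) = 1.
  have := r2_sqr R; rewrite mulrCA => ->; by rewrite mulfV.
have -> : r2 * (w + (u.1 - v)) = r2 * (u.1 + (w - v)) by ring.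
have -> : r2 * (w + (v - u.1)) = 2 * r2 * v + (r2 * (w - v) - r2 * u.1) by ring.
have -> : r2 * (v + (w - u.1)) = 2 * r2 * v + (r2 * (w - v) - r2 * u.1) by ring.
have -> : r2 * (v + (u.1 - w)) = r2 * (u.1 + (v - w)) by ring.
ring.
Qed.

Let line_integral z : int1 (fun v => N (v, z)) =
  expi (u.2 * z) * ((2 * r2)^-1%:C * (s4pi * rho (kprod k l) (u.1, z))).
Proof.
rewrite (eq_int1 (g := fun v => expi (u.2 * z) * M (2 * r2 * v + (r2 * z - r2 * u.1), z))); last first.
  by move=> v; rewrite NE.
have tM := s2_fst_tame M z.
rewrite int1Z; last exact: (tame_nice (tame_affine _ rr0 tM)).
congr (_ * _); rewrite rhoE kprodE mulVKf ?s4pi_neq0 //.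
have <- : int1 (fun t => M (t, z)) = int1 (fun t => k (r2 * (u.1 + z), t) * l (t, r2 * (u.1 - z))).
  by apply: eq_int1 => t; rewrite ME.
rewrite (int1_affine (r2 * z - r2 * u.1) rr0 tM) mulrA -rmorphM gtr0_norm.
  by rewrite mulVf // mul1r.
by rewrite mulr_gt0 // r2_gt0.
Qed.

Lemma twist_V_point :
  (4 * pi ^+ 2)^-1%:C * int2 (fun v => int2 (fun w =>
    V l v * V k w * expi (symp u v + symp v w + symp w u))) = V (kprod k l) u.
Proof.
rewrite twist_iterated.
rewrite (eq_int1 (g := fun v => (2 * pi)%:C * int1 (slice N v))); last first.
  move=> v; rewrite (int1_affine (- v) one0 (s1_tame (slice N v))) normr1 rmorph1 mul1r.
  rewrite -int1Z; last exact: (tame_nice (tame_affine _ one0 (s1_tame (slice N v)))).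
  by apply: eq_int1 => w; rewrite integrand.
rewrite int1Z; last exact: (tame_nice (functional_slice_tame (int_clinf R) N)).
rewrite (int1_swap (s2_nice2 N)).
rewrite (eq_int1 line_integral) VE.
rewrite (eq_int1 (g := fun z => (2 * r2)^-1%:C * s4pi * (expi (u.2 * z) * rho (kprod k l) (u.1, z)))); last first.
  by move=> z; ring.
rewrite int1Z; last exact: (ft_nice (slice (rho (kprod k l)) u.1)).
rewrite !mulrA; congr (_ * _).
apply: (mulIf (s2pi_neq0 R)); rewrite mulVf ?s2pi_neq0 //.
rewrite /s2pi /s4pi -!rmorphM -[RHS]/((1 : R)%:C); congr (_%:C).
by rewrite -[RHS]twist_constant expr2 !mulrA.
Qed.

End AtPoint.

Lemma twist_V k l : twist (V l) (V k) = V (kprod k l).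
Proof.
rewrite /twist; have -> : (fun u : plane R => (4 * pi ^+ 2)^-1%:C * int2 (fun v => int2 (fun w =>
    V l v * V k w * expi (symp u v + symp v w + symp w u)))) = V (kprod k l).
  by apply/funext => u; exact: twist_V_point.
by apply: schwartz_ext => u; rewrite to_schwartzE //; exact: schwartzP.
Qed.

Definition pairing m k : C := int1 (fun x => int1 (fun y => m (x, y) * k (x, y))).

Lemma emb2E m k : emb2 m k = (2 * pi)^-1%:C * pairing m k.
Proof.
rewrite /emb2 int2_iter12 //.
by have := s2_nice2 (smul regP m k); congr nice2; apply/funext => p; rewrite smulE.
Qed.

Lemma pairing_smul m k : pairing m k = int1 (fun x => int1 (slice (smul regP m k) x)).
Proof. by apply: eq_int1 => x; apply: eq_int1 => y; rewrite sliceE smulE. Qed.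

Lemma pairingC m k : pairing m k = pairing k m.
Proof. by apply: eq_int1 => x; apply: eq_int1 => y; rewrite mulrC. Qed.

Lemma pairing_tensor m psi phi :
  pairing (swap m) (tensor psi phi) = int1 (fun x => kop m phi x * psi x).
Proof.
apply: eq_int1 => x; rewrite kopE [RHS]mulrC -int1Z; last first.
  have := s1_nice (smul regL phi (slice (swap m) x)); congr nice; apply/funext => t.
  by rewrite smulE sliceE swapE.
by apply: eq_int1 => t; rewrite swapE tensorE /=; ring.
Qed.

Lemma swapK m : swap (swap m) = m.
Proof. by apply: schwartz_ext => -[x y]; rewrite !swapE. Qed.

(** Integrals against Schwartz functions of one variable separate points; this is used once in each
    variable. *)
Lemma pairing_ext f g : (forall psi phi, pairing f (tensor psi phi) = pairing g (tensor psi phi)) ->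
  f = g.
Proof.
move=> H; apply: plane_ext => x; apply: emb1_separates => phi.
have E h (y : R) : kop (swap h) phi y = int1 (fun t => slice h y t * phi t).
  by rewrite kopE; apply: eq_int1 => t; rewrite swapE sliceE mulrC.
suff Ek : kop (swap f) phi = kop (swap g) phi by rewrite -!E Ek.
by apply: emb1_separates => psi; rewrite -!pairing_tensor !swapK.
Qed.

Lemma int_rho m : int1 (fun x => int1 (slice (rho m) x)) = int1 (fun x => int1 (slice m x)).
Proof.
have d1 : (0 : R) * -1 - 1 * (2 * r2) != 0 by rewrite mul0r mul1r sub0r oppr_eq0.
have rV0 : r2^-1 != 0 by rewrite invr_eq0.
(* The state halfway: s = r2 (x + y) has replaced y, and x has still to be replaced by 2 r2 x - s.
   The factors r2^-1 and 2 r2 of the two substitutions are equal and cancel. *)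
pose W := aff2 0 0 d1 m.
have WE x s : W (x, s) = m (s, 2 * r2 * x - s).
  by rewrite /W aff2E /=; congr (m (_, _)); ring.
rewrite (eq_int1 (g := fun x => r2^-1%:C * int1 (slice W x))); last first.
  move=> x; rewrite (int1_affine (- x) rV0 (s1_tame (slice (rho m) x))) gtr0_norm ?invr_gt0 ?r2_gt0 //.
  congr (_ * _); apply: eq_int1 => s; rewrite !sliceE rhoE WE; congr (m (_, _)).
    by rewrite [x + _]addrC subrK mulVKf.
  by rewrite mulrBr mulrBr mulVKf //; ring.
rewrite int1Z; last exact: (tame_nice (functional_slice_tame (int_clinf R) _)).
rewrite (int1_swap (s2_nice2 W)) -int1Z; last first.
  have := tame_nice (functional_slice_tame (int_clinf R) (swap W)).
  by congr nice; apply/funext => s; apply: eq_int1 => x; rewrite sliceE swapE.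
apply: eq_int1 => s; rewrite (int1_affine (- s) rr0 (s1_tame (slice m s))).
rewrite gtr0_norm ?mulr_gt0 ?r2_gt0 //.
have -> : 2 * r2 = r2^-1 by rewrite r2_double invrK.
by congr (_ * _); apply: eq_int1 => x; rewrite WE sliceE r2_double invrK.
Qed.

(** Moving one Fourier transform across the integral makes it a double transform on the other
    factor, that is, the reflection y -> -y; under [rho] this reflection becomes the exchange of the
    two variables. *)
Lemma emb2_V m k : emb2 (V m) (V k) = (2 * pi)^-1%:C * pairing k (swap m).
Proof.
rewrite emb2E; congr (_ * _); rewrite [RHS]pairing_smul -int_rho.
apply: eq_int1 => x.
have E : int1 (fun y => V m (x, y) * V k (x, y)) =
    int1 (fun y => ft (ft (slice (rho m) x)) y * slice (rho k) x y).
  have H : int1 (fun y => ft (slice (rho m) x) y * ft (slice (rho k) x) y) =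
     int1 (fun y => ft (ft (slice (rho m) x)) y * slice (rho k) x y).
    set a := ft (slice (rho m) x); set b := slice (rho k) x.
    rewrite (eq_int1 (g := fun y => (s2pi)^-1 * (a y * ft0 b y))); last first.
      by move=> y; rewrite [ft b y]schwartzZE mulrCA.
    rewrite int1Z; last by have := s1_nice (smul regL a (ft0 b)); congr nice; apply/funext => y; rewrite smulE.
    rewrite ft0_mult -int1Z; last by have := s1_nice (smul regL (ft0 a) b); congr nice; apply/funext => y; rewrite smulE.
    by apply: eq_int1 => y; rewrite /ft schwartzZE mulrA.
  have SV h : slice (V h) x = ft (slice (rho h) x) by rewrite /V /= /pft slice_opt.
  by rewrite -H -!SV.
rewrite E; apply: eq_int1 => y; rewrite ft_ft !sliceE !rhoE smulE swapE mulrC.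
by rewrite opprK.
Qed.

End TwistKernel.

(** * Uniform boundedness *)

Section Completeness.
Variable R : realType.
Local Notation C := R[i].
Local Notation e2 n := ((2^-1 : R) ^+ n).

Lemma e2_gt0 n : 0 < e2 n.
Proof. by rewrite exprn_gt0 // invr_gt0. Qed.

Lemma e2S n : 2 * e2 n.+1 = e2 n.
Proof. by rewrite exprS mulrA mulfV ?mul1r. Qed.

Lemma e2_small (e : R) : 0 < e -> exists n0, forall n, (n0 <= n)%N -> e2 n <= e.
Proof.
move=> e0; pose n0 := (Num.truncn e^-1).+1; exists n0 => n nn.
rewrite exprVn invf_ple ?posrE ?exprn_gt0 //.
have h1 : e^-1 < n0%:R.
  by have := truncn_itv (_ : 0 <= e^-1); rewrite invr_ge0 => /(_ (ltW e0))/andP[].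
apply: ltW; apply: lt_le_trans h1 _; apply: le_trans (_ : n%:R <= _); first by rewrite ler_nat.
by rewrite -natrX ler_nat ltnW // ltn_expl.
Qed.

Lemma le_geometric (a b K : R) n0 : (forall n, (n0 <= n)%N -> a <= b + K * e2 n) -> a <= b.
Proof.
move=> H; apply/ler_addgt0Pl => e e0.
have eK : 0 < e / (`|K| + 1) by rewrite divr_gt0 // ltr_wpDl.
have [n1 N1] := e2_small eK.
have := H (maxn n0 n1) (leq_maxl _ _) => /le_trans; apply.
rewrite addrC lerD2r; apply: le_trans (_ : (`|K| + 1) * e2 (maxn n0 n1) <= _).
  by rewrite ler_wpM2r ?(ltW (e2_gt0 _)) // (le_trans (ler_norm _)) // lerDl.
by rewrite mulrC -ler_pdivlMr ?ltr_wpDl // N1 // leq_maxr.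
Qed.

Lemma real_geometric_limit (u : nat -> R) (K : R) n0 : 0 <= K ->
  (forall n, (n0 <= n)%N -> `|u n.+1 - u n| <= K * e2 n) ->
  exists l, forall n, (n0 <= n)%N -> `|l - u n| <= 2 * K * e2 n.
Proof.
move=> K0 H.
(* A step of size [K * e2 n] is exactly compensated by the shrinking of [2 * K * e2 n], so the
   intervals from A n to B n are nested. *)
pose A n := u n - 2 * K * e2 n; pose B n := u n + 2 * K * e2 n.
have AS n : (n0 <= n)%N -> A n <= A n.+1.
  move=> nn; have := H n nn; rewrite ler_norml => /andP[h _].
  by rewrite /A -(e2S n); move: h; rewrite -(e2S n); lra.
have BS n : (n0 <= n)%N -> B n.+1 <= B n.
  move=> nn; have := H n nn; rewrite ler_norml => /andP[_ h].
  by rewrite /B -(e2S n); move: h; rewrite -(e2S n); lra.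
have AD n k : (n0 <= n)%N -> A n <= A (n + k)%N.
  move=> nn; elim: k => [|k IH]; first by rewrite addn0.
  by rewrite addnS (le_trans IH) // AS // (leq_trans nn) // leq_addr.
have BD n k : (n0 <= n)%N -> B (n + k)%N <= B n.
  move=> nn; elim: k => [|k IH]; first by rewrite addn0.
  by rewrite addnS (le_trans _ IH) // BS // (leq_trans nn) // leq_addr.
have AB n m : (n0 <= n)%N -> (n0 <= m)%N -> A n <= B m.
  move=> nn mm; apply: le_trans (AD n m nn) _; apply: le_trans (BD m n mm); rewrite addnC /A /B.
  have : 0 <= 2 * K * e2 (m + n) by rewrite !mulr_ge0 // ltW // e2_gt0.
  by move: (u _) (2 * K * _) => x y; lra.
pose E := [set A n | n in [set n | (n0 <= n)%N]].
exists (sup E) => n nn.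
have h1 : A n <= sup E.
  apply: ub_le_sup; last by exists n.
  by exists (B n) => _ [m mm <-]; exact: AB.
have h2 : sup E <= B n.
  apply: ge_sup; first by exists (A n); exists n.
  by move=> _ [m mm <-]; exact: AB.
by rewrite ler_norml; move: h1 h2; rewrite /A /B; move: (sup E) (u n) (2 * K * _) => x y z; lra.
Qed.

Lemma complex_geometric_limit (u : nat -> C) (K : R) n0 : 0 <= K ->
  (forall n, (n0 <= n)%N -> cabs (u n.+1 - u n) <= K * e2 n) ->
  exists l, forall n, (n0 <= n)%N -> cabs (l - u n) <= 4 * K * e2 n.
Proof.
move=> K0 H.
have HR n : (n0 <= n)%N -> `|Re (u n.+1) - Re (u n)| <= K * e2 n.
  by move=> nn; have := le_trans (abs_Re _) (H n nn); rewrite cReD cReN.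
have HI n : (n0 <= n)%N -> `|Im (u n.+1) - Im (u n)| <= K * e2 n.
  by move=> nn; have := le_trans (abs_Im _) (H n nn); rewrite cImD cImN.
have [a aH] := real_geometric_limit K0 HR.
have [b bH] := real_geometric_limit K0 HI.
exists (a +i* b) => n nn; apply: le_trans (cabs_ReIm _) _.
rewrite cReD cReN cImD cImN /=.
have -> : 4 * K * e2 n = 2 * K * e2 n + 2 * K * e2 n by ring.
by rewrite lerD ?aH ?bH.
Qed.

Variables (X : frame R).
Hypothesis regX : regular_frame X.
Local Notation S := (schwartz X).

Section Limit.
Variable f : nat -> S.
Hypothesis fC : forall ab, exists n0, forall n, (n0 <= n)%N -> semi ab (f n.+1 - f n) <= e2 n.

Let fL (L : clmap X X) : exists K n0, 0 <= K /\ forall n, (n0 <= n)%N ->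
  snorm (L (f n.+1 - f n)) <= K * e2 n.
Proof.
have [s [M [M0 H]]] := domd_cl_snorm L.
have [n0 N0] : exists n0, forall n, (n0 <= n)%N -> qs s (f n.+1 - f n) <= (size s)%:R * e2 n.
  elim: s {H} => [|ab s [n0 N0]].
    by exists 0%N => n _; rewrite /qs big_nil mul0r.
  have [n1 N1] := fC ab; exists (maxn n0 n1) => n; rewrite geq_max => /andP[h0 h1].
  have -> : (size (ab :: s))%:R = 1 + (size s)%:R :> R by rewrite /= -natr1 addrC.
  rewrite /qs big_cons mulrDl mul1r; exact: lerD (N1 n h1) (N0 n h0).
exists (M * (size s)%:R), n0; split=> [|n nn]; first by rewrite mulr_ge0.
by apply: le_trans (H _) _; rewrite -mulrA ler_wpM2l // N0.
Qed.

Let limit_exists (L : clmap X X) : exists l : X -> C, exists K n0, 0 <= K /\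
  forall n, (n0 <= n)%N -> forall x, cabs (l x - L (f n) x) <= K * e2 n.
Proof.
have [K [n0 [K0 H]]] := fL L.
have /choice[l lE] : forall x, exists l, forall n, (n0 <= n)%N -> cabs (l - L (f n) x) <= 4 * K * e2 n.
  move=> x; apply: complex_geometric_limit => // n nn.
  apply: le_trans (H n nn); rewrite (clinBE (cl_clin L)); exact: (cabs_snorm (L (f n.+1) - L (f n)) x).
by exists l, (4 * K), n0; split=> [|n nn x]; [rewrite mulr_ge0|exact: lE].
Qed.

(** A limit of L (f n) is taken for every continuous operator L at once: the derivative of such a
    limit is then another one, and the class criterion applies to the family of all of them. *)
Let lim (L : clmap X X) : X -> C := projT1 (cid (limit_exists L)).
Let limP L : exists K n0, 0 <= K /\
  forall n, (n0 <= n)%N -> forall x, cabs (lim L x - L (f n) x) <= K * e2 n.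
Proof. exact: projT2 (cid (limit_exists L)). Qed.

Let bounded (L : clmap X X) : exists B n0, forall n, (n0 <= n)%N -> snorm (L (f n)) <= B.
Proof.
have [K [n0 [K0 H]]] := limP L.
exists (snorm (L (f n0)) + (K + K)), n0 => n nn.
apply: snorm_le => x.
have -> : L (f n) x = L (f n0) x + ((lim L x - L (f n0) x) - (lim L x - L (f n) x)) by ring.
apply: le_trans (cabsD _ _) _; apply: lerD; first exact: cabs_snorm.
have K1 m : K * e2 m <= K by rewrite ler_piMr // exprn_ile1 ?invr_ge0 // invf_le1 // ler1n.
apply: le_trans (cabsB _ _) _; apply: lerD; first exact: le_trans (H _ (leqnn _) x) (K1 _).
exact: le_trans (H _ nn x) (K1 _).
Qed.

(** The Taylor remainders of L (f n) are quadratic with a constant independent of n, and this bound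
    survives the limit. *)
Let lim_isd L j x : isd (lim L) x (axis j) (lim (cl_comp (cl_D regX j) L) x).
Proof.
have [B [n2 HB]] := bounded (cl_comp (cl_D regX j) (cl_comp (cl_D regX j) L)).
apply: (isd_quadratic (K := 4 * B)) => h h1.
have [K0 [n0 [K00 H0]]] := limP L.
have [K1 [n1 [K10 H1]]] := limP (cl_comp (cl_D regX j) L).
apply: (@le_geometric _ _ (K0 + K0 + K1) (maxn n0 (maxn n1 n2))) => n.
rewrite !geq_max => /and3P[h0' h1' h2'].
have T := schwartz_taylor regX (L (f n)) x j h.
set d := cl_comp _ _ in H1 *.
have -> : lim L (x + h *: axis j) - lim L x - h%:C * lim d x =
   (L (f n) (x + h *: axis j) - L (f n) x - h%:C * d (f n) x) +
   ((lim L (x + h *: axis j) - L (f n) (x + h *: axis j)) - (lim L x - L (f n) x)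
    - h%:C * (lim d x - d (f n) x)) by ring.
apply: le_trans (cabsD _ _) _; apply: lerD.
  apply: le_trans T _; rewrite ler_wpM2r ?sqr_ge0 // ler_wpM2l //.
  exact: HB.
apply: le_trans (cabsB _ _) _; rewrite mulrDl; apply: lerD.
  by apply: le_trans (cabsB _ _) _; rewrite mulrDl; apply: lerD; exact: H0.
rewrite cabsM cabsR; apply: le_trans (H1 n h1' x).
by rewrite ler_piMl ?cabs_ge0.
Qed.

Let lim_X L j x : (coord j x)%:C * lim L x = lim (cl_comp (cl_X regX j) L) x.
Proof.
have [K0 [n0 [K00 H0]]] := limP L.
have [K1 [n1 [K10 H1]]] := limP (cl_comp (cl_X regX j) L).
apply/eqP; rewrite -subr_eq0; apply/eqP/cabs_eq0/eqP; rewrite eq_le cabs_ge0 andbT.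
apply: (@le_geometric _ _ (`|coord j x| * K0 + K1) (maxn n0 n1)) => n.
rewrite geq_max add0r => /andP[h0 h1].
have -> : (coord j x)%:C * lim L x - lim (cl_comp (cl_X regX j) L) x =
   (coord j x)%:C * (lim L x - L (f n) x) - (lim (cl_comp (cl_X regX j) L) x - cl_comp (cl_X regX j) L (f n) x).
  by rewrite cl_compE cl_XE; ring.
apply: le_trans (cabsB _ _) _; rewrite mulrDl -mulrA; apply: lerD; last exact: H1.
by rewrite cabsM cabsR ler_wpM2l // H0.
Qed.

Let lim_schwartz L : is_schwartz (lim L).
Proof.
pose F (L : clmap X X) (s : unit) := lim L.
apply: (@class_schwartz R X regX (clmap X X) unit (fun _ => True) F I (fun _ _ _ _ => I) _ _ _ L tt).
- move=> L'; have [B [n0 HB]] := bounded L'; have [K [n1 [K0 H]]] := limP L'.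
  exists (fun=> B) => // s x; apply: (@le_geometric _ _ K (maxn n0 n1)) => n.
  rewrite geq_max => /andP[h0 h1].
  have -> : F L' s x = L' (f n) x + (lim L' x - L' (f n) x) by rewrite /F; ring.
  apply: le_trans (cabsD _ _) _; apply: lerD; last exact: H.
  exact: le_trans (cabs_snorm _ _) (HB n h0).
- by move=> L' j; exists [:: cl_comp (cl_D regX j) L'] => s x; rewrite big_seq1; exact: lim_isd.
- by move=> L' j; exists [:: cl_comp (cl_X regX j) L'] => s x; rewrite big_seq1; exact: lim_X.
Qed.

Lemma schwartz_complete : exists Phi : S, forall ab, exists K n0, 0 <= K /\
  forall n, (n0 <= n)%N -> semi ab (Phi - f n) <= K * e2 n.
Proof.
pose PL L := mk_schwartz (lim_schwartz L).
exists (PL (cl_id X)) => -[a b].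
(* The seminorm with words a, b is the sup norm after a composite L of derivatives and coordinates;
   by [lim_isd] and [lim_X] such an L may be applied to the limit. *)
have [L LE] : exists L : clmap X X, (forall g, L g = sw regX a b g) /\ sw regX a b (PL (cl_id X)) = PL L.
  have [L0 [E1 E2]] : exists L : clmap X X, (forall g, L g = foldr (sD regX) g b) /\
      foldr (sD regX) (PL (cl_id X)) b = PL L.
    elim: b => [|j b [L [E1 E2]]]; first by exists (cl_id X).
    exists (cl_comp (cl_D regX j) L); split=> [g|]; first by rewrite /= E1.
    by rewrite /= E2; apply: sD_eq => x; exact: lim_isd.
  elim: a => [|j a [L [E3 E4]]].
    by exists L0; split=> [g|]; rewrite sw_foldr.
  exists (cl_comp (cl_X regX j) L); split=> [g|].
    by rewrite sw_foldr /= -sw_foldr -E3.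
  rewrite sw_foldr /= -sw_foldr E4; apply: schwartz_ext => x.
  by rewrite sXE; exact: lim_X.
have [K [n0 [K0 H]]] := limP L; exists K, n0; split=> // n nn.
apply: semi_le => x; rewrite -(swE regX) (clinBE (sw_clin regX a b)) LE.2 schwartzBE -LE.1.
exact: H.
Qed.

End Limit.
End Completeness.

(** * The gliding hump *)

Section UniformBoundedness.
Variables (R : realType) (X : frame R).
Hypothesis regX : regular_frame X.
Local Notation C := R[i].
Local Notation S := (schwartz X).
Local Notation W := (seq (axes X) * seq (axes X))%type.
Local Notation e2 n := ((2^-1 : R) ^+ n).

(** Words are enumerated through [pickle], so that each of the countably many seminorms is
    controlled from some step on. *)
Definition first_words n : seq W := pmap unpickle (iota 0 n).

Lemma mem_first_words (ab : W) n : (pickle ab < n)%N -> ab \in first_words n.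
Proof.
move=> h; rewrite mem_pmap; apply/mapP; exists (pickle ab).
  by rewrite mem_iota.
by rewrite pickleK.
Qed.

Lemma semi_qs (ab : W) s (f : S) : ab \in s -> semi ab f <= qs s f.
Proof.
elim: s => // cd s IH; rewrite inE /qs big_cons => /orP[/eqP ->|/IH h].
  by rewrite lerDl; exact: qs_ge0.
by apply: le_trans h _; rewrite lerDr semi_ge0.
Qed.

Variables (I : Type) (lam : I -> S -> C).
Hypothesis lamC : forall i, clinf (lam i).
Hypothesis lamB : forall f, exists M, forall i, cabs (lam i f) <= M.

(* Gliding hump: a state is a partial sum together with a seminorm that dominates
   all the functionals chosen so far, so that the later steps do not affect them. *)
Section Hump.
Hypothesis unbounded : forall s (M : R), 0 <= M -> exists i f, M * qs s f < cabs (lam i f).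

Let state := (S * (seq W * R))%type.

(** The clauses ensure, in order: convergence of the partial sums; a small effect of the step on the
    functionals chosen before; a large value of the new functional; growth of the dominating
    seminorm; its domination of the new functional. *)
Let next (n : nat) (st st' : state) : Prop := exists i,
  [/\ qs (first_words n) (st'.1 - st.1) <= e2 n,
      `|st.2.2| * qs st.2.1 (st'.1 - st.1) <= e2 n,
      n.+2%:R <= cabs (lam i st'.1),
      forall f, `|st.2.2| * qs st.2.1 f <= `|st'.2.2| * qs st'.2.1 f &
      forall f, cabs (lam i f) <= `|st'.2.2| * qs st'.2.1 f].

Let next_exists n st : exists st', next n st st'.
Proof.
case: st => F [s K]; set t := s ++ first_words n.
(* M is chosen so that the multiple g of f with [cabs (lam i g)] equal to n + 2 still satisfies
   [(|K| + 1) * qs t g <= e2 n]. *)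
pose M := n.+2%:R * (`|K| + 1) / e2 n.
have e0 := @e2_gt0 R n.
have K1 : 0 < `|K| + 1 by rewrite ltr_wpDl.
have n2 : 0 < n.+2%:R :> R by rewrite ltr0n.
have M0 : 0 < M by rewrite divr_gt0 // mulr_gt0.
have [i [f if_]] := unbounded t (ltW M0).
set a := cabs (lam i f) in if_.
have a0 : 0 < a by apply: le_lt_trans if_; rewrite mulr_ge0 ?qs_ge0 // ltW.
pose c : R := n.+2%:R / a.
have c0 : 0 < c by rewrite divr_gt0.
pose g := c%:C *: f.
have lg : cabs (lam i g) = n.+2%:R.
  by rewrite /g (clinfZE (lamC i)) cabsM cabsR gtr0_norm // /c -/a divfK // gt_eqF.
have qg : (`|K| + 1) * qs t g <= e2 n.
  have h : qs t g <= c * qs t f.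
    by apply: le_trans (qsZ _ _ _) _; rewrite cabsR gtr0_norm.
  apply: le_trans (ler_wpM2l (ltW K1) h) _.
  rewrite /c -(ler_pM2r a0).
  have -> : (`|K| + 1) * (n.+2%:R / a * qs t f) * a = n.+2%:R * (`|K| + 1) * qs t f.
    by field; rewrite gt_eqF.
  have := ltW if_; rewrite /M mulrAC ler_pdivrMr // [a * _]mulrC.
  by [].
have qts h : qs t h = qs s h + qs (first_words n) h by rewrite /qs big_cat.
have qpos h : 0 <= qs t h by exact: qs_ge0.
have H1 h : qs t h = qs t g -> qs (first_words n) h <= e2 n.
  move=> hg; apply: le_trans qg; rewrite -hg qts; have := qs_ge0 s h.
  move=> h1; have h2 := qs_ge0 (first_words n) h.
  rewrite mulrDl mul1r addrA; apply: le_trans (_ : qs s h + qs (first_words n) h <= _).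
    by rewrite lerDr.
  by rewrite -addrA lerDr mulr_ge0 // addr_ge0.
have H2 h : qs t h = qs t g -> `|K| * qs s h <= e2 n.
  move=> hg; apply: le_trans qg; rewrite -hg qts; have := qs_ge0 s h.
  move=> h1; have h2 := qs_ge0 (first_words n) h.
  rewrite mulrDl mul1r mulrDr -addrA lerDl !addr_ge0 // mulr_ge0 //.
have qN : qs t (- g) = qs t g.
  have qle h : qs t (- h) <= qs t h.
    by rewrite -scaleN1r; apply: le_trans (qsZ _ _ _) _; rewrite cabsN cabs1 mul1r.
  by apply/eqP; rewrite eq_le qle /= -[X in qs t X <= _]opprK qle.
have [u [N [N0 uN]]] := (lamC i).2.
have E : `| `|K| + N | = `|K| + N by rewrite ger0_norm // addr_ge0.
have qsu f' : qs (s ++ u) f' = qs s f' + qs u f' by rewrite /qs big_cat.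
have H4 f' : `|K| * qs s f' <= `| `|K| + N | * qs (s ++ u) f'.
  have h1 := qs_ge0 s f'; have h2 := qs_ge0 u f'.
  rewrite E qsu mulrDl mulrDr -addrA lerDl.
  by apply: addr_ge0; apply: mulr_ge0 => //; exact: addr_ge0.
have H5 f' : cabs (lam i f') <= `| `|K| + N | * qs (s ++ u) f'.
  have h1 := qs_ge0 s f'; have h2 := qs_ge0 u f'.
  apply: le_trans (uN f') _; rewrite E qsu mulrDl !mulrDr addrA lerDr.
  by rewrite !addr_ge0 // mulr_ge0.
(* Whatever the value at F, the moduli at F + g and F - g add up to at least twice the modulus at g,
   so one of the two signs reaches n + 2. *)
have [h|h] := leP (n.+2%:R) (cabs (lam i (F + g))).
  exists (F + g, (s ++ u, `|K| + N)), i; split=> //=; rewrite addrAC subrr add0r; [exact: H1|exact: H2].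
exists (F - g, (s ++ u, `|K| + N)), i; split=> //=.
- by rewrite addrAC subrr add0r; exact: H1.
- by rewrite addrAC subrr add0r; exact: H2.
- have : 2 * n.+2%:R <= cabs (lam i (F + g)) + cabs (lam i (F - g)).
    rewrite -lg -[2](ger0_norm (ler0n R 2)) -cabsR -cabsM; apply: le_trans (cabsB _ _).
    rewrite -(clinfBE (lamC i)) opprD opprK addrACA subrr add0r (clinfDE (lamC i)).
    by rewrite le_eqVlt; apply/orP; left; apply/eqP; congr cabs; rewrite rmorph_nat; ring.
  by move: h; move: (cabs _) (cabs _) => x y; lra.
Qed.

Lemma hump_absurd : False.
Proof.
have /choice[nx nxP] : forall p : nat * state, exists st', next p.1 p.2 st'.
  by move=> [n st]; exact: next_exists.
pose st := fix st n : state := if n is n'.+1 then nx (n', st n') else (0, ([::], 0)).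
have stP n : next n (st n) (st n.+1) by exact: (nxP (n, st n)).
pose f n := (st n).1.
have fC (ab : W) : exists n0, forall n, (n0 <= n)%N -> semi ab (f n.+1 - f n) <= e2 n.
  exists (pickle ab).+1 => n nn; have [i [h _ _ _ _]] := stP n.
  by apply: le_trans h; apply: semi_qs; exact: mem_first_words.
have [Phi PhiP] := schwartz_complete regX fC.
have [M MP] := lamB Phi.
have [n nM] : exists n : nat, M < n%:R.
  exists (Num.truncn `|M|).+1; apply: le_lt_trans (ler_norm M) _.
  by have /andP[] := truncn_itv (normr_ge0 M).
have [i [_ _ h3 _ h5]] := stP n.
have chain m g : (n.+1 <= m)%N -> cabs (lam i g) <= `|(st m).2.2| * qs (st m).2.1 g.
  move=> /subnK <-; elim: (m - n.+1)%N => [|k IH]; first by rewrite add0n; exact: h5.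
  rewrite addSn; apply: le_trans IH _; have [j [_ _ _ h4 _]] := stP (k + n.+1)%N.
  exact: h4.
have step m : (n.+1 <= m)%N -> cabs (lam i (f m.+1 - f m)) <= e2 m.
  move=> nm; apply: le_trans (chain m _ nm) _; have [j [_ h2 _ _ _]] := stP m.
  exact: h2.
(* The later steps add up to a tail of the geometric series, so together they change the value of
   [lam i] by at most 1. *)
have dist k : cabs (lam i (f (k + n.+1)%N - f n.+1)) <= 2 * e2 n.+1 - 2 * e2 (k + n.+1).
  elim: k => [|k IH]; first by rewrite add0n !subrr (clinf0E (lamC i)) cabs0.
  rewrite addSn.
  have -> : f (k + n.+1).+1 - f n.+1 = (f (k + n.+1).+1 - f (k + n.+1)%N) + (f (k + n.+1)%N - f n.+1).
    by rewrite addrA subrK.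
  rewrite (clinfDE (lamC i)); apply: le_trans (cabsD _ _) _.
  have := step (k + n.+1)%N (leq_addl _ _); rewrite (e2S R (k + n.+1)).
  move: IH; rewrite -(e2S R (k + n.+1)); move: (cabs _) (cabs _) (e2 _) (e2 _) => x y z t; lra.
have d1 k : cabs (lam i (f (k + n.+1)%N - f n.+1)) <= 1.
  apply: le_trans (dist k) _; rewrite (e2S R n).
  have := @e2_gt0 R (k + n.+1); have : e2 n <= 1 by rewrite exprn_ile1 ?invr_ge0 // invf_le1 // ler1n.
  by move: (e2 _) (e2 _) => x y; lra.
have [K K0 KP] : exists2 K, 0 <= K & exists n0, forall m, (n0 <= m)%N -> cabs (lam i (Phi - f m)) <= K * e2 m.
  have [s [N [N0 HN]]] := (lamC i).2.
  have [K [K0 [n0 KP]]] : exists K : R, 0 <= K /\ exists n0, forall m, (n0 <= m)%N -> qs s (Phi - f m) <= K * e2 m.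
    elim: s {HN} => [|ab s [K [K0 [n0 KP]]]].
      by exists 0; split=> //; exists 0%N => m _; rewrite /qs big_nil mul0r.
    have [L [n1 [L0 LP]]] := PhiP ab.
    exists (L + K); split; first exact: addr_ge0.
    exists (maxn n0 n1) => m; rewrite geq_max => /andP[h0 h1].
    by rewrite /qs big_cons mulrDl; exact: lerD (LP m h1) (KP m h0).
  exists (N * K); first exact: mulr_ge0.
  by exists n0 => m nm; apply: le_trans (HN _) _; rewrite -mulrA ler_wpM2l // KP.
have [n0 {}KP] := KP.
(* The value at [f n.+1] is at least n + 2, the later steps contribute at most 1, and the distance
   to Phi tends to 0; with M < n this is impossible. *)
suff : n.+2%:R <= M + 1 by rewrite -natr1 -natr1; move: nM; lra.
apply: (@le_geometric _ _ _ K n0) => m nm.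
pose m' := (m + n.+1)%N.
have h6 : cabs (lam i (Phi - f m')) <= K * e2 m.
  apply: le_trans (KP m' (leq_trans nm (leq_addr _ _))) _.
  rewrite ler_wpM2l // /m' exprD ler_piMr ?exprn_ge0 ?invr_ge0 //.
  by rewrite exprn_ile1 ?invr_ge0 // invf_le1 // ler1n.
apply: le_trans h3 _; rewrite -/(f n.+1).
have -> : f n.+1 = Phi - ((Phi - f m') + (f m' - f n.+1)).
  by rewrite addrA subrK opprB addrCA subrr addr0.
rewrite (clinfBE (lamC i)); apply: le_trans (cabsB _ _) _.
rewrite (clinfDE (lamC i)) -addrA; apply: lerD; first exact: MP.
apply: le_trans (cabsD _ _) _; rewrite addrC; apply: lerD => //; exact: d1.
Qed.

End Hump.

Theorem uniform_boundedness : exists s M, 0 <= M /\ forall i f, cabs (lam i f) <= M * qs s f.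
Proof.
apply: contrapT => H; apply: hump_absurd => s M M0.
apply: contrapT => H1; apply: H; exists s, M; split=> // i f.
by rewrite leNgt; apply/negP => h; apply: H1; exists i, f.
Qed.

End UniformBoundedness.

(** * Weakly continuous operators on S(R) are continuous *)

Section WeaklyContinuous.
Variable R : realType.
Local Notation C := R[i].
Local Notation S1 := (schwartz (line R)).
Local Notation regL := (line_regular R).
Local Notation D := (sD (line_regular R) tt).
Local Notation Q := (sX (line_regular R) tt).
Local Notation P := (sP (line_regular R) tt).

Lemma int_smul (f g : S1) : int1 (fun x => f x * g x) = int1 (smul regL f g).
Proof. by apply: eq_int1 => x; rewrite smulE. Qed.

Lemma nice_smul (f g : S1) : nice (fun x => f x * g x).
Proof. by have := s1_nice (smul regL f g); congr nice; apply/funext => x; rewrite smulE. Qed.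

Lemma sD_smul (f g : S1) : D (smul regL f g) = smul regL (D f) g + smul regL f (D g).
Proof.
apply: sD_eq => x; rewrite schwartzDE !smulE.
have := isdM (isd_schwartz regL f x tt) (isd_schwartz regL g x tt).
by apply: isd_ext => y; rewrite smulE.
Qed.

Lemma int_by_parts (f g : S1) : int1 (fun x => D f x * g x) = int1 (fun x => f x * (- D g) x).
Proof.
have H := int1_sD (smul regL f g).
rewrite sD_smul (clinfDE (int_clinf R)) -!int_smul in H.
move/eqP: H; rewrite addr_eq0 => /eqP ->.
rewrite (eq_int1 (f := fun x => f x * (- D g) x) (g := fun x => -1 * (f x * D g x))).
  by rewrite int1Z ?mulN1r //; exact: nice_smul.
by move=> x; rewrite -[(- D g) x]/(- (D g x)); ring.
Qed.

(** Under the integral pairing, multiplication by the coordinate is symmetric and the derivative is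
    antisymmetric. *)
Lemma transpose_sw a b (psi : S1) : exists psi' : S1, forall f : S1,
  int1 (fun x => sw regL a b f x * psi x) = int1 (fun x => f x * psi' x).
Proof.
have [p1 H1] : exists psi1 : S1, forall f : S1,
    int1 (fun x => foldr (sX regL) f a x * psi x) = int1 (fun x => f x * psi1 x).
  elim: a psi => [|[] a IH] psi; first by exists psi.
  have [p pH] := IH (Q psi); exists p => f; rewrite -pH; apply: eq_int1 => x.
  by rewrite /= !sXE; ring.
have [p2 H2] : exists psi2 : S1, forall f : S1,
    int1 (fun x => foldr (sD regL) f b x * p1 x) = int1 (fun x => f x * psi2 x).
  elim: b p1 {H1} => [|[] b IH] p1; first by exists p1.
  by have [p pH] := IH (- D p1); exists p => f; rewrite -pH /= int_by_parts.
by exists p2 => f; rewrite -H2 -H1; apply: eq_int1 => x; rewrite sw_foldr.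
Qed.

(** The functionals [lam (x, e)] average x^a D^b A phi around x at scale e. For fixed phi they are
    bounded by a multiple of a sup norm, so uniform boundedness gives one estimate for all x and e,
    and e -> 0 turns it into an estimate of the seminorm of A phi. *)
Lemma weakly_continuous_clin (A : S1 -> S1) : linear A ->
  (forall psi : S1, clinf (fun phi => int1 (fun x => A phi x * psi x))) -> clin A.
Proof.
move=> lA wA; split=> // -[a b].
pose B phi := sw regL a b (A phi).
have wB (psi : S1) : clinf (fun phi => int1 (fun x => B phi x * psi x)).
  have [psi' E] := transpose_sw a b psi.
  by have := wA psi'; congr clinf; apply/funext => phi; rewrite E.
have e0 (e : {e : R | 0 < e}) : sval e != 0 by case: e => e /= e0; rewrite gt_eqF.
have eV0 (e : {e : R | 0 < e}) : (sval e)^-1 != 0 by rewrite invr_eq0.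
pose lam (i : R * {e : R | 0 < e}) (phi : S1) : C :=
  int1 (fun s => B phi (i.1 + sval i.2 * s) * gaussS R s).
have lamE i phi : lam i phi = (sval i.2)^-1%:C *
   int1 (fun x => B phi x * aff1 (- ((sval i.2)^-1 * i.1)) (eV0 i.2) (gaussS R) x).
  set psi := aff1 _ _ _.
  have t1 : tame (fun x => B phi x * psi x).
    by have := s1_tame (smul regL (B phi) psi); congr tame; apply/funext => u; rewrite smulE.
  have h0 : 0 < sval i.2 by case: (i.2).
  rewrite (int1_affine i.1 (e0 i.2) t1) mulrA -rmorphM gtr0_norm // mulVf ?mul1r //.
  apply: eq_int1 => s; rewrite /psi aff1E [_ * s + i.1]addrC; congr (_ * gaussS R _).
  by rewrite mulrDr mulKf // addrAC subrr add0r.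
have lamC i : clinf (lam i).
  have := clinfZ (sval i.2)^-1%:C (wB (aff1 (- ((sval i.2)^-1 * i.1)) (eV0 i.2) (gaussS R))).
  by congr clinf; apply/funext => phi; rewrite lamE.
have lamB phi : exists M, forall i, cabs (lam i phi) <= M.
  exists (2 * pi * (snorm (B phi) * snorm (P (gaussS R)))) => i.
  have cB : continuous (fun s : R => B phi (i.1 + sval i.2 * s)).
    apply: tame_continuous; have := tame_affine i.1 (e0 i.2) (s1_tame (B phi)).
    by congr tame; apply/funext => s; rewrite addrC.
  apply: int1_bound.
    exact: (@cmeasurableM _ (measurableTypeR R)) (continuous_cmeasurable cB) (s1_nice (gaussS R)).1.
  by move=> s; rewrite cabsM -mulrA ler_pM ?cabs_ge0 ?cabs_snorm // s1_bound.
have [s [M [M0 HM]]] := uniform_boundedness regL lamC lamB.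
pose m := cabs (int1 (gaussS R)).
have m0 : 0 < m.
  by rewrite /m int_gauss cabsR normr_gt0 mulf_neq0 // gt_eqF // sqrtr_gt0 ?pi_gt0.
exists s, (M / m); split=> [|phi]; first by rewrite divr_ge0 // ltW.
rewrite semi_snorm_line; apply: snorm_le => x; rewrite -/(B phi).
rewrite mulrAC ler_pdivlMr // /m -cabsM.
have [K K0 KP] := mollify (B phi) (gaussS R).
apply/ler_addgt0Pl => d d0.
pose e := d / (K + 1).
have K1 : 0 < K + 1 by rewrite ltr_wpDl.
have e_gt0 : 0 < e by rewrite divr_gt0.
have h1 := KP x e (ltW e_gt0).
have h2 := HM (x, exist _ e e_gt0) phi.
rewrite /lam /= in h2.
set z := int1 (fun s => _) in h1 h2.
have -> : B phi x * int1 (gaussS R) = z - (z - B phi x * int1 (gaussS R)) by ring.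
apply: le_trans (cabsB _ _) _; rewrite addrC; apply: lerD => //.
apply: le_trans h1 _; rewrite /e mulrCA ger_pMr // ler_pdivrMr // mul1r lerDl //.
Qed.

End WeaklyContinuous.

(** * Density of composed kernels *)

Section Density.
Variable R : realType.
Local Notation C := R[i].
Local Notation S1 := (schwartz (line R)).
Local Notation S2 := (schwartz (plane R)).
Local Notation regL := (line_regular R).
Local Notation regP := (plane_regular R).
Local Notation X2 := (sX (plane_regular R) true).
Local Notation D := (sD (line_regular R) tt).
Local Notation ft0 := (@ft0 R).
Implicit Types (f g phi psi : S1) (h k l : S2).

Definition mulop g : S2 -> S2 := opt (smul_clin regL g).

Lemma mulopE g h (p : R * R) : mulop g h p = g p.2 * h p.
Proof. by case: p => x y; rewrite /mulop optE smulE. Qed.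

Section Dilation.
Let P := {e : R | 0 < e <= 1}.
(** Bounds linear in the dilation parameter: with them the class criterion yields convergence in S
    as e -> 0, not mere boundedness. *)
Let Dm (m : P -> R) := exists2 K, 0 <= K & forall e, m e <= K * sval e.

(* [inl (h, g)] is h(x, y) (g(e y) - g(0)) and [inr (n, h, g)] is e^(n+1) h(x, y) g(e y). *)
Let F (i : (S2 * S1) + (nat * S2 * S1)) (e : P) (p : plane R) : C :=
  match i with
  | inl (h, g) => h p * (g (sval e * p.2) - g 0)
  | inr (n, h, g) => ((sval e) ^+ n.+1)%:C * (h p * g (sval e * p.2))
  end.

Let isd_dilate g (e : R) (y : R) : isd (fun z : R => g (e * z)) y (1 : R) (e%:C * D g (e * y)).
Proof.
apply: (isd_quadratic (K := 4 * snorm (D (D g)) * e ^+ 2)) => h _.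
have H := schwartz_taylor regL g (e * y) tt (h * e).
rewrite [h *: _]mulr1 (_ : e * (y + h) = e * y + (h * e) *: (1 : R)); last first.
  by rewrite [_ *: _]mulr1; ring.
rewrite -mulrA -exprMn [e * h]mulrC; apply: le_trans H.
by rewrite le_eqVlt; apply/orP; left; apply/eqP; congr cabs; rewrite rmorphM /= mulrA.
Qed.

Let eP (e : P) : 0 < sval e /\ sval e <= 1.
Proof. by case: e => e /= /andP[]. Qed.

Let Fbound i : exists2 m, Dm m & forall e p, cabs (F i e p) <= m e.
Proof.
case: i => [[h g]|[[n h] g]].
  exists (fun e => 2 * snorm (D g) * snorm (X2 h) * sval e).
    by exists (2 * snorm (D g) * snorm (X2 h)) => //; rewrite !mulr_ge0 ?snorm_ge0.
  move=> e p; have [e0 _] := eP e.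
  have := schwartz_mvt regL g 0 tt (sval e * p.2).
  rewrite /= add0r [_ *: _]mulr1 normrM (gtr0_norm e0) => H.
  rewrite cabsM; apply: le_trans (ler_wpM2l (cabs_ge0 _) H) _.
  have := cabs_snorm (X2 h) p; rewrite sXE cabsM cabsR /= => H2.
  have -> : cabs (h p) * (2 * snorm (D g) * (sval e * `|p.2|)) =
     2 * snorm (D g) * sval e * (`|p.2| * cabs (h p)) by ring.
  rewrite [leRHS]mulrAC; apply: ler_wpM2l H2.
  by rewrite !mulr_ge0 ?snorm_ge0 // ltW.
exists (fun e => snorm h * snorm g * sval e).
  by exists (snorm h * snorm g) => //; rewrite !mulr_ge0 ?snorm_ge0.
move=> e p; have [e0 e1] := eP e.
rewrite !cabsM cabsR mulrC; apply: ler_pM; rewrite ?mulr_ge0 ?cabs_ge0 //.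
  by apply: ler_pM; rewrite ?cabs_ge0 ?cabs_snorm.
rewrite normrX (gtr0_norm e0) exprS ler_piMr ?(ltW e0) //.
by rewrite exprn_ile1 // ltW.
Qed.

Let Fderiv i j : exists s : seq ((S2 * S1) + (nat * S2 * S1)), forall e p,
  isd (F i e) p (axis j) (\sum_(k <- s) F k e p).
Proof.
have dg g e t y j' : isd (fun p : plane R => g (e * p.2)) ((t, y) : plane R) (@axis R (plane R) j')
    (if j' then e%:C * D g (e * y) else 0).
  case: j'; first exact: (isd_snd t (isd_dilate g e y)).
  exact: (isd_snd0 (fun z => g (e * z)) t y).
case: i => [[h g]|[[n h] g]].
  exists (inl (sD regP j h, g) :: if j then [:: inr (0%N, h, D g)] else [::]) => e [t y].
  have H := isdM (isd_schwartz regP h (t, y) j) (isdD (dg g (sval e) t y j) (isd_cst (- g 0) _ _)).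
  have -> : \sum_(k <- inl (sD regP j h, g) :: (if j then [:: inr (0%N, h, D g)] else [::])) F k e (t, y) =
    sD regP j h (t, y) * (g (sval e * y) - g 0) +
    h (t, y) * ((if j then (sval e)%:C * D g (sval e * y) else 0) + 0).
    rewrite big_cons /F /=; congr (_ + _); case: j {H} => /=.
      by rewrite big_seq1 expr1 addr0; ring.
    by rewrite big_nil addr0 mulr0.
  by apply: isd_ext H => q.
exists (inr (n, sD regP j h, g) :: if j then [:: inr (n.+1, h, D g)] else [::]) => e [t y].
have H := isdZ ((sval e) ^+ n.+1)%:C (isdM (isd_schwartz regP h (t, y) j) (dg g (sval e) t y j)).
have -> : \sum_(k <- inr (n, sD regP j h, g) :: (if j then [:: inr (n.+1, h, D g)] else [::])) F k e (t, y) =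
  ((sval e) ^+ n.+1)%:C * (sD regP j h (t, y) * g (sval e * y) +
    h (t, y) * (if j then (sval e)%:C * D g (sval e * y) else 0)).
  rewrite big_cons /F mulrDr; congr (_ + _); case: j {H} => /=.
    by rewrite big_seq1 [_ ^+ n.+2]exprS rmorphM; ring.
  by rewrite big_nil !mulr0.
by apply: isd_ext H => q.
Qed.

Let Fcoord i j : exists s : seq ((S2 * S1) + (nat * S2 * S1)), forall e p,
  (coord j p)%:C * F i e p = \sum_(k <- s) F k e p.
Proof.
case: i => [[h g]|[[n h] g]].
  by exists [:: inl (sX regP j h, g)] => e p; rewrite big_seq1 /F sXE mulrA.
by exists [:: inr (n, sX regP j h, g)] => e p; rewrite big_seq1 /F sXE; ring.
Qed.

(* Multiply by g(e y) for a Gaussian g and let e -> 0. *)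
Lemma functional_mulop0 (lam : S2 -> C) h : clinf lam ->
  (forall g, lam (mulop g h) = 0) -> lam h = 0.
Proof.
move=> cl H.
pose g := gaussS R.
have eN (e : P) : sval e != 0 by rewrite gt_eqF //; case: (eP e).
pose d (e : P) := mulop (aff1 0 (eN e) g) h - g 0 *: h.
have dE e p : d e p = F (inl (h, g)) e p.
  by rewrite /d schwartzBE schwartzZE mulopE aff1E addr0 /F; ring.
have Dm0 : Dm (fun=> 0) by exists 0 => // e; rewrite mul0r.
have DmD m n : Dm m -> Dm n -> Dm (fun e => m e + n e).
  move=> [K K0 KE] [L L0 LE]; exists (K + L) => [|e]; first exact: addr_ge0.
  by rewrite mulrDl; exact: lerD (KE e) (LE e).
have B ab : exists2 K, 0 <= K & forall e, semi ab (d e) <= K * sval e.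
  have [m [K K0 KE] mE] := class_bound Dm0 DmD Fbound Fderiv Fcoord (inl (h, g)) ab.1 ab.2.
  exists K => // e; apply: le_trans (KE e); apply: semi_le => x.
  have -> : (d e : plane R -> C) = F (inl (h, g)) e by apply/funext => p; exact: dE.
  exact: mE.
have r0 (e : P) : 0 <= sval e by apply: ltW; case: (eP e).
have [K K0 KP] := domd_family (m := fun k : S2 => cabs (lam k)) (g := d)
  (r := fun e : P => sval e) cl.2 r0 B.
apply/cabs_eq0/eqP; rewrite eq_le cabs_ge0 andbT; apply/ler_addgt0Pl => eps eps0; rewrite addr0.
have K1 : 0 < K + 1 by rewrite ltr_wpDl.
have eh : 0 < Num.min 1 (eps / (K + 1)) <= 1.
  by rewrite lt_min ltr01 divr_gt0 //= ge_min lexx.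
pose e0 : P := exist (fun e : R => is_true (0 < e <= 1)) _ eh.
have := KP e0; rewrite /d (clinfBE cl) H (clinfZE cl) sub0r cabsN.
have -> : g 0 = 1 by rewrite /g gaussSE /gauss expr0n /= mul0r oppr0 expR0.
rewrite mul1r => /le_trans; apply => /=.
apply: le_trans (_ : K * (eps / (K + 1)) <= _).
  by rewrite ler_wpM2l // ge_min lexx orbT.
by rewrite mulrCA ger_pMr // ler_pdivrMr // mul1r lerDl.
Qed.

End Dilation.

Let shear_det : (1 : R) * 1 - 1 * 0 != 0.
Proof. by rewrite mulr1 mulr0 subr0 oner_neq0. Qed.

(* The Fourier transform has no Schwartz kernel; it acquires one once cut off on
   both sides. *)
Lemma localised_kernel g g' : exists l, forall phi,
  smul regL g' (ft (smul regL g (ft phi))) = (2 * pi)^-1%:C *: kop l phi.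
Proof.
pose l := aff2 0 0 shear_det (tensor (ft0 g) g').
have lE (t y : R) : l (t, y) = ft0 g (t + y) * g' y.
  by rewrite /l aff2E tensorE /= !mul1r mul0r add0r !addr0.
exists l => phi; apply: schwartz_ext => y; rewrite smulE schwartzZE kopE.
have E f (z : R) : ft f z = (s2pi R)^-1 * ft0 f z by [].
have E2 : ft (smul regL g (ft phi)) y = (2 * pi)^-1%:C * int1 (fun t => phi t * ft0 g (t + y)).
  rewrite E ft0E (eq_int1 (g := fun t => (s2pi R)^-1 * (smod regL y tt g t * ft0 phi t))); last first.
    by move=> t; rewrite smulE E smodE /=; ring.
  rewrite int1Z; last exact: nice_smul.
  rewrite ft0_mult mulrA -invfM s2pi_sqr -fmorphV; congr (_ * _).
  apply: eq_int1 => t; rewrite mulrC; congr (_ * _); rewrite !ft0E.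
  by apply: eq_int1 => s; rewrite smodE /= mulrA -expiD; congr (expi _ * _); ring.
rewrite E2 mulrCA; congr (_ * _); rewrite -int1Z.
  by apply: eq_int1 => t; rewrite lE; ring.
have := nice_smul phi (aff1 y (oner_neq0 R) (ft0 g)).
by congr nice; apply/funext => t; rewrite aff1E mul1r.
Qed.

(** By [localised_kernel], two cut-offs, one on each side of a Fourier transform, turn the twofold
    transform of k in its second variable into some k . l up to a constant. Removing the cut-offs
    one after the other leaves lam zero on all twofold transforms, and these exhaust S. *)
Theorem functional_kprod0 (lam : S2 -> C) : clinf lam ->
  (forall k l, lam (kprod k l) = 0) -> forall h, lam h = 0.
Proof.
move=> cl H.
have H1 g k : lam (pft (mulop g (pft k))) = 0.
  apply: functional_mulop0 => // g'.
  have [l lE] := localised_kernel g g'.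
  have -> : mulop g' (pft (mulop g (pft k))) = ((2 * pi)^-1%:C * s4pi R) *: kprod k l.
    apply: plane_ext => x; rewrite /mulop /pft !slice_opt lE.
    apply: schwartz_ext => y; rewrite sliceE !schwartzZE optE /= -mulrA.
    by rewrite mulVKf ?s4pi_neq0.
  by rewrite (clinfZE cl) H mulr0.
have H2 k : lam (pft (pft k)) = 0.
  apply: (functional_mulop0 (lam := lam \o @pft R)) => [|g /=]; last exact: H1.
  exact: clinf_comp cl (pft_clin R).
by move=> h; rewrite -(pft_pift h) -(pft_pift (pift h)).
Qed.

End Density.

(** * Operators and multipliers *)

Section Correspondence.
Variable R : realType.
Local Notation C := R[i].
Local Notation S1 := (schwartz (line R)).
Local Notation S2 := (schwartz (plane R)).
Local Notation regL := (line_regular R).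
Local Notation s2pi := (s2pi R).
Local Notation s4pi := (s4pi R).
Implicit Types (A B : S1 -> S1) (phi psi : S1) (h k l m : S2) (T : S2 -> C).

Lemma eval_clinf (y : R) : clinf (fun phi => phi y).
Proof.
split=> [c f g|]; first by rewrite schwartz_linE.
by apply: domd_le (domd_snorm (line R)) => f; exact: cabs_snorm.
Qed.

Lemma diag_det : (0 : R) * 1 - 1 * 1 != 0.
Proof. by rewrite mul0r mulr1 sub0r oppr_eq0 oner_neq0. Qed.

(** The diagonal is reached as the slice at 0 of a sheared function, so that continuity is inherited
    from slices and affine substitutions. *)
Definition diag h : S1 := slice (aff2 0 0 diag_det h) 0.

Lemma diagE h (x : R) : diag h x = h (x, x).
Proof. by rewrite sliceE aff2E /=; congr (h (_, _)); ring. Qed.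

Lemma trace_clinf : clinf (fun h => int1 (diag h)).
Proof.
have c0 : clinf (fun h => int1 (slice h 0)).
  split=> [c f g|]; first by rewrite slice_lin (int_clinf R).1.
  have [n dn nE] := domd_slice (int_clinf R).2.
  apply: domd_le (domdZ (wt_ge0 0) dn) => h; exact: nE.
exact: clinf_comp c0 (aff2_clin _ _ diag_det).
Qed.

(** [kop l phi] is the integral over t of [phi t *: slice l t]. For fixed y the functional f -> A f
    y is continuous, and [functional_total] takes it under the integral. *)
Lemma opt_kop A (cA : clin A) l phi : A (kop l phi) = kop (opt cA l) phi.
Proof.
pose m := swap (opt (smul_clin regL phi) (swap l)).
have mE t : slice m t = phi t *: slice l t.
  by apply: schwartz_ext => y; rewrite schwartzZE !sliceE swapE optE smulE sliceE swapE.
have -> : kop l phi = total m.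
  by apply: schwartz_ext => y; rewrite kopE totalE; apply: eq_int1 => t; rewrite -!sliceE mE.
apply: schwartz_ext => y.
rewrite [LHS](functional_total (clinf_comp (eval_clinf y) cA) m) kopE.
by apply: eq_int1 => t /=; rewrite mE (clinZE cA) schwartzZE optE.
Qed.

Lemma opt_kprod A (cA : clin A) k l : opt cA (kprod k l) = kprod k (opt cA l).
Proof.
apply: plane_ext => x; rewrite slice_opt.
have E k' l' : slice (kprod k' l') x = s4pi^-1 *: kop l' (slice k' x).
  by apply: schwartz_ext => y; rewrite !schwartzZE sliceE kprodE kopE.
by rewrite !E (clinZE cA) (opt_kop cA).
Qed.

Lemma trace_opt_kop k m : int1 (diag (opt (kop_clin m) k)) = pairing k (swap m).
Proof.
apply: eq_int1 => x; rewrite diagE optE kopE.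
by apply: eq_int1 => y; rewrite swapE sliceE.
Qed.

(** Chosen so that the factor 1/sqrt 2 of [kernel_map] leaves the constant of [emb1]; divided by
    [s4pi] it also becomes the constant of [emb2]. *)
Let c0 : C := (Num.sqrt 2)%:C * s2pi^-1.

Let sqrt2_neq0 : (Num.sqrt 2)%:C != 0 :> C.
Proof.
have h : 0 < Num.sqrt 2 :> R by rewrite sqrtr_gt0.
by apply/negP => /eqP/(congr1 (@complex.Re R)) /= H; rewrite H ltxx in h.
Qed.

Let c0_neq0 : c0 != 0.
Proof. by rewrite mulf_neq0 ?invr_eq0 ?s2pi_neq0. Qed.

Let pi2_neq0 : (2 * pi)%:C != 0 :> C.
Proof. by rewrite -s2pi_sqr mulf_neq0 ?s2pi_neq0. Qed.

Let c0_s4pi : c0 * s4pi^-1 = (2 * pi)^-1%:C.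
Proof.
have E : Num.sqrt (4 * pi) = Num.sqrt 2 * Num.sqrt (2 * pi) :> R.
  by rewrite -sqrtrM // mulrA -natrM.
have -> : s4pi = (Num.sqrt 2)%:C * s2pi by rewrite -rmorphM -E.
rewrite /c0 invfM mulrACA mulfV // mul1r -invfM s2pi_sqr.
by rewrite -fmorphV.
Qed.

Definition symbol A : S2 -> C :=
  fun h => c0 * int1 (fun x => A (slice (Vinv h) x) x).

Lemma symbolE A (cA : clin A) h : symbol A h = c0 * int1 (diag (opt cA (Vinv h))).
Proof. by congr (_ * _); apply: eq_int1 => x; rewrite diagE optE. Qed.

Lemma symbol_clinf A : clin A -> clinf (symbol A).
Proof.
move=> cA; have := clinfZ c0 (clinf_comp trace_clinf (clin_comp (opt_clin cA) (@Vinv_clin R))).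
by congr clinf; apply/funext => h; rewrite symbolE.
Qed.

Lemma symbol_kprod A (cA : clin A) k l :
  symbol A (V (kprod k l)) = (2 * pi)^-1%:C * pairing k (swap (opt cA l)).
Proof.
rewrite symbolE VinvK opt_kprod /kprod (clinfZE trace_clinf) trace_opt_kop mulrA.
by rewrite c0_s4pi.
Qed.

Lemma symbol_tensor A : clin A -> forall psi phi,
  symbol A (V (tensor psi phi)) = c0 * int1 (fun x => A phi x * psi x).
Proof.
move=> cA psi phi; congr (_ * _); apply: eq_int1 => x.
by rewrite VinvK slice_tensor (clinZE cA) schwartzZE mulrC.
Qed.

Lemma dtwistl_symbol A (cA : clin A) h :
  dtwistl (symbol A) h = emb2 (V (opt cA (Vinv h))).
Proof.
apply/funext => g; rewrite /dtwistl -{1}(VK h) -(VK g) twist_V symbol_kprod.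
by rewrite emb2_V.
Qed.

Lemma emb2_inj : injective (@emb2 R).
Proof.
move=> f g fg; apply: pairing_ext => psi phi.
have := congr1 (fun T => T (tensor psi phi)) fg; rewrite !emb2E.
by apply: mulfI; rewrite fmorphV invr_eq0.
Qed.

Lemma densityE (g : S2) : density (emb2 g) = g.
Proof. by apply: emb2_inj; exact: (xgetPex 0 (ex_intro [set f | emb2 f = emb2 g] g erefl)). Qed.

Lemma symbol_ML A : clin A -> ML R (symbol A).
Proof.
move=> cA; split; first exact/contlin_functionalP/symbol_clinf.
by move=> f; rewrite (dtwistl_symbol cA); eexists.
Qed.

Lemma dtwist_symbol A B : clin A -> clin B ->
  dtwist (symbol A) (symbol B) = symbol (A \o B).
Proof.
move=> cA cB; apply/funext => h.
rewrite /dtwist (dtwistl_symbol cB) densityE /symbol VinvK; congr (_ * _).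
by apply: eq_int1 => x; rewrite slice_opt.
Qed.

Lemma kernel_map_symbol A : clin A ->
  kernel_map (wigner (symbol A)) = fun phi => emb1 (A phi).
Proof.
move=> cA; apply/funext => phi; apply/funext => psi.
rewrite /kernel_map /wigner WbarinvE symbol_tensor // /c0 /emb1 mulrA mulrA.
rewrite fmorphV mulVf // mul1r; congr (_ * _).
by rewrite fmorphV.
Qed.

Lemma symbol_inj A B : clin A -> clin B -> symbol A = symbol B -> A = B.
Proof.
move=> cA cB AB; apply/funext => phi; apply: emb1_separates => psi.
apply: (mulfI c0_neq0).
by rewrite -!symbol_tensor // AB.
Qed.

Lemma symbol_lin (c : C) A B : clin A -> clin B ->
  symbol (fun f => c *: A f + B f) = c *: symbol A + symbol B.
Proof.
move=> cA cB; apply/funext => h.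
transitivity (c * symbol A h + symbol B h); last by [].
rewrite (symbolE (clin_lin c cA cB)) (symbolE cA) (symbolE cB) mulrCA -mulrDr.
rewrite -int1_lin; [|exact: s1_nice..].
by congr (_ * _); apply: eq_int1 => x; rewrite !diagE !optE schwartz_linE.
Qed.

Lemma symbol0 : symbol (fun=> 0) = 0.
Proof. by apply/funext => h; rewrite /symbol int1_0 mulr0. Qed.

Lemma ML_functional T : ML R T -> exists r : S2 -> S2, forall k l,
  T (V (kprod k l)) = (2 * pi)^-1%:C * pairing k (swap (r l)).
Proof.
move=> [_ rT]; exists (fun l => Vinv (density (dtwistl T (V l)))) => k l.
have [g _ gE] := rT (V l).
by rewrite -twist_V -[T _]/(dtwistl T (V l) (V k)) -gE densityE -{1}(VK g) emb2_V.
Qed.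

Lemma kprod_tensor b psi l : kprod (tensor psi b) l = s4pi^-1 *: tensor psi (kop l b).
Proof.
apply: schwartz_ext => -[x y].
rewrite kprodE schwartzZE tensorE /= kopE; congr (_ * _).
rewrite -int1Z.
  by apply: eq_int1 => t; rewrite tensorE mulrA.
have := s1_nice (smul regL b (slice (swap l) y)).
by congr nice; apply/funext => t; rewrite smulE sliceE swapE.
Qed.

Lemma ML_operator T : ML R T -> exists2 A : S1 -> S1, clin A &
  forall psi phi, T (V (tensor psi phi)) = c0 * int1 (fun x => A phi x * psi x).
Proof.
move=> MT; have [r rE] := ML_functional MT.
have cT : clinf T by apply/contlin_functionalP; exact: MT.1.
(* The Gaussian is 1 at 0, hence not the zero function, so it cannot be orthogonal to every Schwartz
   function; it plays the part of gamma. *)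
have [b bE] : exists b : S1, int1 (fun x => gaussS R x * b x) != 0.
  apply: contrapT => H; suff : gaussS R = 0.
    move=> /(congr1 (fun f : S1 => f 0)) /eqP.
    by rewrite gaussSE /gauss expr0n /= mul0r oppr0 expR0 oner_eq0.
  apply: emb1_separates => psi; rewrite [RHS](eq_int1 (g := fun=> 0)) ?int1_0.
    by apply: contrapT => H1; apply: H; exists psi; apply/eqP.
  by move=> x; rewrite mul0r.
set I := int1 _ in bE.
have kopb phi : kop (tensor (gaussS R) phi) b = I *: phi.
  apply: schwartz_ext => y; rewrite kopE schwartzZE mulrC -int1Z; last exact: nice_smul.
  by apply: eq_int1 => t; rewrite tensorE /=; ring.
have c4 := s4pi_neq0 R.
have tE psi phi : tensor psi phi = (s4pi * I^-1) *: kprod (tensor psi b) (tensor (gaussS R) phi).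
  rewrite kprod_tensor kopb (clinZE (tensor_clin psi)) !scalerA.
  by rewrite [s4pi * _]mulrC mulfK // mulVf // scale1r.
(* The factors of [tE] and [rE], divided by the [c0] of the claim. *)
pose K := c0^-1 * (s4pi * I^-1 * (2 * pi)^-1%:C).
pose A phi := K *: kop (r (tensor (gaussS R) phi)) b.
have AE psi phi : T (V (tensor psi phi)) = c0 * int1 (fun x => A phi x * psi x).
  rewrite tE (clinZE (@V_clin R)) (clinfZE cT) rE pairingC pairing_tensor.
  rewrite (eq_int1 (f := fun x => A phi x * psi x)
    (g := fun x => K * (kop (r (tensor (gaussS R) phi)) b x * psi x))); last first.
    by move=> x; rewrite schwartzZE mulrA.
  rewrite int1Z; last exact: nice_smul.
  by rewrite [RHS]mulrA mulrA; congr (_ * _); rewrite /K mulVKf.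
have intA psi phi : int1 (fun x => A phi x * psi x) = c0^-1 * T (V (tensor psi phi)).
  by rewrite AE mulKf.
have cf psi : clinf (fun phi => T (V (tensor psi phi))).
  exact: clinf_comp cT (clin_comp (@V_clin R) (tensor_clin psi)).
have cA psi : clinf (fun phi => int1 (fun x => A phi x * psi x)).
  by have := clinfZ c0^-1 (cf psi); congr clinf; apply/funext => phi; rewrite intA.
(* [r] comes from a choice of densities, so linearity is not visible in the definition of A. It
   follows from the weak formula, which is linear in phi and determines A phi. *)
exists A => //; apply: weakly_continuous_clin => // c f g.
apply: emb1_separates => psi.
rewrite (cA psi).1 -int1_lin; [|exact: nice_smul..].
by apply: eq_int1 => x; rewrite schwartz_linE mulrDl mulrA.
Qed.

Theorem ML_symbol T : ML R T -> exists2 A, clin A & T = symbol A.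
Proof.
move=> MT; have [r rE] := ML_functional MT; have [A cA AE] := ML_operator MT.
have cT : clinf T by apply/contlin_functionalP; exact: MT.1.
have cS := symbol_clinf cA.
exists A => //.
(* It suffices to test against tensors. Composing a tensor with l gives a multiple of another
   tensor, and on tensors T and [symbol A] agree. *)
have rA l : swap (r l) = swap (opt cA l).
  apply: pairing_ext => psi b; rewrite ![pairing _ (tensor _ _)]pairingC.
  have i0 : (2 * pi)^-1%:C != 0 :> C by rewrite fmorphV invr_eq0.
  apply: (mulfI i0).
  transitivity (T (V (kprod (tensor psi b) l))); first exact/esym/rE.
  transitivity (symbol A (V (kprod (tensor psi b) l))); last exact: symbol_kprod.
  rewrite kprod_tensor (clinZE (@V_clin R)).
  by rewrite (clinfZE cT) (clinfZE cS) AE symbol_tensor.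
have E k l : -1 * symbol A (V (kprod k l)) + T (V (kprod k l)) = 0.
  by rewrite rE symbol_kprod rA mulN1r addNr.
have c := clinf_comp (clinf_lin (-1) cS cT) (@V_clin R).
apply/funext => h; have := functional_kprod0 c E (Vinv h).
by rewrite /= VK mulN1r => /eqP; rewrite addrC subr_eq0 => /eqP.
Qed.

Definition operator T : S1 -> S1 := xget (fun=> 0) [set A | clin A /\ T = symbol A].

Lemma operator_symbol A : clin A -> operator (symbol A) = A.
Proof.
move=> cA; rewrite /operator.
have [cB E] := xgetPex (fun=> 0) (ex_intro [set B | clin B /\ symbol A = symbol B] A (conj cA erefl)).
exact/esym/symbol_inj.
Qed.

End Correspondence.

Theorem theorem1 (R : realType) :
  [set kernel_map (wigner T) | T in ML R] =
    [set (fun phi => emb1 (A phi))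
      | A in contlin (schwartz (line R)) (schwartz (line R))] /\
  is_algebra (ML R) (@dtwist R) /\
  exists Phi : (schwartz (plane R) -> complex R) ->
               (schwartz (line R) -> schwartz (line R)),
    (forall T, ML R T ->
       kernel_map (wigner T) = (fun phi => emb1 (Phi T phi))) /\
    is_algebra_iso (ML R) (@dtwist R)
      (contlin (schwartz (line R)) (schwartz (line R))) (fun A B => A \o B)
      Phi.
Proof.
split; [|split; [split|exists (@operator R); split; [|split; [split|..]]]].
- apply/seteqP; split=> [_ [T /ML_symbol[A cA ->] <-]|_ [A /contlin_operatorP cA <-]].
    by exists A; [exact/contlin_operatorP|rewrite kernel_map_symbol].
  by exists (symbol A); [exact: symbol_ML|rewrite kernel_map_symbol].
- split; first by rewrite -symbol0; apply/symbol_ML/clin0.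
  move=> c _ _ /ML_symbol[A cA ->] /ML_symbol[B cB ->].
  by rewrite -symbol_lin //; apply/symbol_ML/clin_lin.
- move=> _ _ /ML_symbol[A cA ->] /ML_symbol[B cB ->].
  by rewrite dtwist_symbol //; apply/symbol_ML/clin_comp.
- move=> c _ _ _ /ML_symbol[A cA ->] /ML_symbol[B cB ->] /ML_symbol[D cD ->].
  rewrite -symbol_lin // !dtwist_symbol //; last exact: clin_lin.
  by rewrite -symbol_lin //; exact: clin_comp.
- move=> c _ _ _ /ML_symbol[A cA ->] /ML_symbol[B cB ->] /ML_symbol[D cD ->].
  rewrite -symbol_lin // !dtwist_symbol //; last exact: clin_lin.
  rewrite -symbol_lin; [|exact: clin_comp..].
  (* Composition is linear in its right factor because the left factor is a linear operator. *)
  by congr symbol; apply/funext => f /=; rewrite cA.1.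
- move=> _ _ _ /ML_symbol[A cA ->] /ML_symbol[B cB ->] /ML_symbol[D cD ->].
  by rewrite !dtwist_symbol //; exact: clin_comp.
- by move=> _ /ML_symbol[A cA ->]; rewrite operator_symbol // kernel_map_symbol.
- by move=> _ /ML_symbol[A cA ->]; rewrite operator_symbol //; exact/contlin_operatorP.
- move=> _ _ /set_mem/ML_symbol[A cA ->] /set_mem/ML_symbol[B cB ->].
  by rewrite !operator_symbol // => ->.
- by move=> A /contlin_operatorP cA; exists (symbol A); [exact: symbol_ML|exact: operator_symbol].
- move=> c _ _ /ML_symbol[A cA ->] /ML_symbol[B cB ->].
  by rewrite -symbol_lin // !operator_symbol //; exact: clin_lin.
- move=> _ _ /ML_symbol[A cA ->] /ML_symbol[B cB ->].
  by rewrite dtwist_symbol // !operator_symbol //; exact: clin_comp.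
Qed.
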